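(* Let $f\colon\mathbb{C}\to\mathbb{C}$ be a transcendental entire function and let $U$ be an (invariant) Siegel disk of $f$ such that $\infty$ is accessible from $U$. Then there are no periodic points of $f$ in $\partial U$.
   Context: $\partial U$ denotes the boundary of $U$ in $\mathbb{C}$. $\infty$ is accessible from $U$ if there is a curve $\gamma\colon[0,1)\to U$ with $\gamma(t)\to\infty$ as $t\to1^-$. A Siegel disk is an invariant Fatou component $U$ ($f(U)\subset U$) on which $f$ is conformally conjugate to an irrational rotation of the unit disk. *)

(* Defs.v *)
From HB Require Import structures.
From mathcomp Require Import all_boot all_order all_algebra.
From mathcomp Require Import complex.
From mathcomp Require Import all_classical all_reals all_analysis.

Set Implicit Arguments.
Unset Strict Implicit.
Unset Printing Implicit Defensive.

Import Order.TTheory GRing.Theory Num.Theory.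
Import numFieldNormedType.Exports.
Local Open Scope classical_set_scope.
Local Open Scope ring_scope.
Local Open Scope complex_scope.

Section ComplexDynamics.
Variable R : realType.

(* The regular-module alias [^o] carries the normed topology of R[i] over
   itself, so that [derivable f z 1] is complex differentiability at z. *)
Local Notation C := (R[i]^o).
Local Notation sphere := (one_point_compactification C).
Local Notation modulus := (@ComplexField.Normc.normc R).

Implicit Types (f phi : C -> C) (A B U V K : set C) (z w : C).

Definition holomorphic_on A f := forall z, A z -> derivable f z 1.

Definition entire f := holomorphic_on setT f.

Definition transcendental_entire f :=
  entire f /\ ~ exists p : {poly R[i]}, forall z, f z = p.[z].

(* Chordal metric on the Riemann sphere; [None] is the point at infinity. *)
Definition chordal (x y : sphere) : R :=
  match x, y with
  | Some z, Some w => 2 * modulus (z - w) /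
      (Num.sqrt (1 + modulus z ^+ 2) * Num.sqrt (1 + modulus w ^+ 2))
  | Some z, None | None, Some z => 2 / Num.sqrt (1 + modulus z ^+ 2)
  | None, None => 0
  end.

(* Montel normality: every sequence in the family has a subsequence that
   converges, uniformly on compact subsets of V, in the Riemann sphere. *)
Definition normal_on V (F : set (C -> C)) :=
  forall u : nat -> C -> C, (forall n, F (u n)) ->
  exists s : nat -> nat, {homo s : m n / (m < n)%N} /\
  exists g : C -> sphere,
  forall K, compact K -> K `<=` V ->
  forall e : R, 0 < e ->
  \forall n \near \oo, forall z, K z -> chordal (Some (u (s n) z)) (g z) < e.

Definition Fatou f : set C :=
  [set z | exists V, [/\ open V, V z & normal_on V [set iter n f | n in setT]]].

Definition Fatou_component f U :=
  exists2 z, Fatou f z & U = connected_component (Fatou f) z.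

Definition unit_disk : set C := [set z | `|z| < 1].

Definition rotation (theta : R) : C -> C := fun z =>
  (cos (2 * pi * theta) +i* sin (2 * pi * theta)) * z.

Definition conformal_iso A B phi :=
  [/\ set_bij A B phi, holomorphic_on A phi &
      exists2 psi : C -> C, holomorphic_on B psi &
        forall z, A z -> psi (phi z) = z].

Definition Siegel_disk f U :=
  [/\ Fatou_component f U, f @` U `<=` U &
      exists theta : R, irrational theta /\
      exists2 phi, conformal_iso unit_disk U phi &
        forall z, unit_disk z -> f (phi z) = phi (rotation theta z)].

(* Only the values of the curve on [0, 1[ matter. *)
Definition infinity_accessible U :=
  exists gamma : R -> C,
  [/\ {within `[0, 1[, continuous gamma},
      forall t, t \in `[0, 1[ -> U (gamma t) &
      modulus (gamma t) @[t --> 1^'-] --> +oo].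

Definition boundary A : set C := closure A `\` A°.

Definition periodic_point f z := exists2 n, (0 < n)%N & iter n f z = z.

End ComplexDynamics.

(* Main.v *)
Require Import Defs.
From HB Require Import structures.
From mathcomp Require Import all_boot all_order all_algebra.
From mathcomp Require Import complex.
From mathcomp Require Import all_classical all_reals all_analysis.
From mathcomp Require Import ring lra.

Set Implicit Arguments.
Unset Strict Implicit.
Unset Printing Implicit Defensive.

Import Order.TTheory GRing.Theory Num.Theory.
Import numFieldNormedType.Exports.
Local Open Scope classical_set_scope.
Local Open Scope ring_scope.
Local Open Scope complex_scope.

(** Let [phi] conjugate an irrational rotation of the unit disk to [f] on [U].
    A curve in [U] tending to infinity is the image of a curve that lands at a
    point of the unit circle: otherwise the latter would cross a circular
    segment along arcs on which [1 / (sqrt (phi - p) + c)], bounded for a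
    suitable [c], tends to zero uniformly, against the maximum principle
    (Koebe).  Since [f] is bounded on bounded sets, rotating the curve backwards
    gives again a curve along which [phi] tends to infinity, so the endpoints of
    such curves are dense in the circle.

    If a boundary point [p] is fixed by the [n]-th iterate, points [w] of the
    disk with [phi w] near [p] accumulate at some [xi] on the circle, and their
    [n]-fold rotations [w'] accumulate at another point [xi'], with [phi w'] also
    near [p].  Choose a curve as above ending in each of the two arcs between
    [xi] and [xi'].  The circle through [w] and [w'] splits into two arcs, each
    avoiding the tail of one of the curves; closing the image of each arc by the
    segment from [phi w] to [phi w'] gives a closed curve disjoint from a
    connected unbounded set containing [phi 0], hence of index zero around
    [phi 0].  But together they bound the image of the full circle, whose index
    around [phi 0] is one.  All indices are only needed modulo two, where
    vanishing means the existence of a continuous square root. *)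

(** * Modulus, continuity and complex differentiability *)

(** The boundary of [U] may be wild and [phi] need not extend to the circle, so no point of the
    circle can be assigned to [p]; compactness only yields points [w] accumulating at some [xi]. The
    segment from [phi w] to [phi w'] may leave [U], which is harmless: it stays in a small disc
    around [p], while the two unbounded connected sets keep a fixed positive distance from [p]. In
    the landing argument smallness is known on the arc, but on the chord that closes the circular
    segment there is only a bound. A high power of a linear polynomial, smaller on the chord than at
    the test point, tips the balance. The constant [c] is the value of the root at [0]: as [phi] is
    injective and omits [p], the root and its opposite have no common value, so the root stays away
    from [- c]. Arcs may intersect themselves, so separation is never stated through an inside and
    an outside: a loop of odd index around a point meets every connected set joining that point to
    infinity. Parity is convenient because a root of [x - z] turns into one of [x - w] on
    multiplication by a principal root. *)

Section Modulus.
Variable R : realType.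
Local Notation C := R[i].
Local Notation Co := (R[i]^o).
Local Notation nm := (@ComplexField.Normc.normc R).
Implicit Types (z w : C) (f g : C -> C).

Lemma nmE z : `|z| = (nm z)%:C :> R[i]. Proof. by []. Qed.
Lemma nm_ge0 z : 0 <= nm z. Proof. by case: z => a b; rewrite /= sqrtr_ge0. Qed.
Lemma nm0 : nm 0 = 0. Proof. exact: ComplexField.Normc.normc0. Qed.
Lemma nm1 : nm 1 = 1. Proof. exact: ComplexField.Normc.normc1. Qed.
Lemma nmM z w : nm (z * w) = nm z * nm w. Proof. exact: ComplexField.Normc.normcM. Qed.
Lemma nmN z : nm (- z) = nm z. Proof. exact: normcN. Qed.
Lemma nmV z : nm z^-1 = (nm z)^-1. Proof. exact: ComplexField.Normc.normcV. Qed.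
Lemma nmD z w : nm (z + w) <= nm z + nm w. Proof. exact: le_normcD. Qed.
Lemma nm_eq0 z : (nm z == 0) = (z == 0).
Proof. by apply/eqP/eqP => [/ComplexField.Normc.eq0_normc|->]; rewrite ?nm0. Qed.
Lemma nm_gt0 z : (0 < nm z) = (z != 0).
Proof. by rewrite lt_def nm_ge0 andbT nm_eq0. Qed.
Lemma nmX z n : nm (z ^+ n) = nm z ^+ n.
Proof. by elim: n => [|n IH]; rewrite ?expr0 ?nm1// !exprS nmM IH. Qed.
Lemma nmBC z w : nm (z - w) = nm (w - z). Proof. by rewrite -nmN opprB. Qed.
Lemma nm_tri z w t : nm (z - t) <= nm (z - w) + nm (w - t).
Proof. by apply: le_trans (nmD _ _); rewrite addrA subrK. Qed.
Lemma nm_sub z w : nm z - nm w <= nm (z - w).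
Proof. by rewrite lerBlDr; apply: le_trans (nmD _ _); rewrite subrK. Qed.
Lemma nm_real (a : R) : nm a%:C = `|a|.
Proof. by rewrite /= expr0n addr0 sqrtr_sqr. Qed.
Lemma nm_Re z : `|complex.Re z| <= nm z.
Proof. by case: z => a b /=; rewrite -sqrtr_sqr ler_wsqrtr// lerDl sqr_ge0. Qed.
Lemma nm_Im z : `|complex.Im z| <= nm z.
Proof. by case: z => a b /=; rewrite -sqrtr_sqr ler_wsqrtr// lerDr sqr_ge0. Qed.
Lemma nm_ReIm z : nm z <= `|complex.Re z| + `|complex.Im z|.
Proof.
case: z => a b; have -> : a +i* b = a%:C + 'i%C * b%:C :> R[i].
  by rewrite [LHS]complexE.
apply: le_trans (nmD _ _) _; rewrite nmM !nm_real /=.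
by rewrite expr0n expr1n add0r sqrtr1 !mul1r !mul0r ?subr0 ?add0r ?addr0.
Qed.
Lemma nm_sqr z : nm z ^+ 2 = complex.Re z ^+ 2 + complex.Im z ^+ 2.
Proof. by case: z => a b /=; rewrite sqr_sqrtr// addr_ge0 ?sqr_ge0. Qed.

(** A positive element of [R[i]] has zero imaginary part, so complex radii are real radii in
    disguise; from here on all epsilons are real. *)
Lemma nbhs_cP z (A : set C) :
  nbhs (z : Co) A <-> exists2 d : R, 0 < d & forall w, nm (w - z) < d -> A w.
Proof.
split.
  move=> /nbhs_ballP [e /= e0 eA].
  have e_real : e = (complex.Re e)%:C by case: e e0 {eA} => a b; rewrite ltcE /= => /andP[/eqP -> _].
  exists (complex.Re e); first by rewrite -ltcR -e_real.
  move=> w wz; apply: eA; rewrite /ball /= nmE e_real ltcR -/nm. by rewrite nmBC.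
move=> [d d0 dA]; apply/nbhs_ballP; exists d%:C => /=; first by rewrite ltcR.
by move=> w; rewrite /ball /= nmE ltcR nmBC => /dA.
Qed.

Lemma cont_cP f z : {for z, continuous (f : Co -> Co)} <->
  forall e : R, 0 < e -> exists2 d : R, 0 < d &
    forall w, nm (w - z) < d -> nm (f w - f z) < e.
Proof.
split.
  move=> fz e e0; have /fz : nbhs (f z : Co) [set w | nm (w - f z) < e] by apply/nbhs_cP; exists e.
  by move=> /nbhs_cP[d d0 dH]; exists d.
move=> H A /nbhs_cP [e /H [d d0 dH] eA]; by apply/nbhs_cP; exists d => // w /dH /eA.
Qed.

Lemma cont_rP (f : R -> C) t : {for t, continuous (f : R -> Co)} <->
  forall e : R, 0 < e -> exists2 d : R, 0 < d &
    forall s, `|s - t| < d -> nm (f s - f t) < e.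
Proof.
split.
  move=> fz e e0; have /fz : nbhs (f t : Co) [set w | nm (w - f t) < e] by apply/nbhs_cP; exists e.
  by move=> /nbhs_ballP[d d0 dH]; exists d => // s st; apply: dH; rewrite /ball /= distrC.
move=> H A /nbhs_cP [e /H [d d0 dH] eA]; apply/nbhs_ballP; exists d => // s; rewrite /ball /= distrC.
by move=> /dH /eA.
Qed.

Lemma cont_crP (f : C -> R) z : {for z, continuous (f : Co -> R)} <->
  forall e : R, 0 < e -> exists2 d : R, 0 < d &
    forall w, nm (w - z) < d -> `|f w - f z| < e.
Proof.
split.
  move=> fz e e0; have /fz : nbhs (f z) [set w | `|w - f z| < e].
    by apply/nbhs_ballP; exists e => // s; rewrite /ball /= distrC.
  by move=> /nbhs_cP[d d0 dH]; exists d.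
move=> H A /nbhs_ballP [e /H [d d0 dH] eA]; apply/nbhs_cP; exists d => // w /dH ?.
by apply: eA; rewrite /ball /= distrC.
Qed.

(** The coordinates stay in the compact square of half-side [M]. The limit is stated as a point
    visited infinitely often, which spares the extraction of a subsequence. *)
Lemma bolzano_weierstrass (u : nat -> C) (M : R) : (forall n, nm (u n) <= M) ->
  exists z, forall e : R, 0 < e -> forall N, exists2 n, (N <= n)%N & nm (u n - z) < e.
Proof.
move=> uM.
pose v n : R * R := (complex.Re (u n), complex.Im (u n)).
have vM : \forall n \near \oo, (`[- M, M] `*` `[- M, M]) (v n).
  near=> n; split => /=; rewrite in_itv /= -ler_norml;
  [exact: le_trans (nm_Re _) (uM _) | exact: le_trans (nm_Im _) (uM _)].
have [[a b] [_ cl]] := @compact_setX _ _ _ _ (@segment_compact R (- M) M) (@segment_compact R (- M) M) (v @ \oo) _ vM.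
exists (a +i* b) => e e0 N.
have e2 : 0 < e / 2 by rewrite divr_gt0.
have A : nbhs (a, b) (ball a (e / 2) `*` ball b (e / 2)).
  by exists (ball a (e/2), ball b (e/2)) => //=; split; apply: nbhsx_ballx.
have B : \forall n \near \oo, [set v k | k in [set k | (N <= k)%N]] (v n).
  by exists N => // n /= Nn; exists n.
have [_ [[n Nn <-] [/= h1 h2]]] := cl _ _ B A; exists n => //.
apply: le_lt_trans (nm_ReIm _) _; rewrite [e]splitr.
case: (u n) h1 h2 => x y; rewrite /ball /= => h1 h2.
by apply: ltrD; rewrite distrC.
Unshelve. all: by end_near.
Qed.

Definition ctsC f z := {for z, continuous (f : Co -> Co)}.
Definition ctsR (f : R -> C) t := {for t, continuous (f : R -> Co)}.
Section Algebra.
Variables (T : topologicalType) (f g : T -> C) (t : T).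
Let ct (h : T -> C) := {for t, continuous (h : T -> Co)}.
Lemma ctM0 : ct f -> ct g -> ct (fun x => f x * g x).
Proof. exact: (@continuousM R[i] T f g t). Qed.
Lemma ctD0 : ct f -> ct g -> ct (fun x => f x + g x).
Proof. exact: (@continuousD R[i] Co T f g t). Qed.
Lemma ctB0 : ct f -> ct g -> ct (fun x => f x - g x).
Proof. exact: (@continuousB R[i] Co T f g t). Qed.
Lemma ctV0 : f t != 0 -> ct f -> ct (fun x => (f x)^-1).
Proof. exact: (@continuousV R[i] T f t). Qed.
End Algebra.
Lemma ctM f g z : ctsC f z -> ctsC g z -> ctsC (fun x => f x * g x) z.
Proof. exact: ctM0. Qed.
Lemma ctD f g z : ctsC f z -> ctsC g z -> ctsC (fun x => f x + g x) z.
Proof. exact: ctD0. Qed.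
Lemma ctV f z : f z != 0 -> ctsC f z -> ctsC (fun x => (f x)^-1) z.
Proof. exact: ctV0. Qed.
Lemma ctK (a z : C) : ctsC (fun=> a) z. Proof. exact: cst_continuous. Qed.
Lemma ct_id z : ctsC (fun w => w) z. Proof. by move=> A. Qed.
Lemma ct_comp f g z : ctsC f z -> ctsC g (f z) -> ctsC (fun x => g (f x)) z.
Proof. exact: continuous_comp. Qed.
Lemma crM (f g : R -> C) t : ctsR f t -> ctsR g t -> ctsR (fun x => f x * g x) t.
Proof. exact: ctM0. Qed.
Lemma crD (f g : R -> C) t : ctsR f t -> ctsR g t -> ctsR (fun x => f x + g x) t.
Proof. exact: ctD0. Qed.
Lemma crB (f g : R -> C) t : ctsR f t -> ctsR g t -> ctsR (fun x => f x - g x) t.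
Proof. exact: ctB0. Qed.
Lemma crV (f : R -> C) t : f t != 0 -> ctsR f t -> ctsR (fun x => (f x)^-1) t.
Proof. exact: ctV0. Qed.
Lemma crK (a : C) t : ctsR (fun=> a) t. Proof. exact: cst_continuous. Qed.
Lemma cr_comp (f : R -> C) g t : ctsR f t -> ctsC g (f t) -> ctsR (fun x => g (f x)) t.
Proof. exact: continuous_comp. Qed.
Lemma cr_re (t : R) : ctsR (fun x => x%:C) t.
Proof. by apply/cont_rP => e e0; exists e => // s; rewrite -[in nm _]rmorphB nm_real. Qed.

Lemma ctN f z : ctsC f z -> ctsC (fun x => - f x) z.
Proof. exact: (@continuousN R[i] Co Co f z). Qed.
Lemma crN (f : R -> C) t : ctsR f t -> ctsR (fun x => - f x) t.
Proof. exact: (@continuousN R[i] Co R f t). Qed.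

Lemma ctsCP f z : ctsC f z <-> forall e : R, 0 < e -> exists2 d : R, 0 < d &
    forall w, nm (w - z) < d -> nm (f w - f z) < e.
Proof. exact: cont_cP. Qed.
Lemma ctsRP (f : R -> C) t : ctsR f t <-> forall e : R, 0 < e -> exists2 d : R, 0 < d &
    forall s, `|s - t| < d -> nm (f s - f t) < e.
Proof. exact: cont_rP. Qed.

End Modulus.
Global Opaque ctsC ctsR.

Ltac cts := repeat match goal with
  | H : ctsC ?f _ |- ctsC ?g _ => constr_eq f g; exact H
  | H : ctsR ?f _ |- ctsR ?g _ => constr_eq f g; exact H
  | H : ctsC ?f _ |- ctsC (fun x => ?g x) _ => constr_eq f g; exact H
  | H : ctsR ?f _ |- ctsR (fun x => ?g x) _ => constr_eq f g; exact H
  | |- ctsC (fun x => x) _ => exact: ct_id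
  | |- ctsC (fun x => ?a) _ => exact: ctK
  | |- ctsC (fun x => @Algebra.add _ (@?f x) (@?g x)) _ => apply: (@ctD _ f g)
  | |- ctsC (fun x => @Algebra.opp _ (@?f x)) _ => apply: (@ctN _ f)
  | |- ctsC (fun x => @GRing.mul _ (@?f x) (@?g x)) _ => apply: (@ctM _ f g)
  | |- ctsR (fun x => ?a) _ => exact: crK
  | |- ctsR (fun x => @Algebra.add _ (@?f x) (@?g x)) _ => apply: (@crD _ f g)
  | |- ctsR (fun x => @Algebra.opp _ (@?f x)) _ => apply: (@crN _ f)
  | |- ctsR (fun x => @GRing.mul _ (@?f x) (@?g x)) _ => apply: (@crM _ f g)
  | |- ctsR (fun x => real_complex _ x) _ => exact: cr_re
  end.

Section Differentiability.
Variable R : realType.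
Local Notation C := R[i].
Local Notation Co := (R[i]^o).
Local Notation nm := (@ComplexField.Normc.normc R).
Implicit Types (z w : C) (f g : C -> C).

(** Carathéodory's form of differentiability: [g] is the difference quotient and [g z] the
    derivative, so the calculus rules reduce to continuity of [g]. *)
Definition cdiff f z := exists2 g : C -> C, ctsC g z & forall w, f w - f z = g w * (w - z).

Lemma derivable_cdiff f z : derivable (f : Co -> Co) z 1 -> cdiff f z.
Proof.
move=> fz.
pose g w := if w == z then 'D_1 (f : Co -> Co) z else (f w - f z) / (w - z).
exists g; last first.
  move=> w; rewrite /g; case: eqP => [->|/eqP wz]; first by rewrite !subrr mulr0.
  by rewrite mulrVK// unitfE subr_eq0.
apply/ctsCP => e e0.
have /cvg_ex [l hl] := fz.
have Dl : 'D_1 (f : Co -> Co) z = l by apply: cvg_lim => //; exact: norm_hausdorff.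
have : nbhs (l : Co) [set w | nm (w - l) < e] by apply/nbhs_cP; exists e.
move=> /hl; rewrite /= => -[d /= d0 dH].
have : nbhs (0 : Co) [set w | w != 0 -> nm (w^-1 * (f (w + z) - f z) - l) < e].
  apply/nbhs_ballP; exists d => // w wd w0; have := dH w wd w0.
  by rewrite /= [w *: _]mulr1.
move=> /nbhs_cP [r r0 rH]; exists r => // w wz.
rewrite /g eqxx; case: eqP => [_|/eqP wz0]; first by rewrite subrr nm0.
have wz1 : w - z != 0 by rewrite subr_eq0.
have /= := rH (w - z); rewrite subr0 => /(_ wz wz1).
by rewrite subrK mulrC Dl.
Qed.

Lemma cdiff_cont f z : cdiff f z -> ctsC f z.
Proof.
move=> [g gz fg].
have E : (fun w => g w * (w - z) + f z) = f by apply/funext => w; rewrite -fg subrK.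
suff: ctsC (fun w => g w * (w - z) + f z) z by rewrite E.
by cts.
Qed.

Lemma cdiff_cst a z : cdiff (fun=> a) z.
Proof. by exists (fun=> 0); [exact: ctK|move=> w; rewrite subrr mul0r]. Qed.
Lemma cdiff_id z : cdiff id z.
Proof. by exists (fun=> 1); [exact: ctK|move=> w; rewrite mul1r]. Qed.
Lemma cdiffD f g z : cdiff f z -> cdiff g z -> cdiff (fun w => f w + g w) z.
Proof.
move=> [f' f'z ff] [g' g'z gg]; exists (fun w => f' w + g' w); first by cts.
by move=> w; rewrite mulrDl -ff -gg; ring.
Qed.
Lemma cdiffM f g z : cdiff f z -> cdiff g z -> cdiff (fun w => f w * g w) z.
Proof.
move=> fz gz; have fc := cdiff_cont fz; case: fz gz => [f' f'z ff] [g' g'z gg].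
exists (fun w => f w * g' w + f' w * g z).
  by cts.
by move=> w; rewrite mulrDl -mulrA -gg mulrAC -ff; ring.
Qed.
Lemma cdiffX f n z : cdiff f z -> cdiff (fun w => f w ^+ n) z.
Proof.
move=> fz; elim: n => [|n IH].
  by rewrite (_ : (fun _ => _) = fun=> 1); [exact: cdiff_cst|apply/funext => w; rewrite expr0].
rewrite (_ : (fun _ => _) = fun w => f w * f w ^+ n); first exact: cdiffM.
by apply/funext => w; rewrite exprS.
Qed.
Lemma cdiff_comp f g z : cdiff f z -> cdiff g (f z) -> cdiff (g \o f) z.
Proof.
move=> fz [g' g'z gg]; have fc := cdiff_cont fz; case: fz => [f' f'z ff].
exists (fun w => g' (f w) * f' w).
  by have h := ct_comp fc g'z; cts.
by move=> w; rewrite /= gg ff mulrA.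
Qed.
End Differentiability.

(** * Square roots, connectedness and paths *)

Section Paths.
Variable R : realType.
Local Notation C := R[i].
Local Notation Co := (R[i]^o).
Local Notation nm := (@ComplexField.Normc.normc R).
Implicit Types (z w : C) (f g : C -> C).

Local Notation Re := (@complex.Re R).
Local Notation Im := (@complex.Im R).
(** The hypothesis describes the plane slit along the nonpositive reals, the domain on which the
    principal root is continuous. *)
Lemma sqrtc_Re_gt0 z : (Im z != 0) || (0 < Re z) -> 0 < Re (sqrtc z).
Proof.
case: z => a b /= h; rewrite sqrtr_gt0 divr_gt0// .
have hb : `|a| <= Num.sqrt (a ^+ 2 + b ^+ 2) by rewrite -sqrtr_sqr ler_wsqrtr// lerDl sqr_ge0.
case: (ltP 0 a) => a0; first by rewrite ltr_wpDl ?sqrtr_ge0.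
move: h; rewrite ltNge a0 orbF => b0.
suff : `|a| < Num.sqrt (a ^+ 2 + b ^+ 2) by rewrite ler0_norm// => h; lra.
by rewrite -sqrtr_sqr ltr_sqrt ?ltrDl ?ltr_pwDr ?sqr_ge0 // lt_def sqrf_eq0 b0 sqr_ge0.
Qed.

(* Continuity comes for free from [(s - s0) * (s + s0) = z - z0]. *)
Lemma ct_sqrtc z : (Im z != 0) || (0 < Re z) -> ctsC (@sqrtc R) z.
Proof.
move=> zs; apply/ctsCP => e e0; have r0 := sqrtc_Re_gt0 zs.
set r := Re _ in r0; exists (e * r); first exact: mulr_gt0.
move=> w; have -> : w - z = (sqrtc w - sqrtc z) * (sqrtc w + sqrtc z).
  by rewrite -subr_sqr !sqr_sqrtc.
rewrite nmM; set x := nm (_ - _) => h.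
have h2 : r <= nm (sqrtc w + sqrtc z).
  apply: le_trans (nm_Re _); apply: le_trans (ler_norm _).
  by case: (w) => a b; rewrite /r raddfD /= lerDr sqrtr_ge0.
have h3 : x * r <= x * nm (sqrtc w + sqrtc z) by rewrite ler_wpM2l ?nm_ge0.
by rewrite -(ltr_pM2r r0); exact: le_lt_trans h3 h.
Qed.

Lemma Re_1B_gt0 z : nm z < 1 -> 0 < Re (1 - z).
Proof. by move=> h; rewrite raddfB /= subr_gt0; apply: le_lt_trans (ler_norm _) (le_lt_trans (nm_Re _) h). Qed.

Lemma ct_sqrt1B z : nm z < 1 -> ctsC (@sqrtc R) (1 - z).
Proof. by move=> /Re_1B_gt0 h; apply: ct_sqrtc; rewrite h orbT. Qed.

Lemma locconst_R (P : R -> Prop) :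
  (forall t, exists2 d : R, 0 < d & forall s, `|s - t| < d -> (P s <-> P t)) ->
  forall s t, P s -> P t.
Proof.
move=> H s t Ps.
have /connected_intervalP : is_interval [set: R] by [].
move=> /(_ [set x | P x]) /= HC.
suff : [set x | P x] = setT by move=> E; have : [set x | P x] t by rewrite E.
apply: HC; first by exists s.
  exists [set x | P x]; last by rewrite setTI.
  rewrite openE => x Px; apply/nbhs_ballP; have [d d0 dH] := H x.
  by exists d => // y; rewrite /ball /= distrC => /dH /iffRL; apply.
exists [set x | P x]; last by rewrite setTI.
rewrite -[X in closed X]setCK; apply: open_closedC.
rewrite openE => x Px; apply/nbhs_ballP; have [d d0 dH] := H x.
by exists d => // y; rewrite /ball /= distrC => /dH h /h.
Qed.

(** Connectedness as constancy of relatively locally constant predicates, the form in which index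
    parity is transported along [Y]. *)
Definition preconnected (Y : set C) := forall P : C -> Prop,
  (forall z, Y z -> exists2 d : R, 0 < d & forall w, Y w -> nm (w - z) < d -> (P w <-> P z)) ->
  forall z w, Y z -> Y w -> P z -> P w.

Lemma preconnected_range (c : R -> C) : (forall t, ctsR c t) -> preconnected [set c t | t in setT].
Proof.
move=> cc P HP _ _ [s _ <-] [t _ <-]; apply: (@locconst_R (P \o c)) => {s}x.
have [|d d0 dH] := HP (c x); first by exists x.
have /ctsRP/(_ _ d0) [r r0 rH] := cc x; exists r => // s /rH h.
by apply: dH => //; exists s.
Qed.

Lemma preconnected_image f (Y : set C) : preconnected Y -> (forall z, Y z -> ctsC f z) -> preconnected (f @` Y).
Proof.
move=> cY fc P HP _ _ [z Yz <-] [w Yw <-]; apply: (cY (P \o f)) => // x Yx.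
have [|d d0 dH] := HP (f x); first by exists x.
have /ctsCP/(_ _ d0) [r r0 rH] := fc x Yx; exists r => // s Ys /rH h.
by apply: dH => //; exists s.
Qed.

Lemma preconnected_bigcup (I : Type) (Y : I -> set C) z0 : (forall i, Y i z0) ->
  (forall i, preconnected (Y i)) -> preconnected (\bigcup_i Y i).
Proof.
move=> Yz cY P HP z w [i _ Yiz] [j _ Yjw] Pz.
have HPi k x : Y k x -> exists2 d : R, 0 < d & forall w, Y k w -> nm (w - x) < d -> (P w <-> P x).
  move=> Yx; have [|d d0 dH] := HP x; first by exists k.
  by exists d => // y Yy; apply: dH; exists k.
apply: (cY j P (HPi j) z0) => //; exact: (cY i P (HPi i) z).
Qed.

Lemma preconnectedU (A B : set C) z0 : A z0 -> B z0 -> preconnected A -> preconnected B -> preconnected (A `|` B).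
Proof.
move=> Az Bz cA cB.
have -> : A `|` B = \bigcup_(i in setT) (if i then A else B).
  apply/seteqP; split => [x [h|h]|x [[] _ h]]; [by exists true|by exists false|by left|by right].
by apply: (@preconnected_bigcup bool _ z0); case.
Qed.

(** Paths are total functions on [R] precomposed with this projection, so their continuity involves
    no subspace topology. *)
Definition clamp (t : R) := Num.max 0 (Num.min 1 t).
Lemma clamp_itv t : 0 <= clamp t <= 1.
Proof. by rewrite /clamp le_max lexx /= ge_max ler01 ge_min lexx. Qed.
Lemma clampE t : 0 <= t <= 1 -> clamp t = t.
Proof. by move=> /andP[h1 h2]; rewrite /clamp; rewrite (min_idPr h2) (max_idPr h1). Qed.
Lemma clamp_lip s t : `|clamp s - clamp t| <= `|s - t|.
Proof.
rewrite /clamp !maxEle !minEle.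
case: (ger0P (s - t)) => h0; rewrite ler_norml;
  case: (leP 1 s) => ?; case: (leP 1 t) => ?; case: (leP 0 s) => ?; case: (leP 0 t) => ?; rewrite ?ler01; apply/andP; split; lra.
Qed.
Lemma cr_clamp (c : R -> C) :
  (forall t, 0 <= t <= 1 -> forall e : R, 0 < e -> exists2 d : R, 0 < d & forall s, 0 <= s <= 1 -> `|s - t| < d -> nm (c s - c t) < e) ->
  forall t, ctsR (fun t => c (clamp t)) t.
Proof.
move=> H t; apply/ctsRP => e e0; have [d d0 dH] := H _ (clamp_itv t) _ e0.
by exists d => // s h; apply: dH; rewrite ?clamp_itv//; apply: le_lt_trans (clamp_lip _ _) h.
Qed.

Definition seg z w (t : R) : C := z + (clamp t)%:C * (w - z).
Lemma cr_seg z w t : ctsR (seg z w) t.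
Proof.
apply: (@cr_clamp (fun u => z + u%:C * (w - z))) => {}t _ e e0; set v := w - z.
exists (e / (nm v + 1)); first by rewrite divr_gt0// ltr_wpDl ?nm_ge0.
move=> s _; rewrite ltr_pdivlMr ?ltr_wpDl ?nm_ge0// => h.
rewrite [X in nm X](_ : _ = (s - t)%:C * v); last by rewrite rmorphB /=; ring.
by rewrite nmM nm_real; apply: le_lt_trans h; rewrite ler_wpM2l // lerDl.
Qed.
Lemma seg0 z w : seg z w 0 = z.
Proof. by rewrite /seg clampE ?lexx ?ler01// mul0r addr0. Qed.
Lemma seg1 z w : seg z w 1 = w.
Proof. by rewrite /seg clampE ?lexx ?ler01// mul1r addrC subrK. Qed.
Lemma seg_ball a r z w t : nm (z - a) < r -> nm (w - a) < r -> nm (seg z w t - a) < r.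
Proof.
move=> hz hw; have /andP[t0 t1] := clamp_itv t; rewrite /seg; set u := clamp t in t0 t1 *.
rewrite (_ : _ - a = (1 - u)%:C * (z - a) + u%:C * (w - a)); last first.
  by rewrite rmorphB rmorph1 /=; ring.
apply: le_lt_trans (nmD _ _) _; rewrite !nmM !nm_real !ger0_norm ?subr_ge0//.
(* At [u = 1] the first summand vanishes, and the strict inequality has to come from [w]. *)
have [->|u1] := eqVneq u 1; first by rewrite subrr mul0r add0r mul1r.
have h1 : (1 - u) * nm (z - a) < (1 - u) * r by rewrite ltr_pM2l// subr_gt0 lt_neqAle u1.
have h2 : u * nm (w - a) <= u * r by rewrite ler_wpM2l// ltW.
apply: lt_le_trans (ltr_leD h1 h2) _; rewrite -mulrDl; lra.
Qed.
End Paths.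

(** * Parity of the index of a closed curve *)

Section IndexParity.
Variable R : realType.
Local Notation C := R[i].
Local Notation Co := (R[i]^o).
Local Notation nm := (@ComplexField.Normc.normc R).
Implicit Types (z w : C) (f g : C -> C).

Implicit Types (c e s : R -> C).
(** A uniform distance rather than mere avoidance: it yields a radius within which the base point
    can move without a change of parity. *)
Definition bounded_away c z := exists2 d : R, 0 < d & forall t, d <= nm (c t - z).

(** For the loop made of [c] followed by [e] backwards: a square root of the displacement from [z],
    continued along the loop, closes up exactly when the winding number is even. Roots on the two
    arcs that agree at both ends express this. *)
Definition even_index c e z := exists s1 s2 : R -> C,
  [/\ forall t, ctsR s1 t /\ s1 t ^+ 2 = c t - z,
      forall t, ctsR s2 t /\ s2 t ^+ 2 = e t - z, s1 0 = s2 0 & s1 1 = s2 1].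

Lemma continuous_nm c : (forall t, ctsR c t) -> continuous (fun t => nm (c t)).
Proof.
move=> cc t A /nbhs_ballP [r r0 rA]; apply/nbhs_ballP.
have /ctsRP/(_ _ r0) [d d0 dH] := cc t; exists d => // s; rewrite /ball /= distrC => /dH h.
apply: rA; rewrite /ball /=; apply: le_lt_trans h.
by rewrite ler_norml lerNl opprB nm_sub /= (nmBC (c s) (c t)) nm_sub.
Qed.

Lemma exists_max_nm c : (forall t, ctsR c t) -> (forall t, c (clamp t) = c t) ->
  exists t : R, forall s : R, nm (c s) <= nm (c t).
Proof.
move=> cc clc.
have [t tI tm] : exists2 t : R, t \in `[0, 1] & forall s : R, s \in `[0, 1] -> nm (c s) <= nm (c t).
  by apply: (@EVT_max _ (fun t => nm (c t)) 0 1 ler01); exact/continuous_subspaceT/continuous_nm.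
by exists t => s; rewrite -[c s]clc; apply: tm; rewrite in_itv /= clamp_itv.
Qed.

Lemma bounded_away_neq c z t : bounded_away c z -> c t - z != 0.
Proof. by move=> [d d0 /(_ t)]; rewrite -nm_gt0; exact: lt_le_trans. Qed.

Lemma bounded_away_clamp c z : (forall t, ctsR c t) -> (forall t, c (clamp t) = c t) ->
  (forall t, 0 <= t <= 1 -> c t != z) -> bounded_away c z.
Proof.
move=> cc ccl cz.
have [t tI tm] : exists2 t : R, t \in `[0, 1] & forall s : R, s \in `[0, 1] -> nm (c t - z) <= nm (c s - z).
  apply: (@EVT_min _ (fun t => nm (c t - z)) 0 1 ler01).
  apply/continuous_subspaceT/(@continuous_nm (fun t => c t - z)) => t.
  by have h := cc t; cts.
exists (nm (c t - z)); first by rewrite nm_gt0 subr_eq0; apply: cz; move: tI; rewrite in_itv.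
by move=> s; rewrite -[c s]ccl; apply: tm; rewrite in_itv /= clamp_itv.
Qed.

(** The factor [1 - (w - z) / (x - z)] turns [x - z] into [x - w] and stays within distance 1 of 1,
    off the slit of the principal root. It depends only on the point [x], so the agreement of the
    roots at the ends survives. *)
Lemma even_index_step c e z w : (forall t, ctsR c t) -> (forall t, ctsR e t) ->
  c 0 = e 0 -> c 1 = e 1 ->
  (forall t, nm (w - z) < nm (c t - z)) -> (forall t, nm (w - z) < nm (e t - z)) ->
  even_index c e z -> even_index c e w.
Proof.
move=> cc ce c0 c1 hc he [s1 [s2 [h1 h2 h3 h4]]].
pose m (x : C) := sqrtc (1 - (w - z) / (x - z)).
have key (c' s : R -> C) : (forall t, ctsR c' t) -> (forall t, nm (w - z) < nm (c' t - z)) ->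
    (forall t, ctsR s t /\ s t ^+ 2 = c' t - z) ->
    forall t, ctsR (fun t => s t * m (c' t)) t /\ (s t * m (c' t)) ^+ 2 = c' t - w.
  move=> cc' hc' hs t; have [st s2t] := hs t.
  have p : 0 < nm (c' t - z) by apply: le_lt_trans (hc' t); exact: nm_ge0.
  have n0 : c' t - z != 0 by rewrite -nm_gt0.
  have q : nm ((w - z) / (c' t - z)) < 1 by rewrite nmM nmV ltr_pdivrMr// mul1r.
  split; last by rewrite exprMn s2t sqr_sqrtc mulrBr mulr1 mulrC divfK//; ring.
  have hct := cc' t.
  have h : ctsR (fun t => 1 - (w - z) / (c' t - z)) t.
    have hV : ctsR (fun t => (c' t - z)^-1) t.
      by apply: (@crV _ (fun t => c' t - z)); [exact: n0|cts].
    cts.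
  have := cr_comp h (ct_sqrt1B q) => h'.
  by rewrite /m; cts.
exists (fun t => s1 t * m (c t)), (fun t => s2 t * m (e t)).
by split; [exact: key|exact: key|rewrite c0 h3|rewrite c1 h4].
Qed.

Lemma even_index_conn c e (Y : set C) z w : (forall t, ctsR c t) -> (forall t, ctsR e t) ->
  c 0 = e 0 -> c 1 = e 1 -> preconnected Y -> (forall z, Y z -> bounded_away c z /\ bounded_away e z) ->
  Y z -> Y w -> even_index c e z -> even_index c e w.
Proof.
move=> cc ce c0 c1 cY hY; apply: cY => {}z Yz.
have [[d1 d10 h1] [d2 d20 h2]] := hY z Yz.
(* Half the distance: [|w - z|] is then below the distance of the curves to [w] as well as to [z],
   and [even_index_step] applies in both directions. *)
exists (Num.min d1 d2 / 2); first by rewrite divr_gt0// lt_min d10.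
move=> {}w _; rewrite ltr_pdivlMr// lt_min => /andP[k1 k2].
have m0 := nm_ge0 (w - z).
split; apply: even_index_step => // t.
- have := h1 t; have := nm_tri (c t) w z; rewrite [nm (z - w)]nmBC; lra.
- have := h2 t; have := nm_tri (e t) w z; rewrite [nm (z - w)]nmBC; lra.
- have := h1 t; lra.
- have := h2 t; lra.
Qed.

(** Writing [x - z = - z * (1 - x / z)] with [|x / z| < 1] gives one continuous root that serves
    both arcs. *)
Lemma even_index_far c e z M : (forall t, ctsR c t) -> (forall t, ctsR e t) ->
  c 0 = e 0 -> c 1 = e 1 ->
  (forall t, nm (c t) < M) -> (forall t, nm (e t) < M) -> M <= nm z -> even_index c e z.
Proof.
move=> cc ce c0 c1 hc he Mz.
pose m (x : C) := sqrtc (- z) * sqrtc (1 - x / z).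
have z0 : 0 < nm z by apply: lt_le_trans Mz; apply: le_lt_trans (hc 0); exact: nm_ge0.
have key (c' : R -> C) : (forall t, ctsR c' t) -> (forall t, nm (c' t) < M) ->
    forall t, ctsR (fun t => m (c' t)) t /\ (m (c' t)) ^+ 2 = c' t - z.
  move=> cc' hc' t; have n0 : z != 0 by rewrite -nm_gt0.
  have q : nm (c' t / z) < 1 by rewrite nmM nmV ltr_pdivrMr// mul1r; exact: lt_le_trans Mz.
  split; last by rewrite exprMn !sqr_sqrtc mulrBr mulr1 mulNr mulrC divfK//; ring.
  have hct := cc' t.
  have h : ctsR (fun t => 1 - c' t / z) t by cts.
  have := cr_comp h (ct_sqrt1B q) => h'.
  by rewrite /m; cts.
exists (fun t => m (c t)), (fun t => m (e t)).
by split; [exact: key|exact: key|rewrite c0|rewrite c1].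
Qed.

(** Parity is even far out in [Y] and constant along [Y]. The set [Y] witnesses that [z] can be
    joined to infinity off the loop. *)
Lemma even_index_unbounded c e (Y : set C) z : (forall t, ctsR c t) -> (forall t, ctsR e t) ->
  c 0 = e 0 -> c 1 = e 1 -> preconnected Y -> (forall z, Y z -> bounded_away c z /\ bounded_away e z) ->
  (forall t, c (clamp t) = c t) -> (forall t, e (clamp t) = e t) ->
  (forall M : R, exists2 w, Y w & M <= nm w) -> Y z -> even_index c e z.
Proof.
move=> cc ce c0 c1 cY hY clc cle Yub Yz.
have bnd (c' : R -> C) : (forall t, ctsR c' t) -> (forall t, c' (clamp t) = c' t) ->
    exists M : R, forall t, nm (c' t) < M.
  move=> cc' clc'.
  have [t tm] := exists_max_nm cc' clc'.
  by exists (nm (c' t) + 1) => s; rewrite ltr_pwDr.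
have [M1 h1] := bnd c cc clc; have [M2 h2] := bnd e ce cle.
have [w Yw Mw] := Yub (Num.max M1 M2).
apply: (even_index_conn cc ce c0 c1 cY hY Yw Yz); apply: (even_index_far cc ce c0 c1 _ _ Mw) => t;
 by rewrite lt_max ?h1 ?h2 ?orbT.
Qed.

(** At each point the roots agree up to sign, and the sign cannot jump since a value and its
    opposite are [2 |s t|] apart. *)
Lemma sqrt_unique s s' : (forall t, ctsR s t) -> (forall t, ctsR s' t) ->
  (forall t, s t ^+ 2 = s' t ^+ 2) -> (forall t, s t != 0) ->
  (forall t, s' t = s t) \/ (forall t, s' t = - s t).
Proof.
move=> cs cs' ss s0.
have H t : s' t = s t \/ s' t = - s t.
  by have /eqP := ss t; rewrite eq_sym eqf_sqr => /orP[] /eqP ->; [left|right].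
have N x : - s x = s x -> False.
  move/eqP; rewrite eq_sym -subr_eq0 opprK -mulr2n mulrn_eq0 /= => /eqP E.
  by have := s0 x; rewrite E eqxx.
have LC : forall x y, s' x = s x -> s' y = s y.
  apply: locconst_R => t; have p : 0 < nm (s t) by rewrite nm_gt0.
  have /ctsRP/(_ _ p) [d d0 dH] := cs t; have /ctsRP/(_ _ p) [d' d'0 dH'] := cs' t.
  exists (Num.min d d'); first by rewrite lt_min d0.
  move=> y; rewrite lt_min => /andP[/dH k /dH' k'].
  have [ht|ht] := H t; have [hy|hy] := H y; split; rewrite ?ht ?hy// => /esym; try (by move=> /esym/N);
  move=> _; exfalso; move: k k'; rewrite ht hy.
  - move=> k k'; have E : - s y - s t = - ((s y - s t) + s t *+ 2) by ring.
    rewrite E nmN in k'; have := nm_sub (s t *+ 2) (- (s y - s t)).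
    by rewrite opprK addrC [s t *+ 2 + _]addrC nmN normcMn mulr2n => ?; lra.
  - move=> k k'; have E : s y - - s t = (s y - s t) + s t *+ 2 by ring.
    rewrite E in k'; have := nm_sub (s t *+ 2) (- (s y - s t)).
    by rewrite opprK addrC [s t *+ 2 + _]addrC nmN normcMn mulr2n => ?; lra.
have [h0|h0] := H 0; first by left => t; exact: LC h0.
right => t; have [ht|//] := H t.
have h0' : s' 0 = s 0 := LC _ _ ht.
by case: (N 0); rewrite -h0.
Qed.
End IndexParity.

(** * Integrals of continuous real functions *)

Section RealIntegral.
Variable R : realType.
Notation mu := (@lebesgue_measure R).
Implicit Types (f g F : R -> R) (a b c : R).
Definition itg f a b : R := \int[mu]_(x in `[a, b]) f x.

Lemma cont_integrable f a b : continuous f -> mu.-integrable `[a, b] (EFin \o f).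
Proof.
move=> cf; apply: continuous_compact_integrable; first exact: segment_compact.
exact: continuous_subspaceT.
Qed.

Lemma itg_cat f a b c : continuous f -> a <= b -> b <= c -> itg f a c = itg f a b + itg f b c.
Proof.
move=> cf ab bc; rewrite /itg.
have := @Rintegral_itvB R f (BLeft a) (BRight c) b.
move=> /(_ (cont_integrable _ _ cf)); rewrite !bnd_simp => /(_ ab bc) H.
rewrite -(@Rintegral_itv_obnd_cbnd R b (BRight c) f); first by rewrite -H addrC subrK.
apply: integrableS (cont_integrable b c cf) => //; apply: subset_itvr; by rewrite bnd_simp.
Qed.

Lemma itgD f g a b : continuous f -> continuous g -> itg (fun x => f x + g x) a b = itg f a b + itg g a b.
Proof. by move=> cf cg; rewrite /itg RintegralD//; exact: cont_integrable. Qed.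

Lemma itgB f g a b : continuous f -> continuous g -> itg (fun x => f x - g x) a b = itg f a b - itg g a b.
Proof. by move=> cf cg; rewrite /itg RintegralB//; exact: cont_integrable. Qed.

Lemma itg_le f g a b : continuous f -> continuous g ->
  (forall x, a <= x <= b -> f x <= g x) -> itg f a b <= itg g a b.
Proof.
move=> cf cg fg; apply: le_Rintegral => //; try exact: cont_integrable.
Qed.

Lemma itg_cst (r : R) a b : a <= b -> itg (fun=> r) a b = r * (b - a).
Proof.
move=> ab; rewrite /itg Rintegral_cst//= lebesgue_measure_itv /= lte_fin.
move: ab; rewrite le_eqVlt => /predU1P[->|->//]; by rewrite ltxx subrr.
Qed.

Lemma itg_ge f a b (m : R) : continuous f -> a <= b ->
  (forall x, a <= x <= b -> m <= f x) -> m * (b - a) <= itg f a b.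
Proof.
by move=> cf ab fm; rewrite -itg_cst//; apply: itg_le => //; exact: cst_continuous.
Qed.

Lemma itg_bnd f a b (M : R) : continuous f -> a <= b ->
  (forall x, a <= x <= b -> `|f x| <= M) -> `|itg f a b| <= M * (b - a).
Proof.
move=> cf ab fM; rewrite ler_norml -mulNr -!itg_cst//; apply/andP.
by split; apply: itg_le => //; try exact: cst_continuous; move=> x /fM; rewrite ler_norml => /andP[].
Qed.

Lemma itg_FTC f F a b : continuous f -> a <= b ->
  (forall x : R, is_derive x 1 F (f x)) -> itg f a b = F b - F a.
Proof.
move=> cf; rewrite le_eqVlt => /predU1P[-> _|ab dF].
  by rewrite /itg set_itv1 Rintegral_set1 subrr.
have cF : continuous F.
  by move=> x; apply: differentiable_continuous; apply/derivable1_diffP; case: (dF x).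
rewrite /itg /Rintegral (@continuous_FTC2 R f F a b ab)//; first exact: continuous_subspaceT.
  split; first by move=> x _; case: (dF x).
    exact: (cvg_at_right_filter (cF a)).
  exact: (cvg_at_left_filter (cF b)).
by move=> x _; rewrite derive1E; case: (dF x).
Qed.

(** A positive value persists, up to a factor 2, on a short interval to its right, which alone makes
    the integral positive. *)
Lemma itg_eq0 f a b : continuous f -> a <= b -> (forall x, 0 <= f x) -> itg f a b = 0 ->
  forall x, a < x < b -> f x = 0.
Proof.
move=> cf ab f0 I0 x /andP[ax xb]; apply/eqP; rewrite eq_le f0 andbT leNgt; apply/negP => fx.
have fx2 : 0 < f x / 2 by rewrite divr_gt0.
have : nbhs (f x) [set y | `|y - f x| < f x / 2].
  by apply/nbhs_ballP; exists (f x / 2) => // y; rewrite /ball /= distrC.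
move=> /(cf x) /nbhs_ballP [d /= d0 dH].
pose c := Num.min (x + d / 2) b.
have xc : x < c by rewrite /c lt_min xb andbT ltrDl divr_gt0.
have cb : c <= b by rewrite ge_min lexx orbT.
have I1 : 0 <= itg f a x by have := itg_ge cf (ltW ax) (fun y _ => f0 y); rewrite mul0r.
have I3 : 0 <= itg f c b by have := itg_ge cf cb (fun y _ => f0 y); rewrite mul0r.
have I2 : f x / 2 * (c - x) <= itg f x c.
  apply: itg_ge => //; first exact: ltW.
  move=> y /andP[xy yc]; have := dH y; rewrite /ball /= => H.
  have : `|x - y| < d.
    rewrite ler0_norm ?opprB ?subr_le0// ltrBlDr; apply: le_lt_trans yc _.
    rewrite /c gt_min; apply/orP; left; lra.
  by move=> /H; rewrite ltr_norml => /andP[]; lra.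
have : 0 < f x / 2 * (c - x) by rewrite mulr_gt0// subr_gt0.
move: I0; rewrite (itg_cat cf (ltW ax) (ltW xb)) (itg_cat cf (ltW xc) cb); lra.
Qed.
End RealIntegral.

(** * Boundary integrals in polar coordinates *)

Section PolarBoundary.
Variable R : realType.
Local Notation C := R[i].
Local Notation Co := (R[i]^o).
Local Notation nm := (@ComplexField.Normc.normc R).
Implicit Types (z w : C) (f g : C -> C).

Local Notation Re := (@complex.Re R).
Local Notation Im := (@complex.Im R).
Implicit Types (c d : R -> C) (F : R -> R -> C).

Lemma ctsR_Re c : (forall t, ctsR c t) -> continuous (fun t => Re (c t)).
Proof.
move=> cc t A /nbhs_ballP [e /= e0 eA]; apply/nbhs_ballP.
have /ctsRP/(_ _ e0) [r r0 rH] := cc t; exists r => //= s; rewrite /ball /= distrC => /rH h.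
apply: eA; rewrite /ball /= distrC -raddfB; exact: le_lt_trans (nm_Re _) h.
Qed.
Lemma ctsR_Im c : (forall t, ctsR c t) -> continuous (fun t => Im (c t)).
Proof.
move=> cc t A /nbhs_ballP [e /= e0 eA]; apply/nbhs_ballP.
have /ctsRP/(_ _ e0) [r r0 rH] := cc t; exists r => //= s; rewrite /ball /= distrC => /rH h.
apply: eA; rewrite /ball /= distrC -raddfB; exact: le_lt_trans (nm_Im _) h.
Qed.
Lemma ctsR_pair (f g : R -> R) t : {for t, continuous f} -> {for t, continuous g} ->
  ctsR (fun t => f t +i* g t) t.
Proof.
move=> cf cg; apply/ctsRP => e e0; have e2 : 0 < e / 2 by rewrite divr_gt0.
have aux (h : R -> R) : {for t, continuous h} -> exists2 d : R, 0 < d & forall s, `|s - t| < d -> `|h s - h t| < e / 2.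
  move=> ch; have : nbhs (h t) (ball (h t) (e / 2)) by exact: nbhsx_ballx.
  move=> /ch /nbhs_ballP [d /= d0 dH]; exists d => // s st.
  by rewrite distrC; apply: dH; rewrite /ball /= distrC.
have [d1 d10 h1] := aux f cf; have [d2 d20 h2] := aux g cg.
exists (Num.min d1 d2); first by rewrite lt_min d10.
move=> s; rewrite lt_min => /andP[/h1 k1 /h2 k2].
by apply: le_lt_trans (nm_ReIm _) _; rewrite [e]splitr /=; exact: ltrD.
Qed.

Definition cint c (a b : R) : C := itg (fun t => Re (c t)) a b +i* itg (fun t => Im (c t)) a b.

Lemma cint_cat c (a b b' : R) : (forall t, ctsR c t) -> a <= b -> b <= b' ->
  cint c a b' = cint c a b + cint c b b'.
Proof.
move=> cc ab bb; rewrite /cint (itg_cat (ctsR_Re cc) ab bb) (itg_cat (ctsR_Im cc) ab bb).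
by apply/eqP; rewrite eq_complex /= !eqxx.
Qed.

Lemma cintD c d a b : (forall t, ctsR c t) -> (forall t, ctsR d t) ->
  cint (fun t => c t + d t) a b = cint c a b + cint d a b.
Proof.
move=> cc cd; apply/eqP; rewrite eq_complex; apply/andP; split; apply/eqP => /=.
  by rewrite -(itgD _ _ (ctsR_Re cc) (ctsR_Re cd)); congr itg; apply/funext => t; rewrite raddfD.
by rewrite -(itgD _ _ (ctsR_Im cc) (ctsR_Im cd)); congr itg; apply/funext => t; rewrite raddfD.
Qed.

Lemma cintB c d a b : (forall t, ctsR c t) -> (forall t, ctsR d t) ->
  cint (fun t => c t - d t) a b = cint c a b - cint d a b.
Proof.
move=> cc cd; apply/eqP; rewrite eq_complex; apply/andP; split; apply/eqP => /=.
  by rewrite -(itgB _ _ (ctsR_Re cc) (ctsR_Re cd)); congr itg; apply/funext => t; rewrite raddfB.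
by rewrite -(itgB _ _ (ctsR_Im cc) (ctsR_Im cd)); congr itg; apply/funext => t; rewrite raddfB.
Qed.

Lemma itgZ (r : R) (f : R -> R) a b : continuous f -> itg (fun x => r * f x) a b = r * itg f a b.
Proof. by move=> cf; rewrite /itg RintegralZl//; exact: cont_integrable. Qed.

Lemma cintZ (B : C) c a b : (forall t, ctsR c t) ->
  cint (fun t => B * c t) a b = B * cint c a b.
Proof.
move=> cc; case: B => p q.
have cR := ctsR_Re cc; have cI := ctsR_Im cc.
have cZ (r : R) (f : R -> R) : continuous f -> continuous (fun x => r * f x).
  by move=> cf x; apply: continuousM; [exact: cst_continuous|exact: cf].
apply/eqP; rewrite eq_complex; apply/andP; split; apply/eqP => /=.
  rewrite -(itgZ p a b cR) -(itgZ q a b cI) -itgB; [|exact: cZ|exact: cZ].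
  by congr itg; apply/funext => t; case: (c t).
rewrite -(itgZ p a b cI) -(itgZ q a b cR) -itgD; [|exact: cZ|exact: cZ].
by congr itg; apply/funext => t; case: (c t) => x y /=; rewrite addrC.
Qed.

(** The factor 2 comes from estimating real and imaginary parts separately; its size does not affect
    the limits below. *)
Lemma cint_bnd c a b (M : R) : (forall t, ctsR c t) -> a <= b ->
  (forall t, a <= t <= b -> nm (c t) <= M) -> nm (cint c a b) <= 2 * M * (b - a).
Proof.
move=> cc ab cM; apply: le_trans (nm_ReIm _) _; rewrite /cint /=.
have h1 := itg_bnd (ctsR_Re cc) ab (fun t tab => le_trans (nm_Re (c t)) (cM t tab)).
have h2 := itg_bnd (ctsR_Im cc) ab (fun t tab => le_trans (nm_Im (c t)) (cM t tab)).
by apply: le_trans (lerD h1 h2) _; rewrite -mulrDl -mulr2n mulr_natl.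
Qed.

(** The complex exponential of [x + i t]. In these coordinates annular sectors are rectangles, which
    can be bisected, and a punctured disc is a half-strip. *)
Definition polar (x t : R) : C := (expR x * cos t) +i* (expR x * sin t).
Local Notation E := polar.

Lemma polar_split x t : E x t = (expR x)%:C * (cos t +i* sin t).
Proof. by rewrite /polar; apply/eqP; rewrite eq_complex /= !mul0r subr0 addr0 !eqxx. Qed.

Lemma nm_cis t : nm (cos t +i* sin t) = 1.
Proof. by rewrite /= cos2Dsin2 sqrtr1. Qed.

Lemma nm_polar x t : nm (E x t) = expR x.
Proof. by rewrite polar_split nmM nm_cis nm_real mulr1 ger0_norm// expR_ge0. Qed.

Lemma ctsR_polar_radial x t : ctsR (fun x => E x t) x.
Proof. by apply: ctsR_pair; apply: continuousM; by [exact: continuous_expR|exact: cst_continuous]. Qed.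
Lemma ctsR_polar_angular x t : ctsR (fun t => E x t) t.
Proof. by apply: ctsR_pair; apply: continuousM; by [exact: continuous_cos|exact: continuous_sin|exact: cst_continuous]. Qed.

Lemma cint_polar_radial x0 x1 t : x0 <= x1 -> cint (fun x => E x t) x0 x1 = E x1 t - E x0 t.
Proof.
move=> x01; apply/eqP; rewrite eq_complex; apply/andP; split; apply/eqP => /=.
  have H (x : R) : is_derive x 1 (fun x => expR x * cos t) (expR x * cos t).
    by apply: is_derive_eq; rewrite scaler0 add0r [LHS]mulrC.
  exact: (itg_FTC (ctsR_Re (fun x => @ctsR_polar_radial x t)) x01 H).
have H (x : R) : is_derive x 1 (fun x => expR x * sin t) (expR x * sin t).
  by apply: is_derive_eq; rewrite scaler0 add0r [LHS]mulrC.
exact: (itg_FTC (ctsR_Im (fun x => @ctsR_polar_radial x t)) x01 H).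
Qed.

Lemma cint_polar_angular x t0 t1 : t0 <= t1 -> 'i%C * cint (fun t => E x t) t0 t1 = E x t1 - E x t0.
Proof.
move=> t01; apply/eqP; rewrite eq_complex; apply/andP; split; apply/eqP => /=; rewrite !mul0r ?add0r ?sub0r mul1r.
  have H (t : R) : is_derive t 1 (fun t => - (expR x * cos t)) (expR x * sin t).
    by apply: is_derive_eq; rewrite scalerN opprK.
  rewrite (itg_FTC (ctsR_Im (fun t => @ctsR_polar_angular x t)) t01 H); ring.
have H (t : R) : is_derive t 1 (fun t => expR x * sin t) (expR x * cos t).
  exact: is_derive_eq.
exact: (itg_FTC (ctsR_Re (fun t => @ctsR_polar_angular x t)) t01 H).
Qed.

(** Continuity in each variable separately is what integrals along the four sides of a rectangle
    require. *)
Definition scont F := (forall x t, ctsR (fun x => F x t) x) /\ (forall x t, ctsR (fun t => F x t) t).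

(** The counterclockwise boundary integral of [F (dx + i dt)]. For [F x t = G (z0 + polar x t)] it
    is the integral of [G z / (z - z0)] around an annular sector, so its vanishing leads straight to
    the mean value property. *)
Definition polar_boundary F (x0 x1 t0 t1 : R) : C :=
  cint (fun x => F x t0 - F x t1) x0 x1 + 'i%C * cint (fun t => F x1 t - F x0 t) t0 t1.
Local Notation J := polar_boundary.

Lemma scont_radialB F u v : scont F -> forall t, ctsR (fun x => F x u - F x v) t.
Proof. by move=> [Fx _] t; have h1 := Fx t u; have h2 := Fx t v; cts. Qed.
Lemma scont_angularB F u v : scont F -> forall t, ctsR (fun t => F u t - F v t) t.
Proof. by move=> [_ Ft] t; have h1 := Ft u t; have h2 := Ft v t; cts. Qed.

Arguments scont_radialB [F] u v _ t.
Arguments scont_angularB [F] u v _ t.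

Lemma polar_boundaryB F G x0 x1 t0 t1 : scont F -> scont G ->
  J (fun x t => F x t - G x t) x0 x1 t0 t1 = J F x0 x1 t0 t1 - J G x0 x1 t0 t1.
Proof.
move=> sF sG; rewrite /polar_boundary.
have -> : (fun x => F x t0 - G x t0 - (F x t1 - G x t1)) = (fun x => (F x t0 - F x t1) - (G x t0 - G x t1)).
  by apply/funext => x; ring.
have -> : (fun x => F x1 x - G x1 x - (F x0 x - G x0 x)) = (fun x => (F x1 x - F x0 x) - (G x1 x - G x0 x)).
  by apply/funext => x; ring.
rewrite (cintB _ _ (scont_radialB t0 t1 sF) (scont_radialB t0 t1 sG)) (cintB _ _ (scont_angularB x1 x0 sF) (scont_angularB x1 x0 sG)).
ring.
Qed.

Lemma polar_boundary_bnd F x0 x1 t0 t1 (M : R) : scont F -> x0 <= x1 -> t0 <= t1 ->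
  (forall x t, x0 <= x <= x1 -> t0 <= t <= t1 -> nm (F x t) <= M) ->
  nm (J F x0 x1 t0 t1) <= 4 * M * ((x1 - x0) + (t1 - t0)).
Proof.
move=> sF x01 t01 FM; rewrite /polar_boundary; apply: le_trans (nmD _ _) _.
rewrite nmM (_ : nm 'i%C = 1); last by rewrite /= expr0n expr1n add0r sqrtr1.
rewrite mul1r mulrDr; apply: lerD.
  apply: le_trans (@cint_bnd _ _ _ (2 * M) (scont_radialB t0 t1 sF) x01 _) _.
  - move=> x xI; apply: le_trans (nmD _ _) _; rewrite nmN mulr_natl mulr2n.
    by apply: lerD; apply: FM; rewrite ?lexx ?t01.
  - by rewrite mulrA -natrM.
apply: le_trans (@cint_bnd _ _ _ (2 * M) (scont_angularB x1 x0 sF) t01 _) _.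
- move=> x xI; apply: le_trans (nmD _ _) _; rewrite nmN mulr_natl mulr2n.
  by apply: lerD; apply: FM; rewrite ?lexx ?x01.
- by rewrite mulrA -natrM.
Qed.

Lemma polar_boundary_catx F x0 x1 x2 t0 t1 : scont F -> x0 <= x1 -> x1 <= x2 ->
  J F x0 x2 t0 t1 = J F x0 x1 t0 t1 + J F x1 x2 t0 t1.
Proof.
move=> sF x01 x12; rewrite /polar_boundary (cint_cat (scont_radialB t0 t1 sF) x01 x12).
have -> : (fun t => F x2 t - F x0 t) = (fun t => (F x1 t - F x0 t) + (F x2 t - F x1 t)).
  by apply/funext => t; ring.
rewrite (cintD _ _ (scont_angularB x1 x0 sF) (scont_angularB x2 x1 sF)); ring.
Qed.

Lemma polar_boundary_catt F x0 x1 t0 t1 t2 : scont F -> t0 <= t1 -> t1 <= t2 ->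
  J F x0 x1 t0 t2 = J F x0 x1 t0 t1 + J F x0 x1 t1 t2.
Proof.
move=> sF t01 t12; rewrite /polar_boundary (cint_cat (scont_angularB x1 x0 sF) t01 t12).
have -> : (fun t => F t t0 - F t t2) = (fun t => (F t t0 - F t t1) + (F t t1 - F t t2)).
  by apply/funext => t; ring.
rewrite (cintD _ _ (scont_radialB t0 t1 sF) (scont_radialB t1 t2 sF)); ring.
Qed.

Lemma scont_affine A B : scont (fun x t => A + B * E x t).
Proof.
by split => x t; [have h := @ctsR_polar_radial x t|have h := @ctsR_polar_angular x t]; cts.
Qed.

(** Constants cancel between opposite sides, and [polar] is a primitive of itself in [x] and of [i]
    times itself in [t], so the four sides telescope. *)
Lemma polar_boundary_affine A B x0 x1 t0 t1 : x0 <= x1 -> t0 <= t1 ->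
  J (fun x t => A + B * E x t) x0 x1 t0 t1 = 0.
Proof.
move=> x01 t01; rewrite /polar_boundary.
have -> : (fun x => A + B * E x t0 - (A + B * E x t1)) = (fun x => B * (E x t0 - E x t1)).
  by apply/funext => x; ring.
have -> : (fun t => A + B * E x1 t - (A + B * E x0 t)) = (fun t => B * (E x1 t - E x0 t)).
  by apply/funext => x; ring.
have sE : scont E by split => x t; [exact: ctsR_polar_radial|exact: ctsR_polar_angular].
rewrite (cintZ _ _ _ (scont_radialB t0 t1 sE)) (cintZ _ _ _ (scont_angularB x1 x0 sE)).
rewrite cintB; [|by move=> x; exact: ctsR_polar_radial..].
rewrite cintB; [|by move=> x; exact: ctsR_polar_angular..].
rewrite (mulrCA 'i%C) (mulrBr 'i%C) !cint_polar_angular// !cint_polar_radial//; ring.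
Qed.
End PolarBoundary.

(** * Goursat lemma *)

Section GoursatLemma.
Variable R : realType.
Local Notation C := R[i].
Local Notation Co := (R[i]^o).
Local Notation nm := (@ComplexField.Normc.normc R).
Implicit Types (z w : C) (f g : C -> C).

Local Notation Re := (@complex.Re R).
Local Notation Im := (@complex.Im R).
Local Notation E := (@polar R).

Lemma cr_compR (c : R -> C) (h : R -> R) t :
  (forall s, `|h s - h t| <= `|s - t|) -> ctsR c (h t) -> ctsR (fun t => c (h t)) t.
Proof.
move=> hl /ctsRP H; apply/ctsRP => e /H [d d0 dH]; exists d => // s st.
by apply: dH; exact: le_lt_trans (hl s) st.
Qed.

Lemma min_lip (X s t : R) : `|Num.min s X - Num.min t X| <= `|s - t|.
Proof.
by case: (ger0P (s - t)) => h0; rewrite ler_norml; case: (leP s X) => ?; case: (leP t X) => ?; apply/andP; split; lra.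
Qed.

Lemma expR_lip (X x a : R) : x <= X -> a <= X -> `|expR x - expR a| <= expR X * `|x - a|.
Proof.
have aux u v : u <= v -> v <= X -> `|expR v - expR u| <= expR X * `|v - u|.
  move=> uv vX; rewrite !ger0_norm ?subr_ge0 ?ler_expR//.
  have -> : expR v - expR u = expR v * (1 - expR (u - v)).
    by rewrite mulrBr mulr1 -expRD; congr (_ - expR _); ring.
  apply: ler_pM => //; rewrite ?expR_ge0 ?ler_expR// ?subr_ge0.
    by rewrite -expR0 ler_expR subr_le0.
  by have := expR_ge1Dx (u - v); lra.
move=> xX aX; case: (leP x a) => xa; last by apply: aux => //; exact: ltW.
by rewrite distrC (distrC x); apply: aux.
Qed.

Lemma trig_lip (f df : R -> R) (s t : R) : (forall x : R, is_derive x 1 f (df x)) ->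
  (forall x, `|df x| <= 1) -> `|f s - f t| <= `|s - t|.
Proof.
move=> fd d1; wlog st : s t / s < t.
  move=> H; have [st|ts|->] := ltgtP s t; first exact: H.
    by rewrite distrC (distrC s); apply: H.
  by rewrite !subrr.
have cf : {within `[s, t], continuous f}.
  by apply: continuous_subspaceT => x; apply: differentiable_continuous; apply/derivable1_diffP; case: (fd x).
have [c _ H] := @MVT R f df s t st (fun x _ => fd x) cf.
by rewrite distrC H normrM (distrC s) ler_piMl.
Qed.

Lemma polar_lip (X x a t b : R) : x <= X -> a <= X ->
  nm (E x t - E a b) <= 2 * expR X * (`|x - a| + `|t - b|).
Proof.
move=> xX aX.
have cosL : `|cos t - cos b| <= `|t - b|.
  by apply: (@trig_lip _ (fun x => - sin x)) => y; rewrite normrN ler_norml sin_geN1 sin_le1.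
have sinL : `|sin t - sin b| <= `|t - b|.
  by apply: (@trig_lip _ cos) => y; rewrite ler_norml cos_geN1 cos_le1.
have -> : E x t - E a b = (expR x - expR a)%:C * (cos t +i* sin t)
    + (expR a)%:C * ((cos t - cos b) +i* (sin t - sin b)).
  by rewrite !polar_split rmorphB /= -[(cos t - cos b) +i* _]/((cos t +i* sin t) - (cos b +i* sin b)); ring.
apply: le_trans (nmD _ _) _; rewrite !nmM nm_cis mulr1 !nm_real (ger0_norm (expR_ge0 a)).
have h1 := expR_lip xX aX.
have h2 : nm ((cos t - cos b) +i* (sin t - sin b)) <= 2 * `|t - b|.
  by apply: le_trans (nm_ReIm _) _; rewrite mulr_natl mulr2n /=; exact: lerD.
have h3 : expR a * nm ((cos t - cos b) +i* (sin t - sin b)) <= expR X * (2 * `|t - b|).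
  by apply: ler_pM; rewrite ?expR_ge0 ?nm_ge0 ?ler_expR.
have h4 : 0 <= expR X * `|x - a| by rewrite mulr_ge0// expR_ge0.
lra.
Qed.

Lemma pigeonhole4 (M a b c d : R) : M <= (a + b) + (c + d) ->
  [\/ M / 4 <= a, M / 4 <= b, M / 4 <= c | M / 4 <= d].
Proof.
move=> H; have [c1|c1] := leP (M / 4) a; first by constructor 1.
have [c2|c2] := leP (M / 4) b; first by constructor 2.
have [c3|c3] := leP (M / 4) c; first by constructor 3.
by constructor 4; lra.
Qed.

Lemma le_div4 (a b : R) : a <= b -> a / 4 <= b / 4.
Proof. by move=> ab; rewrite ler_pM2r. Qed.

Local Notation J := (@polar_boundary R).

Section Goursat.
Variables (G : C -> C) (z0 : C) (X : R).
Hypothesis hG : forall x t, x <= X -> cdiff G (z0 + E x t).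
(** Freezing the radius at [expR X] makes [F] continuous for every [x], as [scont] asks, without
    changing it where [x <= X]. *)
Let F x t := G (z0 + E (Num.min x X) t).

Lemma scontF : scont F.
Proof.
split => x t; have GC : ctsC G (z0 + E (Num.min x X) t) by apply: cdiff_cont; apply: hG; rewrite ge_min lexx orbT.
  have h0 := @ctsR_polar_radial R (Num.min x X) t.
  have h1 : ctsR (fun x => E (Num.min x X) t) x.
    by apply: (@cr_compR (fun x => E x t) (fun x => Num.min x X) x _ h0) => s; exact: min_lip.
  have h2 : ctsR (fun x => z0 + E (Num.min x X) t) x by cts.
  exact: (cr_comp h2 GC).
have h1 := @ctsR_polar_angular R (Num.min x X) t.
have h2 : ctsR (fun t => z0 + E (Num.min x X) t) t by cts.
exact: (cr_comp h2 GC).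
Qed.

(** The integrals over the four quarters add up to the whole, so one of them has at least a quarter
    of its modulus. *)
Lemma bisect_rectangle (w h x t : R) : 0 <= w -> 0 <= h ->
  exists p : R * R, [/\ x <= p.1, p.1 + w / 2 <= x + w, t <= p.2, p.2 + h / 2 <= t + h &
    nm (J F x (x + w) t (t + h)) / 4 <= nm (J F p.1 (p.1 + w / 2) p.2 (p.2 + h / 2))].
Proof.
move=> w0 h0.
have ex : x + w = x + w / 2 + w / 2 by rewrite -addrA -splitr.
have et : t + h = t + h / 2 + h / 2 by rewrite -addrA -splitr.
have J4 : J F x (x + w) t (t + h) = J F x (x + w / 2) t (t + h / 2)
    + J F x (x + w / 2) (t + h / 2) (t + h / 2 + h / 2)
    + (J F (x + w / 2) (x + w / 2 + w / 2) t (t + h / 2)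
    + J F (x + w / 2) (x + w / 2 + w / 2) (t + h / 2) (t + h / 2 + h / 2)).
  rewrite ex et (@polar_boundary_catx _ _ _ (x + w / 2)) ?lerDl ?divr_ge0//; last exact: scontF.
  by congr (_ + _); apply: polar_boundary_catt; rewrite ?lerDl ?divr_ge0//; exact: scontF.
have w2 : 0 <= w / 2 by rewrite divr_ge0.
have h2 : 0 <= h / 2 by rewrite divr_ge0.
have xw : x + w / 2 <= x + w by rewrite lerD2l; lra.
have th : t + h / 2 <= t + h by rewrite lerD2l; lra.
have HM := le_trans (nmD _ _) (lerD (nmD (J F x (x + w / 2) t (t + h / 2)) (J F x (x + w / 2) (t + h / 2) (t + h / 2 + h / 2)))
   (nmD (J F (x + w / 2) (x + w / 2 + w / 2) t (t + h / 2)) (J F (x + w / 2) (x + w / 2 + w / 2) (t + h / 2) (t + h / 2 + h / 2)))).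
rewrite -J4 in HM.
case: (pigeonhole4 HM) => H.
- by exists (x, t); split; [exact: lexx|exact: xw|exact: lexx|exact: th|exact: H].
- by exists (x, t + h / 2); split; [exact: lexx|exact: xw|rewrite lerDl|rewrite /= -et|exact: H].
- by exists (x + w / 2, t); split; [rewrite lerDl|rewrite /= -ex|exact: lexx|exact: th|exact: H].
- by exists (x + w / 2, t + h / 2); split; [rewrite lerDl|rewrite /= -ex|rewrite lerDl|rewrite /= -et|exact: H].
Qed.

(** Goursat's bisection: a nonzero integral [eta] leaves at least [eta / 4 ^ n] on nested
    rectangles. Near their common point [G] differs from an affine function by [e] times the
    distance, and the affine part integrates to zero, so the [n]-th integral is of order
    [e / 4 ^ n]. *)
Lemma goursat x0 x1 t0 t1 : x0 <= x1 -> x1 <= X -> t0 <= t1 -> J F x0 x1 t0 t1 = 0.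
Proof.
move=> x01 x1X t01; apply/eqP; rewrite -nm_eq0 eq_le nm_ge0 andbT leNgt; apply/negP.
set eta := nm _ => eta0.
pose w := x1 - x0; pose h := t1 - t0.
have w0 : 0 <= w by rewrite subr_ge0.
have h0 : 0 <= h by rewrite subr_ge0.
pose wn n := w / 2 ^+ n; pose hn n := h / 2 ^+ n.
have wn0 n : 0 <= wn n by rewrite divr_ge0// exprn_ge0.
have hn0 n : 0 <= hn n by rewrite divr_ge0// exprn_ge0.
have wnS n : wn n.+1 = wn n / 2 by rewrite /wn exprS; field.
have hnS n : hn n.+1 = hn n / 2 by rewrite /hn exprS; field.
pose nxt n (p : R * R) := sval (cid (bisect_rectangle p.1 p.2 (wn0 n) (hn0 n))).
pose fix P n := if n is m.+1 then nxt m (P m) else (x0, t0).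
have PS n : [/\ (P n).1 <= (P n.+1).1, (P n.+1).1 + wn n.+1 <= (P n).1 + wn n,
   (P n).2 <= (P n.+1).2, (P n.+1).2 + hn n.+1 <= (P n).2 + hn n &
   nm (J F (P n).1 ((P n).1 + wn n) (P n).2 ((P n).2 + hn n)) / 4 <=
   nm (J F (P n.+1).1 ((P n.+1).1 + wn n.+1) (P n.+1).2 ((P n.+1).2 + hn n.+1))].
  by rewrite wnS hnS; exact: (svalP (cid (bisect_rectangle (P n).1 (P n).2 (wn0 n) (hn0 n)))).
have PJ n : eta / 4 ^+ n <= nm (J F (P n).1 ((P n).1 + wn n) (P n).2 ((P n).2 + hn n)).
  elim: n => [|n IH].
    have W0 : x0 + wn 0%N = x1 by rewrite /wn expr0 divr1 /w addrC subrK.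
    have H0 : t0 + hn 0%N = t1 by rewrite /hn expr0 divr1 /h addrC subrK.
    rewrite -[X in _ <= X]/(nm (J F x0 (x0 + wn 0%N) t0 (t0 + hn 0%N))) W0 H0.
    by rewrite expr0 divr1 lexx.
  have [_ _ _ _ H4] := PS n.
  have -> : eta / 4 ^+ n.+1 = eta / 4 ^+ n / 4 by rewrite exprSr invfM mulrA.
  exact: le_trans (le_div4 IH) H4.
have Pmono m n : (m <= n)%N -> [/\ (P m).1 <= (P n).1, (P n).1 + wn n <= (P m).1 + wn m,
   (P m).2 <= (P n).2 & (P n).2 + hn n <= (P m).2 + hn m].
  move=> /subnK <-; elim: (n - m)%N => [|k [i1 i2 i3 i4]]; first by rewrite add0n; split.
  rewrite addSn; have [j1 j2 j3 j4 _] := PS (k + m)%N.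
  by split; [exact: le_trans i1 j1|exact: le_trans j2 i2|exact: le_trans i3 j3|exact: le_trans j4 i4].
(* The corners have a cluster point, and nesting places it in every rectangle. *)
have [zl zlP] : exists z, forall e : R, 0 < e -> forall N, exists2 n, (N <= n)%N & nm (((P n).1 +i* (P n).2) - z) < e.
  apply: (@bolzano_weierstrass R _ (`|x0| + w + (`|t0| + h))) => n; apply: le_trans (nm_ReIm _) _.
  have [i1 i2 i3 i4] := Pmono 0%N n (leq0n n); have k1 := wn0 n; have k2 := hn0 n.
  move: i1 i2 i3 i4; rewrite /= /wn /hn expr0 !divr1 -/(wn n) -/(hn n) => i1 i2 i3 i4.
  have a1 := ler_norm x0; have a2 := ler_norm (- x0); have a3 := ler_norm t0; have a4 := ler_norm (- t0).
  rewrite normrN in a2; rewrite normrN in a4.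
  apply: lerD; rewrite ler_norml; apply/andP.
    by move: i1 i2 k1 a1 a2; move: (P n).1 (wn n); clear; split; lra.
  by move: i3 i4 k2 a3 a4; move: (P n).2 (hn n); clear; split; lra.
pose a := Re zl; pose b := Im zl.
have Hab m : [/\ (P m).1 <= a, a <= (P m).1 + wn m, (P m).2 <= b & b <= (P m).2 + hn m].
  have K e : 0 < e -> [/\ (P m).1 <= a + e, a <= (P m).1 + wn m + e, (P m).2 <= b + e & b <= (P m).2 + hn m + e].
    move=> /zlP /(_ m) [n mn H]; have [i1 i2 i3 i4] := Pmono m n mn.
    have k1 := wn0 n; have k2 := hn0 n.
    have := le_lt_trans (nm_Re _) H; have := le_lt_trans (nm_Im _) H.
    rewrite /a /b; case: (zl) => p q /=; rewrite !ltr_norml => /andP[j1 j2] /andP[j3 j4].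
    move: i1 i2 i3 i4 k1 k2 j1 j2 j3 j4.
    by move: (P n) (P m) (wn n) (wn m) (hn n) (hn m) p q; clear; split; lra.
  by split; apply/ler_addgt0Pr => e /K [].
have aX : a <= X by have [_ H _ _] := Hab 0%N; move: H; rewrite /= /wn expr0 divr1 /w; lra.
pose z1 := z0 + E a b.
have [g gc gE] := hG b aX.
pose L := 2 * expR X.
have L0 : 0 < L by rewrite mulr_gt0// expR_gt0.
(* The constant of the closing estimate; the [+ 1] keeps [D] positive and makes that estimate
   strict, as [e * (D - 1) < eta]. *)
pose D := 4 * L * (w + h) ^+ 2 + 1.
have D0 : 0 < D by rewrite ltr_wpDl// mulr_ge0 ?sqr_ge0// mulr_ge0// ltW.
pose e := eta / D.
have e0 : 0 < e by rewrite divr_gt0.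
have /ctsCP/(_ _ e0) [d d0 dH] := gc.
have [n Hn] : exists n, L * (wn n + hn n) < d.
  have q0 : 0 < L * (w + h) / d + 1 by rewrite ltr_wpDl// divr_ge0 ?(ltW d0)// mulr_ge0 ?(ltW L0)// addr_ge0.
  have [N HN] : exists N : nat, L * (w + h) / d + 1 < N%:R.
    by exists (Num.trunc (L * (w + h) / d + 1)).+1; exact: truncnS_gt.
  exists N; rewrite /wn /hn -mulrDl mulrA ltr_pdivrMr ?exprn_gt0//.
  rewrite -ltr_pdivrMl// mulrC; apply: lt_le_trans (_ : N%:R <= _).
    by apply: lt_trans HN; rewrite ltrDl.
  by rewrite -natrX ler_nat ltnW// ltn_expl.
have := PJ n; apply/negP; rewrite -ltNge.
set p := P n; have [i1 i2 i3 i4] := Hab n; rewrite -/p in i1 i2 i3 i4.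
(* First-order expansion of [G] at the limit point [z1], affine in [polar] and hence of zero
   boundary integral. *)
pose A x t := (G z1 - g z1 * E a b) + g z1 * E x t.
have sA : scont A by exact: scont_affine.
have [_ pX _ _] := Pmono 0%N n (leq0n n).
have {}pX : p.1 + wn n <= X by apply: le_trans pX _; rewrite /= /wn expr0 divr1 /w; lra.
have JE : J F p.1 (p.1 + wn n) p.2 (p.2 + hn n) = J (fun x t => F x t - A x t) p.1 (p.1 + wn n) p.2 (p.2 + hn n).
  by rewrite (polar_boundaryB _ _ _ _ scontF sA) polar_boundary_affine ?subr0// lerDl.
have sFA : scont (fun x t => F x t - A x t).
  have [Fx Ft] := scontF; have [Ax At] := sA.
  by split => x t; [exact: crB (Fx x t) (Ax x t)|exact: crB (Ft x t) (At x t)].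
have pw : p.1 <= p.1 + wn n by rewrite lerDl.
have ph : p.2 <= p.2 + hn n by rewrite lerDl.
have key x t : p.1 <= x <= p.1 + wn n -> p.2 <= t <= p.2 + hn n ->
    nm (F x t - A x t) <= e * (L * (wn n + hn n)).
  move=> /andP[x1' x2'] /andP[t1' t2'].
  have xX : x <= X by exact: le_trans pX.
  have -> : F x t - A x t = (g (z0 + E x t) - g z1) * (z0 + E x t - z1).
    rewrite mulrBl -gE /F (min_idPl xX) /A /z1; ring.
  have zz : nm (z0 + E x t - z1) <= L * (wn n + hn n).
    rewrite /z1 (_ : _ - (z0 + _) = E x t - E a b); last by ring.
    apply: le_trans (polar_lip _ _ xX aX) _; rewrite -/L ler_pM2l//.
    apply: lerD; rewrite ler_norml; apply/andP.
      by move: x1' x2' i1 i2; clear; split; lra.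
    by move: t1' t2' i3 i4; clear; split; lra.
  rewrite nmM; apply: ler_pM; rewrite ?nm_ge0//; apply/ltW; apply: dH.
  exact: le_lt_trans zz Hn.
rewrite JE; apply: le_lt_trans (polar_boundary_bnd sFA pw ph key) _.
rewrite !(addrC _.1) !(addrC _.2) !addrK.
have -> : 4 * (e * (L * (wn n + hn n))) * (wn n + hn n) = e * (D - 1) / 4 ^+ n.
  rewrite /D addrK /wn /hn -!mulrDl (_ : 4 = 2 * 2 :> R) ?exprMn; last by rewrite -natrM.
  by field; rewrite expf_neq0.
rewrite ltr_pM2r ?invr_gt0 ?exprn_gt0// mulrBr mulr1 /e divfK ?gt_eqF//.
by rewrite ltrBlDr ltrDl divr_gt0.
Qed.
End Goursat.
End GoursatLemma.

(** * Mean value property and maximum principle *)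

Section MaximumPrinciple.
Variable R : realType.
Local Notation C := R[i].
Local Notation Co := (R[i]^o).
Local Notation nm := (@ComplexField.Normc.normc R).
Implicit Types (z w : C) (f g : C -> C).

Local Notation Re := (@complex.Re R).
Local Notation Im := (@complex.Im R).
Local Notation E := (@polar R).

Definition adherentC (W : set C) z := forall e : R, 0 < e -> exists2 w, W w & nm (w - z) < e.
Definition openC (W : set C) := forall z, W z -> exists2 d : R, 0 < d & forall w, nm (w - z) < d -> W w.

Lemma compact_bc (K : set C) (M : R) : (forall z, adherentC K z -> K z) -> (forall z, K z -> nm z <= M) ->
  compact (K : set Co).
Proof.
move=> clK bK.
pose f (p : R * R) : Co := p.1 +i* p.2.
have cf : continuous f.
  move=> p A /nbhs_cP [e e0 eA].
  have e2 : 0 < e / 2 by rewrite divr_gt0.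
  exists (ball p.1 (e / 2), ball p.2 (e / 2)); first by split; exact: nbhsx_ballx.
  move=> q [/= h1 h2]; apply: eA; rewrite /f; apply: le_lt_trans (nm_ReIm _) _.
  by rewrite [e]splitr /= distrC (distrC q.2); exact: ltrD.
have sq : compact (f @` (`[- M, M] `*` `[- M, M])).
  by apply: continuous_compact; [exact: continuous_subspaceT|apply: compact_setX; exact: segment_compact].
apply: (subclosed_compact _ sq).
  move=> z /= hz; apply: clK => e e0.
  have [|w [Kw hw]] := hz [set w | nm (w - z) < e]; first by apply/nbhs_cP; exists e.
  by exists w.
move=> z /bK zM; exists (Re z, Im z); last by rewrite /f; case: (z).
by split; rewrite /= in_itv /= -ler_norml; [exact: le_trans (nm_Re _) zM|exact: le_trans (nm_Im _) zM].
Qed.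

Lemma max_attained (K : set C) (M : R) (h : C -> R) : K !=set0 ->
  (forall z, adherentC K z -> K z) -> (forall z, K z -> nm z <= M) ->
  (forall z, K z -> forall e : R, 0 < e -> exists2 d : R, 0 < d & forall w, nm (w - z) < d -> `|h w - h z| < e) ->
  exists2 m, K m & forall z, K z -> h z <= h m.
Proof.
move=> K0 clK bK ch.
have [|m mK hm] := @compact_EVT_max Co R h K K0 (compact_bc clK bK).
  apply: continuous_in_subspaceT => z; rewrite inE => Kz; apply/cont_crP; exact: ch.
by exists m; [move: mK; rewrite inE|move=> z Kz; apply: hm; rewrite inE].
Qed.

Lemma polar_2pi x : E x (2 * pi) = E x 0.
Proof. by rewrite /polar mulr_natl cos2pi sin2pi cos0 sin0. Qed.

Local Notation J := (@polar_boundary R).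

(** On a rectangle of height [2 * pi] the sides [t = 0] and [t = 2 * pi] cancel by periodicity, so
    circles of radius [expR x] and [expR X] have the same integral. A small inner circle sees values
    close to [G z0]. *)
Lemma mean_value (G : C -> C) z0 (X : R) :
  (forall x t, x <= X -> cdiff G (z0 + E x t)) -> ctsC G z0 ->
  cint (fun t => G z0 - G (z0 + E X t)) 0 (2 * pi) = 0.
Proof.
move=> hG cG; apply/eqP; rewrite -nm_eq0 eq_le nm_ge0 andbT.
have pi2 : 0 <= 2 * pi :> R by rewrite mulr_ge0 ?pi_ge0.
pose F x t := G (z0 + E (Num.min x X) t).
have sF : scont F := scontF hG.
have FE x t : x <= X -> F x t = G (z0 + E x t) by move=> xX; rewrite /F (min_idPl xX).
have cF x t : ctsR (fun t => F x t) t := sF.2 x t.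
have cB x t : ctsR (fun t => G z0 - F x t) t by have h := cF x t; cts.
suff H e : 0 < e -> nm (cint (fun t => G z0 - G (z0 + E X t)) 0 (2 * pi)) <= 0 + e * (4 * pi).
  apply/ler_addgt0Pr => e e0; have p0 : 0 < 4 * pi :> R by rewrite mulr_gt0// pi_gt0.
  by have := H _ (divr_gt0 e0 p0); rewrite divfK// gt_eqF.
move=> e0; have /ctsCP/(_ _ e0) [d d0 dH] := cG.
pose x := Num.min X (ln (d / 2)).
have d2 : 0 < d / 2 by rewrite divr_gt0.
have xX : x <= X by rewrite ge_min lexx.
have xd : expR x < d.
  apply: le_lt_trans (_ : expR (ln (d / 2)) < d); first by rewrite ler_expR ge_min lexx orbT.
  by rewrite lnK ?posrE//; lra.
have J0 := goursat hG xX (lexx X) pi2; rewrite -/F in J0.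
have I0 : cint (fun t => F X t - F x t) 0 (2 * pi) = 0.
  move: J0; rewrite /polar_boundary (_ : (fun y => F y 0 - F y (2 * pi)) = fun=> 0 * 0); last first.
    by apply/funext => y; rewrite /F polar_2pi subrr mul0r.
  rewrite cintZ; last by move=> y; exact: crK.
  rewrite mul0r add0r => /eqP; rewrite mulf_eq0 => /orP[|/eqP//].
  by rewrite eq_complex /= eqxx oner_eq0.
have -> : (fun t => G z0 - G (z0 + E X t)) = fun t => (G z0 - F x t) - (F X t - F x t).
  by apply/funext => t; rewrite (FE X)//; ring.
rewrite cintB; [|exact: cB|by move=> t; have h1 := cF X t; have h2 := cF x t; cts].
rewrite I0 subr0 add0r.
apply: le_trans (@cint_bnd _ _ _ _ e (cB x) pi2 _) _; last by rewrite subr0; lra.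
move=> t _; rewrite FE// nmBC; apply/ltW/dH.
by rewrite addrC addKr nm_polar.
Qed.

(** With [u] the conjugate of [G z0], the real part of [u * (G z0 - G)] is nonnegative on the circle
    and has integral zero, so it vanishes inside the interval; then
    [|G z0| ^ 2 = Re (u * G) <= |G z0| |G|]. *)
Lemma max_circle (G : C -> C) z0 (X : R) :
  (forall x t, x <= X -> cdiff G (z0 + E x t)) -> ctsC G z0 ->
  (forall t, nm (G (z0 + E X t)) <= nm (G z0)) ->
  forall t, 0 < t < 2 * pi -> nm (G (z0 + E X t)) = nm (G z0).
Proof.
move=> hG cG hm t tI; apply/eqP; rewrite eq_le hm /=.
pose u := (G z0)^*%C.
have nu : nm u = nm (G z0) by rewrite /u; case: (G z0) => a b /=; rewrite sqrrN.
pose c t := u * (G z0 - G (z0 + E X t)).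
have cc t' : ctsR (fun t => G z0 - G (z0 + E X t)) t'.
  have h1 := @ctsR_polar_angular R X t'; have h2 : ctsR (fun t => z0 + E X t) t' by cts.
  have h3 := cr_comp h2 (cdiff_cont (hG X t' (lexx X))); cts.
have cc' t' : ctsR c t' by have h := cc t'; rewrite /c; cts.
have I0 : cint c 0 (2 * pi) = 0 by rewrite /c cintZ// mean_value// mulr0.
have uG : u * G z0 = (nm (G z0) ^+ 2)%:C.
  by rewrite nm_sqr /u; case: (G z0) => a b; apply/eqP; rewrite eq_complex /= !expr2; apply/andP; split; apply/eqP; ring.
have uRe z : Re (u * z) <= nm (G z0) * nm z.
  by rewrite -nu -nmM; apply: le_trans (nm_Re _); exact: ler_norm.
have cE s : Re (c s) = nm (G z0) ^+ 2 - Re (u * G (z0 + E X s)).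
  by rewrite /c mulrBr uG raddfB.
have c0 s : 0 <= Re (c s).
  rewrite cE subr_ge0; apply: le_trans (uRe _) _; rewrite expr2.
  by apply: ler_wpM2l; rewrite ?nm_ge0.
have pi2 : 0 <= 2 * pi :> R by rewrite mulr_ge0 ?pi_ge0.
have := itg_eq0 (ctsR_Re cc') pi2 c0; rewrite -[itg _ _ _]/(Re (cint c 0 (2 * pi))) I0.
move=> /(_ erefl t tI); rewrite cE => /eqP; rewrite subr_eq0 => /eqP E0.
have := uRe (G (z0 + E X t)); rewrite -E0 expr2.
have [-> _|p] := eqVneq (nm (G z0)) 0; first exact: nm_ge0.
by rewrite ler_pM2l// lt_def p nm_ge0.
Qed.

(** Among the maximizers of [|G|] on the closure take one with largest real part. If the maximum
    exceeded 1 it would lie in [W], and a small circle around it would contain maximizers further to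
    the right. *)
Lemma max_principle (W : set C) (G : C -> C) (M : R) : openC W -> (forall z, W z -> nm z <= M) ->
  (forall z, adherentC W z -> cdiff G z) ->
  (forall z, adherentC W z -> ~ W z -> nm (G z) <= 1) -> forall z, W z -> nm (G z) <= 1.
Proof.
move=> oW bW dG bG z Wz; rewrite leNgt; apply/negP => Gz.
have Wcl : W `<=` adherentC W by move=> w Ww e e0; exists w => //; rewrite subrr nm0.
have clcl w : adherentC (adherentC W) w -> adherentC W w.
  move=> hw e e0; have e2 : 0 < e / 2 by rewrite divr_gt0.
  have [w' /(_ _ e2) [w'' Ww h1] h2] := hw _ e2; exists w'' => //.
  by apply: le_lt_trans (nm_tri _ w' _) _; rewrite [e]splitr; exact: ltrD.
have bcl w : adherentC W w -> nm w <= M + 1.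
  move=> /(_ _ ltr01) [w' /bW h1 h2]; have := nm_sub w w'; rewrite nmBC; lra.
have cG w : adherentC W w -> forall e : R, 0 < e -> exists2 d : R, 0 < d & forall v, nm (v - w) < d -> `|nm (G v) - nm (G w)| < e.
  move=> /dG /cdiff_cont /ctsCP cGw e /cGw [d d0 dH]; exists d => // v /dH; apply: le_lt_trans.
  by rewrite ler_norml lerNl opprB nm_sub nmBC nm_sub.
have [m Km Hm] := max_attained (ex_intro _ z (Wcl _ Wz)) clcl bcl cG.
pose K := [set w | adherentC W w /\ nm (G w) = nm (G m)].
have clK w : adherentC K w -> K w.
  move=> hw; have clw : adherentC W w by apply: clcl => e /hw [v [cv _] vw]; exists v.
  split => //; apply/eqP; rewrite eq_le Hm//=; apply/ler_addgt0Pr => e e0.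
  have [d d0 dH] := cG w clw e e0; have [v [_ <-] /dH] := hw d d0.
  by rewrite ltr_norml => /andP[_]; lra.
have [m' [clm' Em'] Hm'] : exists2 m', K m' & forall w, K w -> Re w <= Re m'.
  apply: (@max_attained K (M + 1)) => //; first by exists m.
    by move=> w [/bcl].
  move=> w _ e e0; exists e => // v; apply: le_lt_trans; rewrite -raddfB; exact: nm_Re.
have Gm' : 1 < nm (G m') by rewrite Em'; apply: lt_le_trans Gz (Hm _ (Wcl _ Wz)).
have Wm' : W m' by apply: contrapT => /(bG _ clm'); rewrite leNgt Gm'.
have [d d0 dH] := oW _ Wm'; have d2 : 0 < d / 2 by rewrite divr_gt0.
pose X := ln (d / 2).
have eX : expR X = d / 2 by rewrite lnK ?posrE.
have WE x t : x <= X -> W (m' + E x t).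
  move=> xX; apply: dH; rewrite addrC addKr nm_polar; apply: le_lt_trans (_ : expR X < _).
    by rewrite ler_expR.
  by rewrite eX; lra.
have pi0 : 0 < pi :> R := pi_gt0 R.
(* Equality on the circle is available for angles strictly between [0] and [2 * pi]; [pi / 4] is
   such an angle with positive cosine. *)
have H := @max_circle G m' X _ (cdiff_cont (dG _ clm')) _ (pi / 4).
have {H} : nm (G (m' + E X (pi / 4))) = nm (G m').
  apply: H; [by move=> x t /WE /Wcl /dG|by move=> t; rewrite Em'; apply: Hm; apply: Wcl; exact: WE|].
  by apply/andP; split; lra.
rewrite Em' => H; have K1 : K (m' + E X (pi / 4)) by split => //; apply: Wcl; exact: WE.
have := Hm' _ K1; rewrite raddfD /= gerDl leNgt mulr_gt0 ?expR_gt0// cos_gt0_pihalf//.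
by apply/andP; split; lra.
Qed.
End MaximumPrinciple.

(** * Square roots of nonvanishing functions on discs *)

Section DiscRoots.
Variable R : realType.
Local Notation C := R[i].
Local Notation Co := (R[i]^o).
Local Notation nm := (@ComplexField.Normc.normc R).
Implicit Types (z w : C) (f g : C -> C).

Lemma cdiff_near f z (g : C -> C) (d : R) : 0 < d -> ctsC g z ->
  (forall w, nm (w - z) < d -> f w - f z = g w * (w - z)) -> cdiff f z.
Proof.
move=> d0 gz fg.
exists (fun w => if nm (w - z) < d then g w else (f w - f z) / (w - z)).
  apply/ctsCP => e e0; move/ctsCP: gz => /(_ _ e0) [r r0 rH].
  exists (Num.min d r); first by rewrite lt_min d0.
  by move=> w; rewrite lt_min subrr nm0 d0 => /andP[-> /rH].
move=> w; case: ifPn => [/fg//|]; rewrite -leNgt => h.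
by rewrite divfK// -nm_gt0; exact: lt_le_trans h.
Qed.

Lemma ct_neq0 f z : ctsC f z -> f z != 0 -> exists2 d : R, 0 < d & forall w, nm (w - z) < d -> f w != 0.
Proof.
move=> /ctsCP fz f0; have p : 0 < nm (f z) by rewrite nm_gt0.
have [d d0 dH] := fz _ p; exists d => // w /dH; apply: contraTneq => ->.
by rewrite sub0r nmN ltxx.
Qed.

Lemma cdiffV f z : f z != 0 -> cdiff f z -> cdiff (fun w => (f w)^-1) z.
Proof.
move=> f0 fz; have fc := cdiff_cont fz; case: fz => [g gz fg].
have [d d0 dH] := ct_neq0 fc f0.
have hV := ctV f0 fc.
apply: (@cdiff_near _ _ (fun w => - (f z)^-1 * (g w * (f w)^-1)) d d0); first by cts.
move=> w /dH fw.
have -> : - (f z)^-1 * (g w * (f w)^-1) * (w - z) = - (f z)^-1 * (f w)^-1 * (g w * (w - z)) by ring.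
by rewrite -fg; field; rewrite fw f0.
Qed.

(** Since [(s w - s z) * (s w + s z) = h w - h z], the difference quotient of [s] is that of [h]
    divided by [s w + s z], which is nonzero near [z]. *)
Lemma cdiff_sqrt (s h : C -> C) z (d : R) : 0 < d ->
  (forall w, nm (w - z) < d -> s w ^+ 2 = h w) -> h z != 0 -> ctsC s z -> cdiff h z -> cdiff s z.
Proof.
move=> d0 sh hz cs [g gz hg].
have s2 : s z ^+ 2 = h z by apply: sh; rewrite subrr nm0.
have sz : s z != 0 by apply: contraNneq hz => s0; rewrite -s2 s0 expr0n.
have c2 : ctsC (fun w => s w + s z) z by cts.
have sz2 : s z + s z != 0 by rewrite -mulr2n mulrn_eq0.
have [r r0 rH] := ct_neq0 c2 sz2.
have cV := @ctV _ (fun w => s w + s z) z sz2 c2.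
apply: (@cdiff_near _ _ (fun w => g w * (s w + s z)^-1) (Num.min d r)); first by rewrite lt_min d0.
  by cts.
move=> w; rewrite lt_min => /andP[/sh sw /rH rw].
have : (s w - s z) * (s w + s z) = g w * (w - z) by rewrite -subr_sqr sw s2 hg.
by move=> H; rewrite mulrAC -H mulfK.
Qed.

Section DiscSqrt.
Variables (h : C -> C) (rho : R).
Hypothesis rho0 : 0 < rho.
Hypothesis hc : forall z, nm z <= rho -> ctsC h z.
Hypothesis h0 : forall z, nm z <= rho -> h z != 0.

Let subdiv n j z : C := (j%:R / n%:R)%:C * z.

Lemma subdiv_le n j z : (j <= n)%N -> nm z <= rho -> nm (subdiv n j z) <= rho.
Proof.
move=> jn zr; rewrite /subdiv nmM nm_real ger0_norm ?divr_ge0//.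
apply: le_trans zr; rewrite -[leRHS]mul1r; apply: ler_wpM2r; first exact: nm_ge0.
case: n jn => [|n] jn; first by rewrite invr0 mulr0.
by rewrite ler_pdivrMr// mul1r ler_nat.
Qed.

(** Uniform continuity by compactness: if every [n] failed, the offending pairs would accumulate at
    a point where [h] is continuous and nonzero. *)
Lemma fine_steps : exists2 n : nat, (0 < n)%N & forall z j, (j < n)%N -> nm z <= rho ->
  nm (1 - h (subdiv n j.+1 z) / h (subdiv n j z)) < 1.
Proof.
apply: contrapT => H.
have B n : exists p : C * nat, [/\ (p.2 < n.+1)%N, nm p.1 <= rho &
    1 <= nm (1 - h (subdiv n.+1 p.2.+1 p.1) / h (subdiv n.+1 p.2 p.1))].
  apply: contrapT => H1; apply: H; exists n.+1 => // z j jn zr.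
  by rewrite ltNge; apply/negP => H2; apply: H1; exists (z, j).
pose p n := sval (cid (B n)).
have pP n : [/\ ((p n).2 < n.+1)%N, nm (p n).1 <= rho &
    1 <= nm (1 - h (subdiv n.+1 (p n).2.+1 (p n).1) / h (subdiv n.+1 (p n).2 (p n).1))] := svalP (cid (B n)).
pose a n := subdiv n.+1 (p n).2 (p n).1; pose b n := subdiv n.+1 (p n).2.+1 (p n).1.
have ar n : nm (a n) <= rho by have [h1 h2 _] := pP n; apply: subdiv_le => //; exact: ltnW.
have br n : nm (b n) <= rho by have [h1 h2 _] := pP n; apply: subdiv_le.
have [z zP] := bolzano_weierstrass ar.
have zr : nm z <= rho.
  apply/ler_addgt0Pr => e /zP /(_ 0%N) [n _ hn].
  by have := nm_sub z (a n); rewrite nmBC; have := ar n; lra.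
have q0 : 0 < nm (h z) / 4 by rewrite divr_gt0// nm_gt0 h0.
have /ctsCP/(_ _ q0) [d d0 dH] := hc zr.
have d2 : 0 < d / 2 by rewrite divr_gt0.
have [N HN] : exists N : nat, rho / (d / 2) < N%:R.
  by exists (Num.trunc (rho / (d / 2))).+1; exact: truncnS_gt.
have [n Nn an] := zP _ d2 N.
have ab : nm (b n - a n) < d / 2.
  rewrite /a /b /subdiv -mulrBl -rmorphB -mulrBl -natrB// subSnn mul1r nmM nm_real.
  rewrite ger0_norm ?invr_ge0// ltr_pdivrMl//; have [_ pr _] := pP n.
  apply: le_lt_trans pr _; rewrite ltr_pdivrMr// in HN; apply: lt_le_trans HN _.
  by rewrite ler_pM2r// ler_nat; exact: leq_trans Nn _.
have bz : nm (b n - z) < d by have := nm_tri (b n) (a n) z; lra.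
have az : nm (a n - z) < d by lra.
have [_ _] := pP n; rewrite -/(a n) -/(b n) leNgt => /negP; apply.
have ha : h (a n) != 0 by exact: h0.
have -> : 1 - h (b n) / h (a n) = (h (a n) - h (b n)) / h (a n) by rewrite mulrBl divff.
rewrite nmM nmV ltr_pdivrMr ?nm_gt0// mul1r.
have := nm_tri (h (a n)) (h z) (h (b n)); rewrite (nmBC (h z)).
have := dH _ bz; have := dH _ az; have := nm_sub (h z) (h (a n)); rewrite (nmBC (h z) (h (a n))).
lra.
Qed.

(** Along a subdivided radius [h z] is [h 0] times a telescoping product of quotients lying in the
    unit disc around 1. The product of their principal roots is a continuous root. *)
Lemma disc_sqrt : exists s : C -> C, forall z, nm z <= rho -> ctsC s z /\ s z ^+ 2 = h z.
Proof.
have [n n0 Hn] := fine_steps.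
pose fix sq (j : nat) (z : C) {struct j} := if j is i.+1 then sq i z * sqrtc (h (subdiv n i.+1 z) / h (subdiv n i z)) else sqrtc (h 0).
have K j : (j <= n)%N -> forall z, nm z <= rho -> ctsC (sq j) z /\ sq j z ^+ 2 = h (subdiv n j z).
  elim: j => [|j IH] jn z zr.
    by split; [exact: ctK|rewrite /= sqr_sqrtc /subdiv !mul0r].
  have [IH1 IH2] := IH (ltnW jn) z zr.
  have p1 := subdiv_le jn zr; have p2 := subdiv_le (ltnW jn) zr.
  split; last by rewrite /= exprMn IH2 sqr_sqrtc mulrC divfK// h0.
  have cpt i : ctsC (subdiv n i) z by rewrite /subdiv; cts.
  have c1 := ct_comp (cpt j.+1) (hc p1); have c2 := ct_comp (cpt j) (hc p2).
  have c3 := @ctV _ (fun z => h (subdiv n j z)) z (h0 p2) c2.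
  have c4 : ctsC (fun z => h (subdiv n j.+1 z) / h (subdiv n j z)) z by cts.
  have c5 : ctsC (@sqrtc R) (h (subdiv n j.+1 z) / h (subdiv n j z)).
    rewrite -[X in ctsC _ X](subKr 1); apply: ct_sqrt1B; exact: Hn.
  have c6 := ct_comp c4 c5.
  rewrite /=; cts.
exists (sq n) => z zr; have [h1 h2] := K n (leqnn n) z zr; split; first exact: h1.
by rewrite h2 /subdiv divff ?mul1r// pnatr_eq0 -lt0n.
Qed.
End DiscSqrt.
End DiscRoots.

(** * Connected components of open sets *)

Section Components.
Variable R : realType.
Local Notation C := R[i].
Local Notation Co := (R[i]^o).
Local Notation nm := (@ComplexField.Normc.normc R).
Implicit Types (z w : C) (f g : C -> C).

Local Notation Re := (@complex.Re R).
Local Notation Im := (@complex.Im R).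

Lemma preconnected_ball z (r : R) : preconnected [set w | nm (w - z) < r].
Proof.
have [r0|r0] := leP r 0.
  by move=> P _ x y /= h; have := lt_le_trans h r0; rewrite ltNge nm_ge0.
have -> : [set w | nm (w - z) < r] = \bigcup_(w : {w | nm (w - z) < r}) [set seg z (sval w) t | t in setT].
  apply/seteqP; split => [w /= wr|_ [[w wr] _ [t _ <-]] /=].
    by exists (exist _ w wr) => //; exists 1 => //; rewrite seg1.
  by apply: seg_ball; rewrite ?subrr ?nm0.
apply: (@preconnected_bigcup _ _ _ z); first by move=> i; exists 0 => //; rewrite seg0.
by move=> i; apply: preconnected_range => t; exact: cr_seg.
Qed.

Definition locconst (O : set C) (P : C -> Prop) :=
  forall z, O z -> exists2 d : R, 0 < d & forall w, O w -> nm (w - z) < d -> (P w <-> P z).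

(* The quasi-component; for open sets it is the connected component. *)
Definition qcomponent (O : set C) z0 : set C := [set w | O w /\ forall P, locconst O P -> P z0 -> P w].

Section Comp.
Variables (O : set C) (z0 : C).
Hypothesis oO : openC O.
Hypothesis Oz0 : O z0.

Lemma qcomponent_refl : qcomponent O z0 z0. Proof. by []. Qed.
Lemma qcomponent_ball z w (d : R) : (forall w, nm (w - z) < d -> O w) -> nm (w - z) < d -> 
  qcomponent O z0 z <-> qcomponent O z0 w.
Proof.
move=> dO wd; have d0 : 0 < d by apply: le_lt_trans wd; exact: nm_ge0.
have zd : nm (z - z) < d by rewrite subrr nm0.
have LB P : locconst O P -> P z <-> P w.
  move=> LP; have LPb : forall x, nm (x - z) < d -> exists2 d' : R, 0 < d' & forall y, nm (y - z) < d -> nm (y - x) < d' -> (P y <-> P x).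
    move=> x xd; have [e e0 eH] := LP x (dO _ xd); exists e => // y yd; apply: eH; exact: dO.
  by split; apply: (@preconnected_ball z d P LPb).
by split => -[_ H]; split; [exact: dO|move=> P LP /(H P LP) /(LB P LP)|exact: dO|move=> P LP /(H P LP) /(LB P LP)].
Qed.
Lemma qcomponent_open : openC (qcomponent O z0).
Proof.
move=> z cz; have [d d0 dO] := oO cz.1; exists d => // w wd.
by apply/(qcomponent_ball dO wd).
Qed.
Lemma qcomponent_closed z : O z -> adherentC (qcomponent O z0) z -> qcomponent O z0 z.
Proof.
move=> Oz cz; have [d d0 dO] := oO Oz; have [w cw wd] := cz d d0.
by apply/(qcomponent_ball dO wd).
Qed.
(** A locally constant predicate on the component, extended by falsity to the rest of [O], remains
    locally constant because the component is relatively open and closed. *)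
Lemma qcomponent_conn : preconnected (qcomponent O z0).
Proof.
have from0 P : locconst (qcomponent O z0) P -> P z0 -> forall z, qcomponent O z0 z -> P z.
  move=> LP P0 z cz.
  have LQ : locconst O (fun x => qcomponent O z0 x /\ P x).
    move=> x Ox; have [d d0 dO] := oO Ox.
    have [cx|ncx] := pselect (qcomponent O z0 x).
      have [e e0 eH] := LP x cx; exists (Num.min d e); first by rewrite lt_min d0.
      move=> w Ow; rewrite lt_min => /andP[wd we].
      have cw : qcomponent O z0 w by apply/(qcomponent_ball dO wd).
      by have H := eH w cw we; split => -[h1 h2]; split => //; apply/H.
    exists d => // w Ow wd; have : ~ qcomponent O z0 w by move/(qcomponent_ball dO wd).
    by move=> ncw; split => -[].
  by have [] := cz.2 _ LQ (conj qcomponent_refl P0).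
move=> P LP z w cz cw Pz.
have [P0|nP0] := pselect (P z0); first exact: from0.
have LN : locconst (qcomponent O z0) (fun x => ~ P x).
  move=> x cx; have [e e0 eH] := LP x cx; exists e => // y cy yx.
  by have H := eH y cy yx; split => h1 h2; apply: h1; apply/H.
by have := from0 _ LN nP0 z cz.
Qed.
End Comp.

Lemma sqrtc_Im_gt0 z : 0 < Im z -> 0 < Im (sqrtc z).
Proof.
move=> h; have := @sqrtc_Re_gt0 R z; rewrite gt_eqF//= => /(_ erefl).
have := sqr_sqrtc z; case: (sqrtc z) => a b E a0; move: h; rewrite -E expr2 /=.
by rewrite mulrC -mulr2n pmulrn_lgt0// pmulr_lgt0.
Qed.
Lemma sqrtc_Im_lt0 z : Im z < 0 -> Im (sqrtc z) < 0.
Proof.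
move=> h; have := @sqrtc_Re_gt0 R z; rewrite lt_eqF//= => /(_ erefl).
have := sqr_sqrtc z; case: (sqrtc z) => a b E a0; move: h; rewrite -E expr2 /=.
by rewrite mulrC -mulr2n pmulrn_llt0// pmulr_llt0.
Qed.

(* A path over [z0] closed up by a chord under [z0] winds once around [z0]. *)
Lemma over_under_not_even (c e : R -> C) z0 :
  (forall t, ctsR c t) -> (forall t, ctsR e t) -> c 0 = e 0 -> c 1 = e 1 ->
  (forall t, Re (c t) = Re z0 -> Im z0 < Im (c t)) -> (forall t, Im (e t) < Im z0) ->
  Re (c 0) < Re z0 -> Re z0 < Re (c 1) -> ~ even_index c e z0.
Proof.
move=> cc ce c0 c1 hc he r0 r1 [s1 [s2 [h1 h2 E0 E1]]].
pose k := sqrtc 'i%C : C; pose k' := sqrtc (- 'i%C) : C.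
have k2 : k ^+ 2 = 'i%C by rewrite sqr_sqrtc.
have k'2 : k' ^+ 2 = - 'i%C by rewrite sqr_sqrtc.
have ii : 'i%C * 'i%C = -1 :> C by rewrite -expr2 sqr_i.
have i0 : 'i%C != 0 :> C by rewrite eq_complex /= oner_eq0 andbF.
(* Quarter turns move the upper path and the chord off the slit of the principal root; the factors
   [k] and [k'] undo them. *)
pose f1 t := sqrtc (- 'i%C * (c t - z0)); pose f2 t := sqrtc ('i%C * (e t - z0)).
have reim x : - 'i%C * x = Im x -i* Re x.
  by case: x => a b; apply/eqP; rewrite eq_complex /= ; apply/andP; split; apply/eqP; ring.
have reim' x : 'i%C * x = (- Im x) +i* Re x.
  by case: x => a b; apply/eqP; rewrite eq_complex /= ; apply/andP; split; apply/eqP; ring.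
have g1 t : c t - z0 != 0.
  apply/negP => /eqP /subr0_eq E; by have := hc t; rewrite E ltxx => /(_ erefl).
have g2 t : e t - z0 != 0.
  apply/negP => /eqP /subr0_eq E; by have := he t; rewrite E ltxx.
have cf1 t : ctsR f1 t.
  have h := cc t; have h' : ctsR (fun t => - 'i%C * (c t - z0)) t by cts.
  apply: (cr_comp h' (ct_sqrtc _)); rewrite reim /= oppr_eq0.
  rewrite !raddfB /= subr_gt0; have [E|nE] := eqVneq (Re (c t)) (Re z0).
    by rewrite E subrr eqxx /= hc.
  by rewrite subr_eq0 nE.
have cf2 t : ctsR f2 t.
  have h := ce t; have h' : ctsR (fun t => 'i%C * (e t - z0)) t by cts.
  apply: (cr_comp h' (ct_sqrtc _)); rewrite reim' /=.
  by apply/orP; right; rewrite oppr_gt0 raddfB /= subr_lt0.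
have e1 t : (k * f1 t) ^+ 2 = s1 t ^+ 2.
  by rewrite (h1 t).2 exprMn k2 sqr_sqrtc mulrA mulrN ii opprK mul1r.
have e2 t : (k' * f2 t) ^+ 2 = s2 t ^+ 2.
  by rewrite (h2 t).2 exprMn k'2 sqr_sqrtc mulrA mulNr ii opprK mul1r.
have n1 t : k * f1 t != 0 by rewrite -sqrf_eq0 e1 (h1 t).2.
have n2 t : k' * f2 t != 0 by rewrite -sqrf_eq0 e2 (h2 t).2.
have ck1 t : ctsR (fun t => k * f1 t) t by have h := cf1 t; cts.
have ck2 t : ctsR (fun t => k' * f2 t) t by have h := cf2 t; cts.
have [x1 x1E] : exists x, forall t, s1 t = x * (k * f1 t).
  have [H|H] := sqrt_unique ck1 (fun t => (h1 t).1) e1 n1; [exists 1|exists (-1)] => t;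
  by rewrite H ?mul1r ?mulN1r.
have [x2 x2E] : exists x, forall t, s2 t = x * (k' * f2 t).
  have [H|H] := sqrt_unique ck2 (fun t => (h2 t).1) e2 n2; [exists 1|exists (-1)] => t;
  by rewrite H ?mul1r ?mulN1r.
have s10 : s1 0 != 0 by rewrite -sqrf_eq0 (h1 0).2.
have P : s1 0 * s2 1 = s1 1 * s2 0 by rewrite E0 E1 mulrC.
have xk : x1 * k * (x2 * k') != 0.
  have a1 : s1 0 != 0 by rewrite -sqrf_eq0 (h1 0).2.
  have a2 : s2 0 != 0 by rewrite -sqrf_eq0 (h2 0).2.
  move: a1 a2; rewrite x1E x2E !mulrA !mulf_eq0 !negb_or => /andP[-> _] /andP[/andP[-> ->] _].
  by [].
(* Agreement at both ends forces this identity, whose left side has positive and whose right side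
   nonpositive imaginary part. *)
have {}P : f1 0 * f2 1 = f1 1 * f2 0.
  apply: (mulfI xk); move: P; rewrite !x1E !x2E => P.
  have L x y : x1 * k * (x2 * k') * (x * y) = x1 * (k * x) * (x2 * (k' * y)) by ring.
  by rewrite !L.
have a1 : 0 < Im (f1 0) by apply: sqrtc_Im_gt0; rewrite reim /= oppr_gt0 raddfB /= subr_lt0.
have a2 : 0 < Im (f2 1) by apply: sqrtc_Im_gt0; rewrite reim' /= raddfB /= subr_gt0 -c1.
have a3 : Im (f1 1) < 0 by apply: sqrtc_Im_lt0; rewrite reim /= oppr_lt0 raddfB /= subr_gt0.
have a4 : Im (f2 0) < 0 by apply: sqrtc_Im_lt0; rewrite reim' /= raddfB /= subr_lt0 -c0.
have b1 : 0 < Re (f1 0).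
  by apply: sqrtc_Re_gt0; apply/orP; left; rewrite reim /= oppr_eq0 raddfB /= subr_eq0 lt_eqF.
have b3 : 0 < Re (f1 1).
  by apply: sqrtc_Re_gt0; apply/orP; left; rewrite reim /= oppr_eq0 raddfB /= subr_eq0 gt_eqF.
have b2 : 0 < Re (f2 1).
  by apply: sqrtc_Re_gt0; apply/orP; left; rewrite reim' /= raddfB /= subr_eq0 -c1 gt_eqF.
have b4 : 0 < Re (f2 0).
  by apply: sqrtc_Re_gt0; apply/orP; left; rewrite reim' /= raddfB /= subr_eq0 -c0 lt_eqF.
move: P a1 a2 a3 a4 b1 b2 b3 b4.
case: (f1 0) => p0 q0; case: (f2 1) => p1 q1; case: (f1 1) => p2 q2; case: (f2 0) => p3 q3 /=.
move=> [_ E] a1 a2 a3 a4 b1 b2 b3 b4.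
have : 0 < p0 * q1 + q0 * p1 by apply: addr_gt0; exact: mulr_gt0.
have u1 : p2 * q3 <= 0 by apply: mulr_ge0_le0; exact: ltW.
have u2 : q2 * p3 <= 0 by apply: mulr_le0_ge0; exact: ltW.
by rewrite E; lra.
Qed.
End Components.

(** * Arcs on which a univalent function is large *)

Section LargeArcs.
Variable R : realType.
Local Notation C := R[i].
Local Notation Co := (R[i]^o).
Local Notation nm := (@ComplexField.Normc.normc R).
Implicit Types (z w : C) (f g : C -> C).

Local Notation Re := (@complex.Re R).
Local Notation Im := (@complex.Im R).

Lemma nm_seg0 z t : nm (seg 0 z t) <= nm z.
Proof.
rewrite /seg add0r subr0 nmM nm_real; have /andP[t0 t1] := @clamp_itv R t.
by rewrite ger0_norm// -[leRHS]mul1r; apply: ler_wpM2r; rewrite ?nm_ge0.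
Qed.

Lemma exp_unbounded (q B : R) : 1 < q -> exists n, B < q ^+ n.
Proof.
move=> q1; have q0 : 0 < q - 1 by rewrite subr_gt0.
have bern n : 1 + n%:R * (q - 1) <= q ^+ n.
  elim: n => [|n IH]; first by rewrite mul0r addr0 expr0.
  rewrite exprS; have h : 0 <= n%:R * (q - 1) * (q - 1) by rewrite mulr_ge0// ?mulr_ge0// ltW.
  apply: le_trans (_ : q * (1 + n%:R * (q - 1)) <= _); last by rewrite ler_pM2l//; lra.
  by rewrite -natr1; lra.
exists (Num.trunc (B / (q - 1))).+1; apply: lt_le_trans (bern _).
have := truncnS_gt (B / (q - 1)); rewrite ltr_pdivrMr//; lra.
Qed.

Section Cap.
Variables (phi : C -> C) (p : C).
Hypothesis hphi : forall z, nm z < 1 -> cdiff phi z.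
(** Continuity at [phi 0] of the inverse of [phi]: the form in which univalence enters. *)
Hypothesis hinv : forall d : R, 0 < d -> exists2 r : R, 0 < r &
  forall z, nm z < 1 -> nm (phi z - phi 0) < r -> nm z < d.
Hypothesis hp : forall z, nm z < 1 -> phi z != p.
Let S0 := sqrtc (phi 0 - p).

Let nm01 : nm 0 < 1. Proof. by rewrite nm0. Qed.
Let S02 : S0 ^+ 2 = phi 0 - p. Proof. exact: sqr_sqrtc. Qed.
Let S0n : S0 != 0. Proof. by rewrite -sqrf_eq0 S02 subr_eq0 hp. Qed.
(* [lra] fails when a section variable has been cleared. *)
Ltac shed := clear -hphi hinv hp nm01 S02 S0n.

(* [phi - p] has a square root which is injective together with its opposite,
   hence the square root omits a disc around [- S0]. *)
Lemma sqrt_away : exists2 eta : R, 0 < eta & forall (rho : R) (s : C -> C), rho < 1 ->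
  (forall z, nm z <= rho -> ctsC s z /\ s z ^+ 2 = phi z - p) -> s 0 = S0 ->
  forall z, nm z <= rho -> eta <= nm (s z + S0).
Proof.
have n0 : 0 < nm S0 by rewrite nm_gt0.
have n20 : 0 < nm S0 ^+ 2 by rewrite exprn_gt0.
have /ctsCP/(_ _ n20) [d d0 dH] := cdiff_cont (hphi nm01).
have [r r0 rH] := hinv d0.
(* If [|s z + S0| < |S0|] then [|s z - S0| < 3 |S0|]; the second entry then makes the product
   [|phi z - phi 0|] less than [r], which forces [z] close to [0]. *)
exists (Num.min (nm S0) (r / (3 * nm S0))).
  by rewrite lt_min n0 divr_gt0// mulr_gt0.
move=> rho s rho1 hs s0 z zr; rewrite leNgt lt_min; apply/negP => /andP[h1].
rewrite ltr_pdivlMr ?mulr_gt0// => h2.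
have z1 : nm z < 1 by exact: le_lt_trans rho1.
have hz : nm (phi z - phi 0) < r.
  have -> : phi z - phi 0 = (s z + S0) * (s z - S0).
    by rewrite mulrC -subr_sqr S02 (hs z zr).2; ring.
  rewrite nmM; apply: le_lt_trans h2; apply: ler_wpM2l; first exact: nm_ge0.
  have -> : s z - S0 = (s z + S0) - S0 *+ 2 by ring.
  by have := nmD (s z + S0) (- (S0 *+ 2)); rewrite nmN normcMn mulr2n; lra.
have zd := rH z z1 hz.
(* The normalized root along the segment from [0] to [z]. Its square stays in the right half-plane,
   so starting from 1 it cannot cross the imaginary axis, and [s z] is not near [- S0]. *)
pose m t := s (seg 0 z t) / S0.
have sr t : nm (seg 0 z t) <= rho by apply: le_trans (nm_seg0 _ _) zr.
have cm t : ctsR m t.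
  have c1 := @cr_seg R 0 z t; have c2 := cr_comp c1 (hs _ (sr t)).1.
  by rewrite /m; cts.
have m2 t : 0 < Re (m t ^+ 2).
  have -> : m t ^+ 2 = 1 - (phi 0 - phi (seg 0 z t)) / S0 ^+ 2.
    rewrite /m expr_div_n (hs _ (sr t)).2 -[in 1](divff (_ : S0 ^+ 2 != 0)) ?sqrf_eq0//.
    by rewrite -mulrBl S02; congr (_ / _); ring.
  apply: Re_1B_gt0; rewrite nmM nmV nmX ltr_pdivrMr// mul1r nmBC; apply: dH.
  by rewrite subr0; apply: le_lt_trans (nm_seg0 _ _) zd.
have mR t : Re (m t) != 0.
  apply: contraTneq (m2 t); rewrite expr2; case: (m t) => a b /= ->.
  by rewrite mul0r sub0r oppr_gt0 -leNgt -expr2 sqr_ge0.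
have : 0 < Re (m 1).
  apply: (@locconst_R R (fun t => 0 < Re (m t)) _ 0); last first.
    by rewrite /m seg0 s0 divff//= ltr01.
  move=> t; have e0 : 0 < `|Re (m t)| by rewrite normr_gt0.
  have /ctsRP/(_ _ e0) [q q0 qH] := cm t; exists q => // s' /qH h.
  have := le_lt_trans (nm_Re _) h; rewrite raddfB /= ltr_norml => /andP[k1 k2].
  have := mR t; rewrite neq_lt => /orP[h0|h0]; [rewrite ltr0_norm// in k1 k2|rewrite gtr0_norm// in k1 k2].
    by move: h0 k1 k2; shed; split => ?; lra.
  by move: h0 k1 k2; shed; split => ?; lra.
rewrite /m seg1 => Rm.
have : nm S0 <= nm (s z + S0); last by rewrite leNgt h1.
have -> : s z + S0 = (s z / S0 + 1) * S0 by rewrite mulrDl mul1r divfK.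
rewrite nmM -[leLHS]mul1r; apply: ler_wpM2r; first exact: nm_ge0.
apply: le_trans (nm_Re _); apply: le_trans (ler_norm _); rewrite raddfD /=.
by rewrite lerDr ltW.
Qed.

(** The test function [G] has modulus [eta / |s + S0|] times the [n]-th power of [|q| / D], with
    [|q|] the distance to a point below the disc. On the chord both factors are at most 1, on the
    arc a large [M] makes the first one small, and at [z0], between chord and arc, the power wins.
    By the maximum principle the component of [|G| > 1] at [z0] escapes, which the odd index of arc
    and chord around [z0] forbids. *)
Lemma no_large_arc (y0 y1 : R) : `|y0| < y1 -> y1 < 1 -> exists M : R, forall c : R -> C,
  (forall t, ctsR c t) -> (forall t, c (clamp t) = c t) ->
  (forall t, nm (c t) < 1) -> (forall t, y1 < nm (c t)) -> (forall t, y0 <= Im (c t)) ->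
  Im (c 0) = y0 -> Im (c 1) = y0 -> Re (c 0) < 0 -> 0 < Re (c 1) ->
  (forall t, M <= nm (phi (c t))) -> False.
Proof.
move=> y01 y11; have [eta eta0 Heta] := sqrt_away.
have [y01l y01r] : - y1 < y0 /\ y0 < y1 by move: y01; rewrite ltr_norml => /andP[].
have y1p : 0 < y1 by apply: le_lt_trans y01.
have dy : 0 < y1 - y0 by rewrite subr_gt0.
(* Circles around [- i A] flatten as [A] grows; for this [A] every point of the chord is strictly
   closer to the centre than [z0] is. *)
pose A := 1 + (y1 - y0)^-1.
have A1 : 1 < A by rewrite ltrDl invr_gt0.
have qgap : (y0 + A) ^+ 2 + 1 < (y1 + A) ^+ 2.
  have hA : (y1 - y0) * A = (y1 - y0) + 1 by rewrite /A mulrDr mulr1 divff// gt_eqF.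
  have -> : (y1 + A) ^+ 2 = (y0 + A) ^+ 2 + (y1 - y0) * (y1 + y0) + ((y1 - y0) * A) * 2 by ring.
  rewrite hA; have : 0 <= (y1 - y0) * (y1 + y0) by apply: mulr_ge0; lra.
  lra.
pose D := Num.sqrt ((y0 + A) ^+ 2 + 1).
have D2 : D ^+ 2 = (y0 + A) ^+ 2 + 1 by rewrite sqr_sqrtr// addr_ge0// sqr_ge0.
have D0 : 0 < D by rewrite sqrtr_gt0 ltr_wpDl ?sqr_ge0.
pose z0 : C := 0 +i* y1.
have nz0 : nm z0 = y1 by rewrite /= expr0n add0r sqrtr_sqr gtr0_norm.
have z01 : nm z0 < 1 by rewrite nz0.
pose q z := z + 0 +i* A.
have nq z : nm (q z) ^+ 2 = Re z ^+ 2 + (Im z + A) ^+ 2.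
  by rewrite nm_sqr /q; case: z => a b /=; rewrite addr0.
have qz0 : nm (q z0) = y1 + A.
  by rewrite /= addr0 expr0n add0r sqrtr_sqr gtr0_norm// addr_gt0//; lra.
have Dq : 1 < nm (q z0) / D.
  rewrite ltr_pdivlMr// mul1r -ltr_sqr ?nnegrE ?(ltW D0) ?nm_ge0//.
  by rewrite D2 qz0.
have q1 z : nm z < 1 -> nm (q z) <= 1 + A.
  move=> h; apply: le_trans (nmD _ _) _; apply: lerD; first exact: ltW.
  by rewrite /= expr0n add0r sqrtr_sqr gtr0_norm//; lra.
(* [B] bounds [|s + S0|] at [z0] whatever the root, [n] makes the gain at [z0] exceed [B / eta], and
   [K] is the size of [|s + S0|] required on the arc. All are fixed before [c] is given. *)
pose B := Num.sqrt (nm (phi z0 - p)) + nm S0.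
have B0 : 0 < B by rewrite ltr_wpDl ?sqrtr_ge0// nm_gt0.
have [n Hn] := exp_unbounded (B / eta) Dq.
pose K := eta * (1 + A) ^+ n / D ^+ n.
have K0 : 0 < K by rewrite divr_gt0 ?exprn_gt0// mulr_gt0// exprn_gt0//; lra.
(* This gives [|s| ^ 2 = |phi - p| >= (K + |S0|) ^ 2] on the arc, hence [|s + S0| >= K]. *)
exists (nm p + (K + nm S0) ^+ 2) => c cc clc c1 cy cI I0 I1 R0 R1 cM.
have [tm Htm] := exists_max_nm cc clc; set rho1 := nm (c tm) in Htm.
have rho11 : rho1 < 1 by exact: c1.
(* The arc lies within radius [rho1], the set [O] within [rho2], and the root exists up to [rho3];
   the gaps leave room for neighbourhoods. *)
pose rho2 := (1 + rho1) / 2; pose rho3 := (1 + rho2) / 2.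
have r12 : rho1 < rho2 by rewrite /rho2; move: rho11; shed; lra.
have r23 : rho2 < rho3 by rewrite /rho3 /rho2; move: rho11; shed; lra.
have r31 : rho3 < 1 by rewrite /rho3 /rho2; move: rho11; shed; lra.
have r1p : y1 < rho1 by exact: cy.
have r3p : 0 < rho3 by exact: lt_trans y1p (lt_trans r1p (lt_trans r12 r23)).
have [s0 Hs0] : exists s : C -> C, forall z, nm z <= rho3 -> ctsC s z /\ s z ^+ 2 = phi z - p.
  apply: disc_sqrt => // z zr.
    have h := cdiff_cont (hphi (le_lt_trans zr r31)); cts.
  by rewrite subr_eq0 hp//; exact: le_lt_trans r31.
have [s Hs sS0] : exists2 s : C -> C, (forall z, nm z <= rho3 -> ctsC s z /\ s z ^+ 2 = phi z - p) & s 0 = S0.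
  have : s0 0 ^+ 2 = S0 ^+ 2 by rewrite S02 (Hs0 0 _).2// nm0 ltW.
  move/eqP; rewrite eqf_sqr => /orP[|] /eqP E; first by exists s0.
  exists (fun z => - s0 z); last by rewrite E opprK.
  by move=> z zr; have [h1 h2] := Hs0 z zr; split; [cts|rewrite sqrrN].
have sS z : nm z <= rho3 -> eta <= nm (s z + S0) := Heta _ _ r31 Hs sS0 z.
have sSn z : nm z <= rho3 -> s z + S0 != 0.
  by move=> /sS h; rewrite -nm_gt0; exact: lt_le_trans h.
pose G z := (eta / D ^+ n)%:C * ((s z + S0)^-1 * q z ^+ n).
have nG z : nm (G z) = eta / nm (s z + S0) * (nm (q z) / D) ^+ n.
  rewrite /G !nmM nmV nmX nm_real ger0_norm; last by rewrite divr_ge0 ?exprn_ge0 ?ltW.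
  by rewrite expr_div_n; ring.
have dG z : nm z < rho3 -> cdiff G z.
  move=> zr; have zr' := ltW zr; have [cs s2] := Hs z zr'.
  have z1 : nm z < 1 by exact: lt_trans r31.
  have d1 : cdiff (fun z => phi z - p) z by apply: cdiffD; [exact: hphi|exact: cdiff_cst].
  have d2 : cdiff s z.
    apply: (@cdiff_sqrt _ s (fun z => phi z - p) z (rho3 - nm z)); rewrite ?subr_gt0//.
      by move=> w h; apply: (Hs w _).2; have := nm_sub w z; move: h; shed; lra.
    by rewrite subr_eq0 hp.
  have d3 : cdiff (fun z => s z + S0) z by apply: cdiffD; [exact: d2|exact: cdiff_cst].
  have d4 := @cdiffV R (fun z => s z + S0) z (sSn z zr') d3.
  have d5 : cdiff q z by apply: cdiffD; [exact: cdiff_id|exact: cdiff_cst].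
  by apply: cdiffM; [exact: cdiff_cst|apply: cdiffM; [exact: d4|exact: cdiffX]].
have G1chord z : Im z = y0 -> nm z < rho3 -> nm (G z) <= 1.
  move=> Iz zr; rewrite nG.
  have z1 : nm z < 1 by exact: lt_trans r31.
  have h1 : nm (q z) / D <= 1.
    rewrite ler_pdivrMr// mul1r -ler_sqr ?nnegrE ?nm_ge0 ?(ltW D0)// D2 nq Iz addrC lerD2l.
    apply: le_trans (_ : nm z ^+ 2 <= 1); first by rewrite nm_sqr lerDl sqr_ge0.
    by rewrite expr_le1 ?nm_ge0// ltW.
  rewrite -[leRHS]mul1r; apply: ler_pM; rewrite ?divr_ge0 ?exprn_ge0 ?divr_ge0 ?nm_ge0 ?(ltW eta0) ?(ltW D0)//.
    by rewrite ler_pdivrMr ?mul1r ?sS ?(ltW zr)// nm_gt0 sSn// ltW.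
  by apply: exprn_ile1 => //; rewrite divr_ge0 ?nm_ge0// ltW.
have cr3 t : nm (c t) < rho3 by exact: le_lt_trans (Htm t) (lt_trans r12 r23).
have G1c t : nm (G (c t)) <= 1.
  rewrite nG; set x := s (c t).
  have x2 : (K + nm S0) ^+ 2 <= nm x ^+ 2.
    rewrite -nmX (Hs (c t) (ltW (cr3 t))).2.
    by have := cM t; have := nm_sub (phi (c t)) p; shed; lra.
  have xK : K <= nm (x + S0).
    have k0 : 0 <= K + nm S0 by rewrite addr_ge0 ?nm_ge0// ltW.
    rewrite ler_sqr ?nnegrE ?nm_ge0// in x2.
    by have := nm_sub x (- S0); rewrite opprK nmN; move: x2; shed; lra.
  apply: le_trans (_ : eta / K * ((1 + A) / D) ^+ n <= 1); last first.
    have A0 : 0 < 1 + A by exact: addr_gt0 ltr01 (lt_trans ltr01 A1).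
    have An : (1 + A) ^+ n != 0 by rewrite expf_neq0// gt_eqF.
    have Dn : D ^+ n != 0 by rewrite expf_neq0// gt_eqF.
    rewrite (_ : _ * _ = 1) ?lexx// /K expr_div_n; field.
    by rewrite Dn An gt_eqF.
  apply: ler_pM; rewrite ?divr_ge0 ?exprn_ge0 ?divr_ge0 ?nm_ge0 ?(ltW eta0) ?(ltW D0)//.
    by rewrite ler_pM2l// lef_pV2 ?posrE//; exact: lt_le_trans xK.
  by apply: lerXn2r; rewrite ?nnegrE ?divr_ge0 ?nm_ge0 ?(ltW D0)//; [exact: addr_ge0 ler01 (ltW (lt_trans ltr01 A1))|rewrite ler_pM2r ?invr_gt0// q1].
have Gz0 : 1 < nm (G z0).
  have z0r : nm z0 <= rho3 by rewrite nz0; exact: ltW (lt_trans r1p (lt_trans r12 r23)).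
  have z0B : nm (s z0 + S0) <= B.
    apply: le_trans (nmD _ _) _; rewrite lerD2r -(Hs z0 z0r).2 nmX sqrtr_sqr.
    exact: ler_norm.
  rewrite nG; apply: lt_le_trans (_ : eta / B * (nm (q z0) / D) ^+ n <= _); last first.
    apply: ler_wpM2r; first by rewrite exprn_ge0// divr_ge0 ?nm_ge0// ltW.
    rewrite ler_pM2l// lef_pV2 ?posrE// nm_gt0; exact: sSn.
  by rewrite -ltr_pdivrMl ?divr_gt0// invf_div mulr1.
pose O : set C := [set z | [/\ y0 < Im z, nm z < rho2 & 1 < nm (G z)]].
have oO : openC O.
  move=> z [h1 h2 h3].
  have e3 : 0 < nm (G z) - 1 by rewrite subr_gt0.
  have /ctsCP/(_ _ e3) [d d0 dH] := cdiff_cont (dG z (lt_trans h2 r23)).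
  exists (Num.min d (Num.min (Im z - y0) (rho2 - nm z))); first by rewrite !lt_min d0 !subr_gt0 h1.
  move=> w; rewrite !lt_min => /andP[/dH k1 /andP[k2 k3]]; split.
  - have := le_lt_trans (nm_Im _) k2; rewrite raddfB /= ltr_norml => /andP[]; shed; lra.
  - have := nm_sub w z; move: k3; shed; lra.
  - by have := nm_sub (G z) (G w); rewrite nmBC; move: k1; shed; lra.
have Oz0 : O z0 by split; [exact: y01r|rewrite nz0; exact: lt_trans r1p r12|exact: Gz0].
pose W := qcomponent O z0.
(* If [W] stayed within radius [rho1], its boundary points would satisfy [|G| <= 1], by the chord
   estimate or by the definition of [O], against [|G z0| > 1]. *)
have [z1 Wz1 z1r] : exists2 z1, W z1 & rho1 < nm z1.
  apply: contrapT => nex.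
  have Wr z : W z -> nm z <= rho1 by move=> Wz; rewrite leNgt; apply/negP => h; apply: nex; exists z.
  have clr z : adherentC W z -> nm z <= rho1.
    move=> cz; apply/ler_addgt0Pr => e /cz [w /Wr h1 h2]; have := nm_sub z w; rewrite nmBC; move: h1 h2; shed; lra.
  have := @max_principle R W G rho1 (qcomponent_open oO) Wr _ _ z0 (qcomponent_refl Oz0).
  rewrite leNgt Gz0 => H; apply/notF/H => z cz; first by apply: dG; exact: le_lt_trans (clr z cz) (lt_trans r12 r23).
  move=> nW; rewrite leNgt; apply/negP => G1; apply: nW; apply: (qcomponent_closed oO) => //.
  have Iz : y0 <= Im z.
    apply/ler_addgt0Pr => e /cz [w [[h1 _ _] _] h2].
    by have := le_lt_trans (nm_Im _) h2; rewrite raddfB /= ltr_norml => /andP[]; move: h1; shed; lra.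
  have zr := clr z cz.
  split; [|exact: le_lt_trans zr r12|exact: G1].
  rewrite lt_neqAle Iz andbT; apply/eqP => E; have := G1chord z (esym E).
  by rewrite leNgt G1 => /(_ _)/notF; apply; exact: le_lt_trans zr (lt_trans r12 r23).
(* From [z1], already outside the disc containing arc and chord, a radial ray leads on to infinity;
   [1 + t ^ 2] covers all factors at least 1. *)
pose ray t := (1 + t ^+ 2)%:C * z1.
pose Y := W `|` [set ray t | t in setT].
have rayr t : nm z1 <= nm (ray t).
  by rewrite /ray nmM nm_real -[leLHS]mul1r; apply: ler_wpM2r; rewrite ?nm_ge0// ger0_norm ?lerDl ?addr_ge0 ?sqr_ge0.
have cray t : ctsR ray t.
  have h : ctsR (fun t => t%:C) t by exact: cr_re.
  rewrite (_ : ray = fun t => (1 + t%:C * t%:C) * z1); first by cts.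
  by apply/funext => u; rewrite /ray rmorphD rmorphXn rmorph1 expr2.
have cY : preconnected Y.
  apply: (@preconnectedU _ _ _ z1) => //; first by exists 0 => //; rewrite /ray expr0n addr0 mul1r.
    exact: (qcomponent_conn oO Oz0).
  exact: preconnected_range.
pose e := seg (c 0) (c 1).
have ecl t : e (clamp t) = e t.
  by rewrite /e /seg (clampE (clamp_itv t)).
have eI t : Im (e t) = y0.
  by rewrite /e /seg; move: I0 I1; case: (c 0) => a b; case: (c 1) => a' b' /= -> ->; rewrite subrr mulr0 mul0r !addr0.
have er t : nm (e t) < nm z1.
  by rewrite -[e t]subr0; apply: seg_ball; rewrite subr0; apply: le_lt_trans z1r.
have ce t : ctsR e t by exact: cr_seg.
have e0 : c 0 = e 0 by rewrite /e seg0.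
have e1 : c 1 = e 1 by rewrite /e seg1.
have ev : even_index c e z0.
  apply: (even_index_unbounded cc ce e0 e1 cY _ clc ecl).
  - move=> z Yz; split.
      apply: (bounded_away_clamp cc clc) => t _; case: Yz => [[[_ _ Gz] _]|[u _ <-]].
        by apply: contraTneq Gz => <-; rewrite -leNgt.
      by apply: contraTneq (rayr u) => <-; rewrite -ltNge; exact: le_lt_trans (Htm t) z1r.
    apply: (bounded_away_clamp ce ecl) => t _; case: Yz => [[[Iz _ _] _]|[u _ <-]].
      by apply: contraTneq Iz => <-; rewrite eI ltxx.
    by apply: contraTneq (rayr u) => <-; rewrite -ltNge er.
  - move=> M; exists (ray (1 + `|M| / nm z1)); first by right; exists (1 + `|M| / nm z1).
    have n1 : 0 < nm z1 by exact: lt_trans y1p (lt_trans r1p z1r).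
    have x0 : 0 <= `|M| / nm z1 by rewrite divr_ge0 ?nm_ge0.
    rewrite /ray nmM nm_real ger0_norm ?addr_ge0 ?sqr_ge0//.
    rewrite -ler_pdivrMr//; apply: le_trans (_ : `|M| / nm z1 <= _).
      by rewrite ler_pM2r ?invr_gt0// ler_norm.
    have : 0 <= (`|M| / nm z1) ^+ 2 by exact: sqr_ge0.
    by rewrite sqrrD expr1n mul1r; move: x0; shed; lra.
  - by left; exact: qcomponent_refl.
apply: (over_under_not_even cc ce e0 e1 _ _ _ _ ev); [|by move=> t; rewrite eI|exact: R0|exact: R1].
move=> t /= E; have := cy t; have := cI t.
have : nm (c t) <= `|Re (c t)| + `|Im (c t)| by exact: nm_ReIm.
rewrite E normr0 add0r; move: y01l; shed.
by case: (ger0P (Im (c t))); lra.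
Qed.
End Cap.
End LargeArcs.

(** * Crossing paths *)

Section Crossing.
Variable R : realType.
Local Notation C := R[i].
Local Notation Co := (R[i]^o).
Local Notation nm := (@ComplexField.Normc.normc R).
Implicit Types (z w : C) (f g : C -> C).

Local Notation Re := (@complex.Re R).
Local Notation Im := (@complex.Im R).

(** These conditions are stable under rotation of the disc, which lets configurations on the circle
    be turned into a standard position. *)
Definition admissible (phi : C -> C) p := [/\ forall z, nm z < 1 -> cdiff phi z,
  forall d : R, 0 < d -> exists2 r : R, 0 < r &
    forall z, nm z < 1 -> nm (phi z - phi 0) < r -> nm z < d &
  forall z, nm z < 1 -> phi z != p].

Lemma admissible_rot phi p u : nm u = 1 -> admissible phi p -> admissible (fun z => phi (u * z)) p.
Proof.
move=> u1 [h1 h2 h3].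
have un z : nm (u * z) = nm z by rewrite nmM u1 mul1r.
split.
- move=> z z1; apply: (@cdiff_comp R (fun z => u * z) phi).
    by apply: cdiffM; [exact: cdiff_cst|exact: cdiff_id].
  by apply: h1; rewrite un.
- move=> d /h2 [r r0 rH]; exists r => // z z1; rewrite mulr0 => h.
  by rewrite -un; apply: rH => //; rewrite un.
- by move=> z z1; apply: h3; rewrite un.
Qed.

Lemma first_hit (Q : R -> Prop) (a b : R) : a <= b -> Q b ->
  (forall t, (forall e, 0 < e -> exists2 s, `|s - t| < e & Q s) -> Q t) ->
  exists2 c, a <= c <= b /\ Q c & forall t, a <= t < c -> ~ Q t.
Proof.
move=> ab Qb clQ; pose S := [set t | a <= t <= b /\ Q t].
have Sb : S b by split => //; rewrite ab lexx.
have lbS : lbound S a by move=> t [/andP[]].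
have hS : has_inf S by split; [exists b|exists a].
pose c := inf S.
have ac : a <= c by apply: lb_le_inf => //; exists b.
have cl t : S t -> c <= t by move=> St; apply: ge_inf => //; case: hS.
exists c; last first.
  move=> t /andP[at_ tc] Qt; have : c <= t by apply: (cl t); split => //; rewrite at_ /=; apply: le_trans (cl _ Sb); exact: ltW.
  by rewrite leNgt tc.
split; first by rewrite ac cl.
apply: clQ => e e0; have [s [sab Qs] sc] := inf_adherent e0 hS.
have cs : c <= s by exact: cl.
by exists s => //; rewrite ger0_norm ?subr_ge0// ltrBlDl.
Qed.

Lemma last_hit (Q : R -> Prop) (a b : R) : a <= b -> Q a ->
  (forall t, (forall e, 0 < e -> exists2 s, `|s - t| < e & Q s) -> Q t) ->
  exists2 c, a <= c <= b /\ Q c & forall t, c < t <= b -> ~ Q t.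
Proof.
move=> ab Qa clQ; have [||t H|c [/andP[bc ca] Qc] Hc] := @first_hit (fun t => Q (- t)) (- b) (- a).
- by rewrite lerN2.
- by rewrite opprK.
- apply: clQ => e /H [s st Qs]; exists (- s) => //.
  by rewrite (_ : - s - - t = - (s - t)) ?normrN//; ring.
exists (- c); first by rewrite lerNr lerNl bc ca.
move=> t /andP[ct tb]; have := Hc (- t); rewrite opprK; apply.
by rewrite lerN2 tb ltrNl.
Qed.

Lemma cont_reim (c : R -> C) t e : ctsR c t -> 0 < e -> exists2 d : R, 0 < d &
  forall s, `|s - t| < d -> `|Re (c s) - Re (c t)| < e /\ `|Im (c s) - Im (c t)| < e.
Proof.
move=> /ctsRP H /H [d d0 dH]; exists d => // s /dH h.
by split; rewrite -raddfB; apply: le_lt_trans h; [exact: nm_Re|exact: nm_Im].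
Qed.

(** Inside the strip the path cannot meet the imaginary axis, where [|g| > y1] exceeds the heights
    allowed. Between the last visit to the left half of the strip and the first visit to the right
    half it is off the strip, hence on one side of it. *)
Lemma crossing_path (g : R -> C) (yl yu y1 a b : R) : (forall t, ctsR g t) -> yl < yu ->
  `|yl| < y1 -> `|yu| < y1 -> a <= b ->
  (forall t, a <= t <= b -> y1 < nm (g t)) ->
  yl <= Im (g a) <= yu -> yl <= Im (g b) <= yu -> Re (g a) < 0 -> 0 < Re (g b) ->
  exists t1 t2 : R, [/\ a <= t1, t1 < t2, t2 <= b, Re (g t1) < 0 & 0 < Re (g t2)] /\
   ([/\ Im (g t1) = yu, Im (g t2) = yu & forall t, t1 <= t <= t2 -> yu <= Im (g t)] \/
    [/\ Im (g t1) = yl, Im (g t2) = yl & forall t, t1 <= t <= t2 -> Im (g t) <= yl]).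
Proof.
move=> cg ylu yl1 yu1 ab gy1 bda bdb ra rb.
have neq t : a <= t <= b -> yl <= Im (g t) <= yu -> Re (g t) != 0.
  move=> tab /andP[h1 h2]; apply/eqP => E; have := gy1 t tab.
  have := nm_ReIm (g t); rewrite E normr0 add0r => h3 h4.
  move: yl1 yu1; rewrite !ltr_norml => /andP[k1 k2] /andP[k3 k4].
  by case: (ger0P (Im (g t))) h3; lra.
have clQ (P : C -> Prop) : (forall z, (forall e : R, 0 < e -> exists2 w, `|Re w - Re z| < e /\ `|Im w - Im z| < e & P w) -> P z) ->
   forall t, (forall e, 0 < e -> exists2 s, `|s - t| < e & P (g s)) -> P (g t).
  move=> clP t H; apply: clP => e e0; have [d d0 dH] := cont_reim (cg t) e0.
  by have [s /dH h Ps] := H d d0; exists (g s).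
pose B z := yl <= Im z <= yu.
have clB z : (forall e : R, 0 < e -> exists2 w, `|Re w - Re z| < e /\ `|Im w - Im z| < e & B w) -> B z.
  move=> H; apply/andP; split; apply/ler_addgt0Pr => e /H [w [_ h] /andP[k1 k2]];
  by move: h; rewrite ltr_norml => /andP[]; lra.
have [t2 [/andP[at2 t2b] [B2 R2]] H2] : exists2 t2, a <= t2 <= b /\ (B (g t2) /\ 0 <= Re (g t2)) &
    forall t, a <= t < t2 -> ~ (B (g t) /\ 0 <= Re (g t)).
  apply: first_hit ab _ _; first by split => //; exact: ltW.
  apply: (clQ (fun z => B z /\ 0 <= Re z)) => z H; split.
    by apply: clB => e /H [w h []]; exists w.
  apply/ler_addgt0Pr => e /H [w [h _] [_ k]].
  by move: h; rewrite ltr_norml => /andP[]; lra.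
have [t1 [/andP[at1 t12] [B1 R1]] H1] : exists2 t1, a <= t1 <= t2 /\ (B (g t1) /\ Re (g t1) <= 0) &
    forall t, t1 < t <= t2 -> ~ (B (g t) /\ Re (g t) <= 0).
  apply: last_hit at2 _ _; first by split => //; exact: ltW.
  apply: (clQ (fun z => B z /\ Re z <= 0)) => z H; split.
    by apply: clB => e /H [w h []]; exists w.
  apply/ler_addgt0Pr => e /H [w [h _] [_ k]].
  by move: h; rewrite ltr_norml => /andP[]; lra.
have r2 : 0 < Re (g t2) by rewrite lt_def R2 neq// at2.
have r1 : Re (g t1) < 0 by rewrite lt_neqAle R1 neq// at1 (le_trans t12).
have {}t12 : t1 < t2 by rewrite lt_neqAle t12 andbT; apply/eqP => E; move: r1; rewrite E; lra.
exists t1, t2; split; first by split.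
have nB t : t1 < t < t2 -> yu < Im (g t) \/ Im (g t) < yl.
  move=> /andP[h1 h2]; have [|h3] := ltP yu (Im (g t)); first by left.
  have [|h4] := ltP (Im (g t)) yl; first by right.
  have Bt : B (g t) by rewrite /B h3 h4.
  have [h5|h5] := leP 0 (Re (g t)).
    by case: (H2 t); [rewrite h2 (le_trans at1 (ltW h1))|split].
  by case: (H1 t); [rewrite h1 ltW|split => //; exact: ltW].
pose m := (t1 + t2) / 2.
have m12 : t1 < m < t2 by rewrite /m; apply/andP; move: t12; clear; split; lra.
have sep s t : t1 < s < t2 -> t1 < t < t2 -> yu < Im (g s) -> ~ Im (g t) < yl.
  move=> sI tI hs ht.
  have cI : continuous (fun t => Im (g t)) by exact: ctsR_Im.
  have [c cI' Ec] : exists2 c, t1 < c < t2 & Im (g c) = (yl + yu) / 2.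
    have [st|ts] := leP s t.
      have [|c] := @IVT R (fun t => Im (g t)) s t ((yl + yu) / 2) st (continuous_subspaceT cI).
        by apply/andP; split; [rewrite ge_min|rewrite le_max]; apply/orP; [right|left]; move: hs ht ylu; clear; lra.
      by rewrite in_itv /= => /andP[c1 c2] <-; exists c => //;
        move: sI tI => /andP[s1 s2] /andP[u1 u2]; rewrite (lt_le_trans _ c1)// (le_lt_trans c2).
    have [|c] := @IVT R (fun t => Im (g t)) t s ((yl + yu) / 2) (ltW ts) (continuous_subspaceT cI).
      by apply/andP; split; [rewrite ge_min|rewrite le_max]; apply/orP; [left|right]; move: hs ht ylu; clear; lra.
    by rewrite in_itv /= => /andP[c1 c2] <-; exists c => //;
        move: sI tI => /andP[s1 s2] /andP[u1 u2]; rewrite (lt_le_trans _ c1)// (le_lt_trans c2).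
  by have := nB c cI'; rewrite Ec; move: ylu; clear => ? []; lra.
(* The one-sided bound passes to [t1] and [t2] by continuity; since these points also lie in the
   strip, they lie on its edge. *)
have closeU (P : R -> Prop) t : (forall x, (forall e, 0 < e -> exists2 w, `|w - x| < e & P w) -> P x) ->
    (forall s, t1 < s < t2 -> P (Im (g s))) -> t1 <= t <= t2 -> P (Im (g t)).
  move=> clP hP /andP[h1 h2]; apply: clP => e e0; have [d d0 dH] := cont_reim (cg t) e0.
  pose d' := Num.min d (t2 - t1).
  have d'0 : 0 < d' by rewrite lt_min d0 subr_gt0.
  have d'd : d' <= d by rewrite ge_min lexx.
  have d't : d' <= t2 - t1 by rewrite ge_min lexx orbT.
  have [s sI st] : exists2 s, t1 < s < t2 & `|s - t| < d.
    have [tm|tm] := leP t m; rewrite /m in tm.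
      exists (t + d' / 4); first by move: h1 tm d'0 d't; clear=> *; apply/andP; split; lra.
      by rewrite addrAC subrr add0r gtr0_norm ?divr_gt0//; move: d'0 d'd; clear; lra.
    exists (t - d' / 4); first by move: h2 tm d'0 d't; clear=> *; apply/andP; split; lra.
    by rewrite addrAC subrr sub0r normrN gtr0_norm ?divr_gt0//; move: d'0 d'd; clear; lra.
  by exists (Im (g s)); [exact: (dH s st).2|exact: hP].
have [hm|hm] := nB m m12; [left|right].
  have hP s : t1 < s < t2 -> yu <= Im (g s).
    by move=> sI; have [/ltW//|h] := nB s sI; case: (sep m s m12 sI hm).
  have K t : t1 <= t <= t2 -> yu <= Im (g t).
    apply: (closeU (fun x => yu <= x)) => // x H; apply/ler_addgt0Pr => e /H [w h k].
    by move: h k; rewrite ltr_norml => /andP[]; clear; lra.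
  have lt12 := ltW t12.
  split => //; apply/eqP; rewrite eq_le K ?lexx ?lt12// andbT; [by case/andP: B1|by case/andP: B2].
have hP s : t1 < s < t2 -> Im (g s) <= yl.
  by move=> sI; have [h|/ltW//] := nB s sI; case: (sep s m sI m12 h).
have K t : t1 <= t <= t2 -> Im (g t) <= yl.
  apply: (closeU (fun x => x <= yl)) => // x H; apply/ler_addgt0Pr => e /H [w h k].
  by move: h k; rewrite ltr_norml => /andP[]; clear; lra.
have lt12 := ltW t12.
by split => //; apply/eqP; rewrite eq_le K ?lexx ?lt12//=; [case/andP: B1|case/andP: B2].
Qed.
End Crossing.

(** * Landing of curves *)

Section Landing.
Variable R : realType.
Local Notation C := R[i].
Local Notation Co := (R[i]^o).
Local Notation nm := (@ComplexField.Normc.normc R).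
Implicit Types (z w : C) (f g : C -> C).

Local Notation Re := (@complex.Re R).
Local Notation Im := (@complex.Im R).

Lemma bounded_on_disc (phi : C -> C) (r : R) : (forall z, nm z <= r -> ctsC phi z) ->
  exists M : R, forall z, nm z <= r -> nm (phi z) <= M.
Proof.
move=> cphi; have [r0|r0] := ltP r 0.
  by exists 0 => z zr; have := nm_ge0 z; lra.
have [|z|z|z zr e e0|m _ Hm] := @max_attained R [set z | nm z <= r] r (fun z => nm (phi z)).
- have h : nm 0 <= r by rewrite nm0.
  by exists 0.
- move=> cz; apply/ler_addgt0Pr => e /cz [w /= wr h].
  by have := nm_sub z w; rewrite nmBC; lra.
- by [].
- have /ctsCP/(_ _ e0) [d d0 dH] := cphi z zr; exists d => // w /dH; apply: le_lt_trans.
  by rewrite ler_norml lerNl opprB nm_sub /= nmBC nm_sub.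
- by exists (nm (phi m)).
Qed.

Definition to_infty (c : R -> C) := forall M : R, exists T : R, forall t, T <= t -> M <= nm (c t).

(** [phi] is bounded on the closed disc of radius [r], so the curve eventually leaves that disc for
    good. *)
Lemma to_circle phi (g : R -> C) (r : R) : (forall z, nm z < 1 -> ctsC phi z) ->
  to_infty (fun t => phi (g t)) -> r < 1 -> exists T : R, forall t, T <= t -> r < nm (g t).
Proof.
move=> cphi inf r1.
have [M HM] : exists M : R, forall z, nm z <= r -> nm (phi z) <= M.
  by apply: bounded_on_disc => z zr; apply: cphi; exact: le_lt_trans r1.
have [T HT] := inf (M + 1); exists T => t /HT h.
by rewrite ltNge; apply/negP => /HM; lra.
Qed.

Definition subpath (g : R -> C) (s s' t : R) := g (s + (s' - s) * clamp t).

Lemma cr_subpath (g : R -> C) (s s' t : R) : (forall t, ctsR g t) -> ctsR (subpath g s s') t.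
Proof.
move=> cg; apply: (@cr_clamp R (fun t => g (s + (s' - s) * t))) => {}t _ e e0.
have /ctsRP/(_ _ e0) [d d0 dH] := cg (s + (s' - s) * t).
have q0 : 0 < `|s' - s| + 1 by rewrite ltr_wpDl.
exists (d / (`|s' - s| + 1)); first by rewrite divr_gt0.
move=> u _; rewrite ltr_pdivlMr// => h; apply: dH.
rewrite (_ : _ - _ = (u - t) * (s' - s)); last by ring.
by rewrite normrM; apply: le_lt_trans h; apply: ler_wpM2l; rewrite ?lerDl.
Qed.
Lemma subpath_clamp (g : R -> C) (s s' t : R) : subpath g s s' (clamp t) = subpath g s s' t.
Proof. by rewrite /subpath (clampE (clamp_itv t)). Qed.
Lemma subpath0 (g : R -> C) (s s' : R) : subpath g s s' 0 = g s.
Proof. by rewrite /subpath clampE ?lexx ?ler01// mulr0 addr0. Qed.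
Lemma subpath1 (g : R -> C) (s s' : R) : subpath g s s' 1 = g s'.
Proof. by rewrite /subpath clampE ?lexx ?ler01// mulr1 addrC subrK. Qed.
Lemma between_clamp (t1 t2 t : R) : t1 <= t2 ->
  t1 <= t1 + (t2 - t1) * clamp t <= t2 /\ t1 <= t2 + (t1 - t2) * clamp t <= t2.
Proof.
move=> t12; have /andP[c0 c1] := @clamp_itv R t; have d0 : 0 <= t2 - t1 by lra.
have u0 := mulr_ge0 d0 c0; have u1 : (t2 - t1) * clamp t <= (t2 - t1) * 1 by rewrite ler_wpM2l.
have -> : (t1 - t2) * clamp t = - ((t2 - t1) * clamp t) by ring.
by split; apply/andP; split; lra.
Qed.

(** Late passages from near [a] to near [b] contain arcs over or under a strip on which [phi] is
    arbitrarily large; [no_large_arc] excludes the former for [phi] and the latter for [phi] turned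
    by [pi]. *)
Lemma no_two_limits phi p (g : R -> C) a b : admissible phi p -> (forall t, ctsR g t) ->
  (forall t, nm (g t) < 1) -> to_infty (fun t => phi (g t)) -> nm a = 1 -> nm b = 1 ->
  Im a = Im b -> Re a < 0 -> 0 < Re b ->
  (forall (e T : R), 0 < e -> exists2 t, T <= t & nm (g t - a) < e) ->
  (forall (e T : R), 0 < e -> exists2 t, T <= t & nm (g t - b) < e) -> False.
Proof.
move=> hg cg g1 ginf a1 b1 Iab ra rb cla clb.
set y := Im a in Iab.
have y1' : `|y| < 1.
  rewrite -ltr_sqr ?nnegrE// expr1n real_normK ?num_real//.
  have := nm_sqr a; rewrite a1 expr1n -/y => ->; rewrite ltrDr.
  by rewrite lt_def sqr_ge0 andbT sqrf_eq0 lt_eqF.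
(* Small enough that [|y| + k < 1 - k]: the strip of half-width [k] around height [y] meets the
   imaginary axis within radius [y1]. *)
pose k := (1 - `|y|) / 4.
have k0 : 0 < k by rewrite /k; lra.
pose yl := y - k; pose yu := y + k; pose y1 := 1 - k.
have y11 : y1 < 1 by rewrite /y1; lra.
have yl1 : `|yl| < y1 by apply: le_lt_trans (ler_normB _ _) _; rewrite (gtr0_norm k0) /y1 /k; lra.
have yu1 : `|yu| < y1 by apply: le_lt_trans (ler_normD _ _) _; rewrite (gtr0_norm k0) /y1 /k; lra.
have ylu : yl < yu by rewrite /yl /yu; lra.
have Nl1 : `|- yl| < y1 by rewrite normrN.
have [h1 h2 h3] := hg; have [Mu HMu] := no_large_arc h1 h2 h3 yu1 y11.
have n1 : nm (-1) = 1 by rewrite nmN nm1.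
have [h1' h2' h3'] := admissible_rot n1 hg; have [Ml HMl] := no_large_arc h1' h2' h3' Nl1 y11.
have [T1 HT1] := ginf (Num.max Mu Ml).
have [T2 HT2] := to_circle (fun z hz => cdiff_cont (h1 z hz)) ginf y11.
pose T := Num.max T1 T2.
have TT1 : T1 <= T by rewrite le_max lexx.
have TT2 : T2 <= T by rewrite le_max lexx orbT.
have ea : 0 < Num.min k (- Re a) by rewrite lt_min k0 oppr_gt0.
have [tA TA gA] := cla _ T ea.
have eb : 0 < Num.min k (Re b) by rewrite lt_min k0.
have [tB AB gB] := clb _ tA eb.
have near z w (e : R) : nm (z - w) < e -> `|Re z - Re w| < e /\ `|Im z - Im w| < e.
  by move=> h; split; rewrite -raddfB; apply: le_lt_trans h; [exact: nm_Re|exact: nm_Im].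
move: gA; rewrite lt_min => /andP[/near [_ A1] /near [A2 _]].
move: gB; rewrite lt_min => /andP[/near [_ B1] /near [B2 _]].
rewrite !ltr_norml -/y -?Iab in A1 A2 B1 B2.
have big t : tA <= t <= tB -> y1 < nm (g t).
  by move=> /andP[h _]; apply: HT2; exact: le_trans TT2 (le_trans TA h).
have bigM t : tA <= t <= tB -> Mu <= nm (phi (g t)) /\ Ml <= nm (phi (g t)).
  move=> /andP[h _]; have := HT1 t; rewrite ge_max => H; apply/andP/H.
  exact: le_trans TT1 (le_trans TA h).
have [||||t1 [t2 [[at1 t12 t2b r1 r2] HC]]] := crossing_path cg ylu yl1 yu1 AB big.
- by move: A1; rewrite /yl /yu; clear=> /andP[? ?]; apply/andP; split; lra.
- by move: B1; rewrite /yl /yu; clear=> /andP[? ?]; apply/andP; split; lra.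
- by move: A2; clear; lra.
- by move: B2; clear; lra.
have inpath t := between_clamp t (ltW t12).
have AB12 t : t1 <= t <= t2 -> tA <= t <= tB.
  by move=> /andP[h h']; rewrite (le_trans at1 h) (le_trans h' t2b).
case: HC => -[i1 i2 Hi].
  apply: (HMu (subpath g t1 t2)).
  - by move=> t; apply: cr_subpath.
  - by move=> t; exact: subpath_clamp.
  - by move=> t; exact: g1.
  - by move=> t; apply: big; apply: AB12; exact: (inpath t).1.
  - by move=> t; apply: Hi; exact: (inpath t).1.
  - by rewrite subpath0.
  - by rewrite subpath1.
  - by rewrite subpath0.
  - by rewrite subpath1.
  - by move=> t; apply: (bigM _ _).1; apply: AB12; exact: (inpath t).1.
have ImN z : Im (- z) = - Im z by case: z.
have ReN z : Re (- z) = - Re z by case: z.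
(* A half-turn puts the lower arc above the strip, and running it backwards restores the order from
   left to right. *)
apply: (HMl (fun t => - subpath g t2 t1 t)).
- by move=> t; have h := @cr_subpath g t2 t1 t cg; cts.
- by move=> t; rewrite subpath_clamp.
- by move=> t; rewrite nmN; exact: g1.
- by move=> t; rewrite nmN; apply: big; apply: AB12; exact: (inpath t).2.
- by move=> t; rewrite ImN lerN2; apply: Hi; exact: (inpath t).2.
- by rewrite subpath0 ImN i2.
- by rewrite subpath1 ImN i1.
- by rewrite subpath0 ReN oppr_lt0.
- by rewrite subpath1 ReN oppr_gt0.
- by move=> t; rewrite mulN1r opprK; apply: (bigM _ _).2; apply: AB12; exact: (inpath t).2.
Qed.

(* A form of Koebe's theorem on sequences of arcs. *)
Lemma landing phi p (g : R -> C) : admissible phi p -> (forall t, ctsR g t) ->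
  (forall t, nm (g t) < 1) -> to_infty (fun t => phi (g t)) ->
  exists2 z, nm z = 1 & forall e : R, 0 < e -> exists T : R, forall t, T <= t -> nm (g t - z) < e.
Proof.
move=> hg cg g1 ginf; have [h1 _ _] := hg.
have circ (r : R) (r1 : r < 1) := to_circle (fun z hz => cdiff_cont (h1 z hz)) ginf r1.
have cluster (u : nat -> R) : (forall n : nat, n%:R <= u n) ->
    exists2 a, nm a = 1 & forall e : R, 0 < e -> forall N, exists2 n, (N <= n)%N & nm (g (u n) - a) < e.
  move=> un; have [a Ha] := @bolzano_weierstrass R (fun n => g (u n)) 1 (fun n => ltW (g1 (u n))).
  exists a => //; apply/eqP; rewrite eq_le; apply/andP; split; apply/ler_addgt0Pr => e e0.
    have [n _ h] := Ha e e0 0%N; have := g1 (u n); have := nm_sub a (g (u n)); rewrite nmBC; lra.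
  have e2 : 0 < e / 2 by rewrite divr_gt0.
  have r1 : 1 - e / 2 < 1 by lra.
  have [T HT] := circ _ r1.
  have [n Nn h] := Ha _ e2 (Num.trunc T).+1.
  have Tn : T <= u n.
    apply: le_trans (un n); apply: le_trans (ltW (truncnS_gt T)) _.
    by rewrite ler_nat.
  by have := HT _ Tn; have := nm_sub (g (u n)) a; lra.
have freq (u : nat -> R) a : (forall n : nat, n%:R <= u n) ->
    (forall e : R, 0 < e -> forall N, exists2 n, (N <= n)%N & nm (g (u n) - a) < e) ->
    forall (e T : R), 0 < e -> exists2 t, T <= t & nm (g t - a) < e.
  move=> un Ha e T e0; have [n Nn h] := Ha e e0 (Num.trunc T).+1; exists (u n) => //.
  apply: le_trans (un n); apply: le_trans (ltW (truncnS_gt T)) _.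
  by rewrite ler_nat.
have [a a1 Ha] := cluster (fun n => n%:R) (fun n => lexx _).
exists a => // e e0; apply: contrapT => nconv.
have far n : exists t, n%:R <= t /\ e <= nm (g t - a).
  apply: contrapT => H; apply: nconv; exists n%:R => t nt.
  by rewrite ltNge; apply/negP => k; apply: H; exists t.
pose u n := sval (cid (far n)); have uP n := svalP (cid (far n)).
have [b b1 Hb] := cluster u (fun n => (uP n).1).
have ab : e <= nm (b - a).
  apply/ler_addgt0Pr => x /Hb /(_ 0%N) [n _ h].
  by have := (uP n).2; rewrite -/(u n); have := nm_tri (g (u n)) b a; lra.
have ab0 : 0 < nm (b - a) by exact: lt_le_trans ab.
(* Rotation making [b - a] a positive real: the images of [a] and [b] then have equal height, and
   being on the circle they are mirror images in the imaginary axis. *)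
pose v : C := (nm (b - a))%:C / (b - a).
have ba0 : b - a != 0 by rewrite -nm_gt0.
have v1 : nm v = 1 by rewrite /v nmM nmV nm_real gtr0_norm// divff// gt_eqF.
have v0 : v != 0 by rewrite -nm_gt0 v1.
have vi1 : nm v^-1 = 1 by rewrite nmV v1 invr1.
have vba : v * b - v * a = (nm (b - a))%:C by rewrite -mulrBr /v divfK.
have va1 : nm (v * a) = 1 by rewrite nmM v1 a1 mul1r.
have vb1 : nm (v * b) = 1 by rewrite nmM v1 b1 mul1r.
have Iab : Im (v * a) = Im (v * b).
  by apply/eqP; rewrite eq_sym -subr_eq0 -raddfB vba.
have Rab : Re (v * b) - Re (v * a) = nm (b - a) by rewrite -raddfB vba.
have R2 : (Re (v * b) - Re (v * a)) * (Re (v * b) + Re (v * a)) = 0.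
  have := nm_sqr (v * a); have := nm_sqr (v * b); rewrite va1 vb1 Iab -subr_sqr; lra.
have RN : Re (v * b) + Re (v * a) = 0.
  by move/eqP: R2; rewrite mulf_eq0 Rab gt_eqF//= => /eqP.
have hv := admissible_rot vi1 hg.
have cvg t : ctsR (fun t => v * g t) t by have h := cg t; cts.
have ra : Re (v * a) < 0 by lra.
have rb : 0 < Re (v * b) by lra.
apply: (@no_two_limits _ p (fun t => v * g t) _ _ hv cvg _ _ va1 vb1 Iab ra rb).
- by move=> t; rewrite nmM v1 mul1r.
- by move=> M; have [T HT] := ginf M; exists T => t; rewrite mulKf//; exact: HT.
- move=> x T x0; have [t Tt h] := freq _ _ (fun n => lexx _) Ha x T x0.
  by exists t => //; rewrite -mulrBr nmM v1 mul1r.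
- move=> x T x0; have [t Tt h] := freq _ _ (fun n => (uP n).1) Hb x T x0.
  by exists t => //; rewrite -mulrBr nmM v1 mul1r.
Qed.
End Landing.

(** * Two accesses to infinity separate boundary points *)

Section Accesses.
Variable R : realType.
Local Notation C := R[i].
Local Notation Co := (R[i]^o).
Local Notation nm := (@ComplexField.Normc.normc R).
Implicit Types (z w : C) (f g : C -> C).

Definition cis (t : R) : C := cos t +i* sin t.
Lemma cisD s t : cis (s + t) = cis s * cis t.
Proof. by rewrite /cis cosD sinD; apply/eqP; rewrite eq_complex /= eqxx addrC eqxx. Qed.
Lemma nmcis t : nm (cis t) = 1. Proof. exact: nm_cis. Qed.
Lemma cis0 : cis 0 = 1. Proof. by rewrite /cis cos0 sin0. Qed.
Lemma cis_neq0 t : cis t != 0. Proof. by rewrite -nm_gt0 nmcis. Qed.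
Lemma cis2pi : cis (2 * pi) = 1.
Proof. by rewrite /cis mulr_natl cos2pi sin2pi. Qed.
Lemma cispi : cis pi = -1.
Proof. by rewrite /cis cospi sinpi; apply/eqP; rewrite eq_complex /= oppr0 !eqxx. Qed.
Lemma cisN t : cis (- t) = (cis t)^-1.
Proof. by apply: (mulIf (cis_neq0 t)); rewrite -cisD addNr cis0 mulVf// cis_neq0. Qed.
Lemma ctsR_cis t : ctsR cis t.
Proof. by apply: ctsR_pair; [exact: continuous_cos|exact: continuous_sin]. Qed.
Lemma cis_neq1 t : 0 < t < 2 * pi -> cis t != 1.
Proof.
move=> /andP[t0 t1]; apply/eqP => E.
have t2 : 0 < sin (t / 2) by apply: sin_gt0_pi; apply/andP; split; lra.
have := congr1 (@complex.Re R) E; rewrite /cis /= => c1.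
have c2 : cos t = cos (t / 2) ^+ 2 *+ 2 - 1 by rewrite -cos_mulr2n mulr2n -splitr.
have s2 : 0 < sin (t / 2) ^+ 2 by rewrite exprn_gt0.
by have := cos2Dsin2 (t / 2); lra.
Qed.

Lemma nm_cisB s t : nm (cis s - cis t) = nm (cis (s - t) - 1).
Proof.
have -> : cis s - cis t = cis t * (cis (s - t) - 1).
  by rewrite mulrBr -cisD mulr1 (addrC t) subrK.
by rewrite nmM nmcis mul1r.
Qed.

Lemma cis_gap (a b t : R) : a <= b -> (forall s, a <= s <= b -> cis s != cis t) ->
  exists2 m : R, 0 < m & forall s, a <= s <= b -> m <= nm (cis s - cis t).
Proof.
move=> ab H.
have [|s sI sm] := @EVT_min R (fun s => nm (cis s - cis t)) a b ab.
  apply/continuous_subspaceT/(@continuous_nm R (fun s => cis s - cis t)) => s.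
  by have h := @ctsR_cis s; cts.
exists (nm (cis s - cis t)); first by rewrite nm_gt0 subr_eq0 H//; move: sI; rewrite in_itv.
by move=> u uI; apply: sm; rewrite in_itv.
Qed.

(** Two roots along the common arc [e] differ by a sign, which is absorbed into the root along
    [c']. *)
Lemma even_index_trans (c c' e : R -> C) z : (forall t, e t != z) ->
  even_index c e z -> even_index c' e z -> even_index c c' z.
Proof.
move=> ez [s1 [s2 [h1 h2 E0 E1]]] [s1' [s2' [h1' h2' E0' E1']]].
have n2 t : s2 t != 0 by rewrite -sqrf_eq0 (h2 t).2 subr_eq0.
have sq t : s2 t ^+ 2 = s2' t ^+ 2 by rewrite (h2 t).2 (h2' t).2.
have [H|H] := sqrt_unique (fun t => (h2 t).1) (fun t => (h2' t).1) sq n2.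
  exists s1, s1'; split; [exact: h1|exact: h1'| |].
    by rewrite E0 E0' H.
  by rewrite E1 E1' H.
exists s1, (fun t => - s1' t); split; [exact: h1| | |].
- by move=> t; have [k1 k2] := h1' t; split; [cts|rewrite sqrrN].
- by rewrite E0 E0' H opprK.
- by rewrite E1 E1' H opprK.
Qed.

Lemma ctsC_near f g z (d : R) : 0 < d -> (forall w, nm (w - z) < d -> f w = g w) -> ctsC g z -> ctsC f z.
Proof.
move=> d0 fg /ctsCP H; apply/ctsCP => e /H [r r0 rH].
exists (Num.min d r); first by rewrite lt_min d0.
by move=> w; rewrite lt_min => /andP[/fg -> /rH]; rewrite fg// subrr nm0.
Qed.

Lemma curve_bounded_away (c : R -> C) p : (forall t, ctsR c t) ->
  (exists T : R, forall t, T <= `|t| -> nm p + 1 <= nm (c t)) -> (forall t, c t != p) -> bounded_away c p.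
Proof.
move=> cc [T HT] cp; pose T' := Num.max T 0.
have T'00 : 0 <= T' by rewrite le_max lexx orbT.
have T'0 : - T' <= T' by lra.
have [|s sI sm] := @EVT_min R (fun s => nm (c s - p)) (- T') T' T'0.
  apply/continuous_subspaceT/(@continuous_nm R (fun s => c s - p)) => s.
  by have h := cc s; cts.
have m0 : 0 < nm (c s - p) by rewrite nm_gt0 subr_eq0.
exists (Num.min 1 (nm (c s - p))); first by rewrite lt_min m0 ltr01.
move=> t; rewrite ge_min; have [h|h] := leP T `|t|.
  by apply/orP; left; have := HT t h; have := nm_sub (c t) p; lra.
apply/orP; right; apply: sm; rewrite in_itv /= -ler_norml.
by apply: le_trans (ltW h) _; rewrite le_max lexx.
Qed.

Definition access phi z := nm z = 1 /\ exists g : R -> C, [/\ forall t, ctsR g t,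
  forall t, nm (g t) < 1, to_infty (fun t => phi (g t)) &
  forall e : R, 0 < e -> exists T : R, forall t, T <= t -> nm (g t - z) < e].

Section TwoAccess.
Variables (phi psi : C -> C) (p : C).
Hypothesis hphi : forall z, nm z < 1 -> cdiff phi z.
Hypothesis hpsi : cdiff psi (phi 0).
Hypothesis psiK : forall z, nm z < 1 -> psi (phi z) = z.
Hypothesis hp : forall z, nm z < 1 -> phi z != p.

Let nm01 : nm 0 < 1. Proof. by rewrite nm0. Qed.
Ltac shed := clear -hphi hpsi psiK hp nm01.

Lemma phi_inj z w : nm z < 1 -> nm w < 1 -> phi z = phi w -> z = w.
Proof. by move=> hz hw E; rewrite -(psiK hz) E psiK. Qed.

(** Away from [0] the quotient is nonzero by injectivity. At [0] it is the derivative: the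
    difference quotients of [phi] and [psi] are inverse to each other, an identity that extends to
    [0] by continuity. *)
Lemma quotient_at0 : exists2 g : C -> C, (forall z, nm z < 1 -> ctsC g z /\ g z != 0) &
  forall z, phi z - phi 0 = g z * z.
Proof.
have [g g0 hg] := hphi nm01; have {}hg z : phi z - phi 0 = g z * z by rewrite hg subr0.
exists g; last exact: hg.
move=> z hz; have [->|z0] := eqVneq z 0; last first.
  split; last first.
    apply: contraNneq z0 => E; apply/eqP/phi_inj => //.
    by apply/eqP; rewrite -subr_eq0 hg E mul0r.
  have zp : 0 < nm z by rewrite nm_gt0.
  apply: (@ctsC_near _ (fun z => (phi z - phi 0) * z^-1) z (nm z) zp).
    move=> w h; rewrite hg mulfK//; apply: contraTneq h => ->.
    by rewrite sub0r nmN ltxx.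
  have h1 := cdiff_cont (hphi hz).
  have h2 : ctsC (fun z => z^-1) z by apply: (@ctV _ (fun z => z)); [exact: z0|exact: ct_id].
  cts.
split; first exact: g0.
have [k kc hk] := hpsi.
have kg v : nm v < 1 -> v != 0 -> k (phi v) * g v = 1.
  move=> hv v0; apply: (mulIf v0); rewrite mul1r -mulrA -hg -hk !psiK// subr0//.
have c1 : ctsC (fun v => k (phi v) * g v) 0.
  have h := ct_comp (cdiff_cont (hphi nm01)) kc; cts.
have E : k (phi 0) * g 0 = 1.
  apply/eqP; rewrite -subr_eq0 -nm_eq0 eq_le nm_ge0 andbT; apply/ler_addgt0Pr => e e0.
  move/ctsCP: c1 => /(_ _ e0) [d d0 dH].
  pose x := Num.min (d / 2) 2^-1.
  have x0 : 0 < x by rewrite lt_min divr_gt0//= invr_gt0.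
  have xd : x < d by rewrite gt_min; apply/orP; left; lra.
  have x1 : x < 1 by rewrite gt_min; apply/orP; right; lra.
  have nx : nm x%:C = x by rewrite nm_real gtr0_norm.
  have xn : x%:C != 0 :> C by rewrite -nm_gt0 nx.
  have := dH x%:C; rewrite subr0 nx kg ?nx// => /(_ xd); rewrite nmBC add0r; exact: ltW.
by apply: contra_eq_neq E => ->; rewrite mulr0 eq_sym oner_eq0.
Qed.

(* The image of a circle around [0] has winding number 1 around [phi 0]. *)
Lemma circle_not_even (w : C) (b : R) : 0 < nm w -> nm w < 1 ->
  ~ even_index (fun t => phi (w * cis (b * clamp t))) (fun t => phi (w * cis ((b - 2 * pi) * clamp t))) (phi 0).
Proof.
move=> w0 w1 [s1 [s2 [h1 h2 E0 E1]]].
have [g gH hg] := quotient_at0.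
have [s sH] : exists s : C -> C, forall z, nm z <= nm w -> ctsC s z /\ s z ^+ 2 = g z.
  by apply: disc_sqrt => // z hz; have [k1 k2] := gH z (le_lt_trans hz w1).
pose v (x t : R) := w * cis (x * clamp t).
have nv x t : nm (v x t) = nm w by rewrite /v nmM nmcis mulr1.
have wn : w != 0 by rewrite -nm_gt0.
pose k0 := sqrtc w.
have k02 : k0 ^+ 2 = w by rewrite sqr_sqrtc.
have k0n : k0 != 0 by rewrite -sqrf_eq0 k02.
have cc (x t : R) : ctsR (fun t => cis (x * clamp t)) t.
  apply: (@cr_clamp R (fun t => cis (x * t))) => {}t _ e e0.
  have /ctsRP/(_ _ e0) [d d0 dH] := @ctsR_cis (x * t).
  have q0 : 0 < `|x| + 1 by rewrite ltr_wpDl.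
  exists (d / (`|x| + 1)); first by rewrite divr_gt0.
  move=> u _; rewrite ltr_pdivlMr// => h; apply: dH.
  rewrite -mulrBr normrM mulrC; apply: le_lt_trans h; apply: ler_wpM2l; rewrite ?lerDl//.
have key (x : R) (q : R -> C) : (forall t, ctsR q t /\ q t ^+ 2 = phi (v x t) - phi 0) ->
    exists2 y : C, y != 0 & forall t, q t = y * cis (x / 2 * clamp t) * s (v x t).
  move=> hq.
  have sn t : s (v x t) != 0.
    rewrite -sqrf_eq0 (sH _ _).2 ?nv//; apply: (gH _ _).2; by rewrite nv.
  (* A root of [phi (v x t) - phi 0 = g (v x t) * v x t]; taking the root of [v x t] halves the
     angle. *)
  pose q' t := k0 * cis (x / 2 * clamp t) * s (v x t).
  have cq' t : ctsR q' t.
    have h := cc (x / 2) t; have h' := cc x t.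
    have hv : ctsR (v x) t by rewrite /v; cts.
    have hv' : nm (v x t) <= nm w by rewrite nv.
    have hs := cr_comp hv (sH _ hv').1; rewrite /q'; cts.
  have q'2 t : q' t ^+ 2 = q t ^+ 2.
    rewrite (hq t).2 hg /q' !exprMn k02 expr2 -cisD -mulrDl -splitr (sH _ _).2 ?nv//.
    by rewrite /v mulrC.
  have q'n t : q' t != 0 by rewrite /q' !mulf_neq0// cis_neq0.
  have [H|H] := sqrt_unique cq' (fun t => (hq t).1) q'2 q'n.
    by exists k0 => // t; rewrite H.
  by exists (- k0); [rewrite oppr_eq0|move=> t; rewrite H /q' !mulNr].
have [x1 x1n X1] := key b s1 h1.
have [x2 x2n X2] := key (b - 2 * pi) s2 h2.
have cl0 : clamp 0 = 0 :> R by rewrite clampE ?lexx ?ler01.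
have cl1 : clamp 1 = 1 :> R by rewrite clampE ?lexx ?ler01.
have v0 x : v x 0 = w by rewrite /v cl0 mulr0 cis0 mulr1.
have v1 : v (b - 2 * pi) 1 = v b 1.
  by rewrite /v cl1 !mulr1 cisD cisN cis2pi invr1 mulr1.
have sn z : nm z = nm w -> s z != 0.
  move=> hz; have zw : nm z <= nm w by rewrite hz.
  by rewrite -sqrf_eq0 (sH _ zw).2; apply: (gH _ _).2; rewrite hz.
have X12 : x1 = x2.
  apply: (mulIf (sn w erefl)); have := E0; rewrite X1 X2 !v0 cl0 !mulr0 cis0 !mulr1.
  by [].
have := E1; rewrite X1 X2 X12 v1 cl1 !mulr1 => /(mulIf (sn _ (nv _ _))) /(mulfI x2n).
(* The two arcs differ by a full turn; half of it contributes [cis pi = -1], so the roots cannot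
   match at the far end. *)
have -> : (b - 2 * pi) / 2 = b / 2 + - pi by field.
rewrite cisD cisN cispi invrN1 mulrN1 => /eqP; rewrite -subr_eq0 opprK -mulr2n mulrn_eq0 /=.
by rewrite (negbTE (cis_neq0 _)).
Qed.

(** The arc through the angles from [0] to [b] avoids the access at [a2], and the complementary arc
    the access at [a1]. Each tail is joined to [phi 0] by adding the image of a disc inside the
    circle through [w]. *)
Lemma two_access (xi : C) (b a1 a2 : R) : nm xi = 1 -> 0 < a1 < b -> b < a2 < 2 * pi ->
  access phi (xi * cis a1) -> access phi (xi * cis a2) ->
  (forall e : R, 0 < e -> exists w, [/\ nm w < 1, nm (w - xi) < e, nm (phi w - p) < e &
     nm (phi (w * cis b) - p) < e]) -> False.
Proof.
move=> xi1 /andP[a10 a1b] /andP[ba2 a22] [_ [g1 [cg1 g11 ginf1 glim1]]] [_ [g2 [cg2 g21 ginf2 glim2]]] Hseq.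
have b0 : 0 < b by lra.
have b2pi : b < 2 * pi by lra.
have [m1 m10 H1] : exists2 m : R, 0 < m & forall s, b <= s <= 2 * pi -> m <= nm (cis s - cis a1).
  apply: cis_gap; first exact: ltW.
  move=> s /andP[k1 k2]; rewrite -subr_eq0 -nm_gt0 nm_cisB nm_gt0 subr_eq0.
  by apply: cis_neq1; apply/andP; split; lra.
have [m2 m20 H2] : exists2 m : R, 0 < m & forall s, 0 <= s <= b -> m <= nm (cis s - cis a2).
  apply: cis_gap; first exact: ltW.
  move=> s /andP[k1 k2]; rewrite -subr_eq0 -nm_gt0 nmBC nm_cisB nm_gt0 subr_eq0.
  by apply: cis_neq1; apply/andP; split; lra.
have hm1 : 0 < m1 / 2 by rewrite divr_gt0.
have hm2 : 0 < m2 / 2 by rewrite divr_gt0.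
have [T1 HT1] := glim1 _ hm1; have [T2 HT2] := glim2 _ hm2.
(* A disc containing the starting points of both tails; [w] is later taken outside radius [r0]. *)
pose r := Num.max (nm (g1 T1)) (nm (g2 T2)).
have r1 : r < 1 by rewrite gt_max g11 g21.
pose r0 := (1 + r) / 2.
have r01 : r0 < 1 by rewrite /r0; lra.
have rr0 : r < r0 by rewrite /r0; lra.
have gr1 : nm (g1 T1) < r0 by apply: le_lt_trans rr0; rewrite le_max lexx.
have gr2 : nm (g2 T2) < r0 by apply: le_lt_trans rr0; rewrite le_max lexx orbT.
have r00 : 0 < r0 by apply: le_lt_trans gr1; exact: nm_ge0.
pose D0 : set C := phi @` [set v | nm (v - 0) < r0].
have D01 v : nm (v - 0) < r0 -> nm v < 1 by rewrite subr0 => h; exact: lt_trans r01.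
have cD0 : preconnected D0.
  by apply: preconnected_image; [exact: preconnected_ball|move=> z /D01 h; exact: (cdiff_cont (hphi h))].
have h00 : nm (0 - 0) < r0 by rewrite subrr nm0.
have phi00 : D0 (phi 0) by exists 0.
have [e0 e00 He0] : exists2 e : R, 0 < e & forall z, D0 z -> e <= nm (z - p).
  have cphi z : nm z <= r0 -> ctsC (fun z => (phi z - p)^-1) z.
    move=> hz; have h1 : nm z < 1 by exact: le_lt_trans r01.
    have h := cdiff_cont (hphi h1).
    apply: (@ctV _ (fun z => phi z - p)); first by rewrite subr_eq0 hp.
    cts.
  have [M HM] := bounded_on_disc cphi.
  have M0 : 0 < M.
    have hz0 : nm 0 <= r0 by rewrite nm0 ltW.
    apply: lt_le_trans (HM 0 hz0).
    by rewrite nm_gt0 invr_eq0 subr_eq0 hp.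
  exists M^-1; first by rewrite invr_gt0.
  move=> _ [v /= hv <-]; rewrite -[leRHS]invrK lef_pV2 ?posrE ?invr_gt0 ?nm_gt0 ?subr_eq0 ?hp ?D01//.
  by rewrite -nmV; apply: HM; apply: ltW; rewrite -[v]subr0.
(* The parameter [T + |t|] lets the whole line parametrize the tail. *)
have tail (g : R -> C) (T : R) : (forall t, ctsR g t) -> (forall t, nm (g t) < 1) ->
    to_infty (fun t => phi (g t)) -> nm (g T) < r0 ->
    let Y := D0 `|` [set phi (g (T + `|t|)) | t in [set: R]] in
    [/\ preconnected Y, bounded_away (fun t => phi (g (T + `|t|))) p & forall M : R, exists2 w, Y w & M <= nm w].
  move=> cg glt1 ginf gr Y.
  have cT t : ctsR (fun t => phi (g (T + `|t|))) t.
    have h : ctsR (fun t => g (T + `|t|)) t.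
      apply: (@cr_compR R g (fun t => T + `|t|)); last exact: cg.
      move=> s; rewrite (_ : _ - _ = `|s| - `|t|); last by ring.
      exact: ler_dist_dist.
    exact: (cr_comp h (cdiff_cont (hphi (glt1 _)))).
  split.
  - have hT : nm (g T - 0) < r0 by rewrite subr0.
    apply: (@preconnectedU _ _ _ (phi (g T))); first by exists (g T).
    + by exists 0 => //; rewrite normr0 addr0.
    + exact: cD0.
    + exact: (@preconnected_range R (fun t => phi (g (T + `|t|))) cT).
  - apply: curve_bounded_away; [exact: cT| |by move=> t; exact: hp].
    have [T' HT'] := ginf (nm p + 1); exists (T' - T) => t h; apply: HT'; lra.
  - move=> M; have [T' HT'] := ginf M; exists (phi (g (T + `|T' - T|))).
      by right; exists (T' - T).
    by apply: HT'; have := ler_norm (T' - T); lra.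
have [cY1 [e1 e10 He1] uY1] := tail g1 T1 cg1 g11 ginf1 gr1.
have [cY2 [e2 e20 He2] uY2] := tail g2 T2 cg2 g21 ginf2 gr2.
set Y1 := D0 `|` _ in cY1 uY1; set Y2 := D0 `|` _ in cY2 uY2.
(* A common distance of both connected sets from [p]; the closing segment stays closer to [p] than
   this. *)
have [ep [ep0 epe0 epe1 epe2]] : exists ep : R, [/\ 0 < ep, ep <= e0, ep <= e1 & ep <= e2].
  by exists (Num.min e0 (Num.min e1 e2)); rewrite !lt_min e00 e10 e20 !ge_min !lexx !orbT.
have Yp1 z : Y1 z -> ep <= nm (z - p).
  move=> [h|[t _ <-]]; first exact: le_trans epe0 (He0 _ h).
  exact: le_trans epe1 (He1 t).
have Yp2 z : Y2 z -> ep <= nm (z - p).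
  move=> [h|[t _ <-]]; first exact: le_trans epe0 (He0 _ h).
  exact: le_trans epe2 (He2 t).
have ee : 0 < Num.min ep (Num.min (1 - r0) (Num.min (m1 / 2) (m2 / 2))).
  by rewrite !lt_min ep0 hm1 hm2 subr_gt0 r01.
have [w [w1]] := Hseq _ ee; rewrite !lt_min => /and4P[_ wr wm1 wm2] /andP[pw _] /andP[pw' _].
have wr0 : r0 < nm w by have := nm_sub xi w; rewrite xi1 nmBC; move: wr; shed; lra.
have w0 : 0 < nm w by exact: lt_trans r00 wr0.
pose c1 t := phi (w * cis (b * clamp t)).
pose c2 t := phi (w * cis ((b - 2 * pi) * clamp t)).
pose S := seg (phi w) (phi (w * cis b)).
have ncis t : nm (w * cis t) = nm w by rewrite nmM nmcis mulr1.
have hcis t : nm (w * cis t) < 1 by rewrite ncis.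
have cc (x t : R) : ctsR (fun t => phi (w * cis (x * clamp t))) t.
  have h : ctsR (fun t => cis (x * clamp t)) t.
    apply: (@cr_clamp R (fun t => cis (x * t))) => {}t _ e e0'.
    have /ctsRP/(_ _ e0') [d d0 dH] := @ctsR_cis (x * t).
    have q0 : 0 < `|x| + 1 by rewrite ltr_wpDl.
    exists (d / (`|x| + 1)); first by rewrite divr_gt0.
    move=> u _; rewrite ltr_pdivlMr// => h; apply: dH.
    rewrite -mulrBr normrM mulrC; apply: le_lt_trans h; apply: ler_wpM2l; rewrite ?lerDl//.
  have h' : ctsR (fun t => w * cis (x * clamp t)) t by cts.
  exact: (cr_comp h' (cdiff_cont (hphi (hcis _)))).
have cS t : ctsR S t by exact: cr_seg.
have cl0 : clamp 0 = 0 :> R by rewrite clampE ?lexx ?ler01.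
have cl1 : clamp 1 = 1 :> R by rewrite clampE ?lexx ?ler01.
have clK t : clamp (clamp t) = clamp t :> R by rewrite (clampE (clamp_itv t)).
have c10 : c1 0 = S 0 by rewrite /c1 /S seg0 cl0 mulr0 cis0 mulr1.
have c11 : c1 1 = S 1 by rewrite /c1 /S seg1 cl1 mulr1.
have c20 : c2 0 = S 0 by rewrite /c2 /S seg0 cl0 mulr0 cis0 mulr1.
have c21 : c2 1 = S 1 by rewrite /c2 /S seg1 cl1 mulr1 cisD cisN cis2pi invr1 mulr1.
have c1K t : c1 (clamp t) = c1 t by rewrite /c1 clK.
have c2K t : c2 (clamp t) = c2 t by rewrite /c2 clK.
have SK t : S (clamp t) = S t by rewrite /S /seg clK.
have Sp t : nm (S t - p) < ep by exact: seg_ball.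
have offS z : ep <= nm (z - p) -> bounded_away S z.
  move=> hz; apply: (bounded_away_clamp cS SK) => t _; apply: contraTneq (Sp t) => ->.
  by rewrite -leNgt.
have wcis s t : nm (w * cis s - xi * cis t) >= nm (cis s - cis t) - nm (w - xi).
  have -> : w * cis s - xi * cis t = xi * (cis s - cis t) - (xi - w) * cis s by ring.
  have := nm_sub (xi * (cis s - cis t)) ((xi - w) * cis s).
  by rewrite !nmM nmcis xi1 mul1r mulr1 (nmBC xi).
have offY (x a m T : R) (g : R -> C) : 
   (forall t, nm (g t) < 1) -> (forall t, T <= t -> nm (g t - xi * cis a) < m / 2) -> nm (w - xi) < m / 2 ->
   (forall t, m <= nm (cis (x * clamp t) - cis a)) ->
   forall z, (D0 `|` [set phi (g (T + `|t|)) | t in [set: R]]) z -> bounded_away (fun t => phi (w * cis (x * clamp t))) z.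
  move=> glt1 glim wm gap z Yz; apply: (bounded_away_clamp (cc x)).
    by move=> t; rewrite clK.
  move=> t _; apply/eqP => E.
  case: Yz => [[v /= hv Ev]|[u _ Ev]].
    have := phi_inj (D01 _ hv) (hcis (x * clamp t)); rewrite Ev E => /(_ erefl) Evw.
    by move: hv; rewrite subr0 Evw ncis ltNge (ltW wr0).
  have := phi_inj (glt1 (T + `|u|)) (hcis (x * clamp t)); rewrite Ev E => /(_ erefl) Egw.
  have := glim (T + `|u|); rewrite lerDl normr_ge0 Egw => /(_ erefl).
  by have := wcis (x * clamp t) a; have := gap t; move: wm; shed; lra.
have off1 z : Y2 z -> bounded_away c1 z.
  apply: (offY b a2 m2 T2 g2 g21 HT2 wm2) => t; apply: H2.
  have /andP[k1 k2] := @clamp_itv R t; rewrite mulr_ge0 ?(ltW b0)//=.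
  by rewrite -[leRHS]mulr1; apply: ler_wpM2l => //; exact: ltW.
have off2 z : Y1 z -> bounded_away c2 z.
  apply: (offY (b - 2 * pi) a1 m1 T1 g1 g11 HT1 wm1) => t.
  (* A full turn shifts the negative angles into the interval from [b] to [2 * pi], where the gap
     [m1] is known. *)
  rewrite -[cis (_ * _)]mulr1 -cis2pi -cisD; apply: H1.
  have /andP[k1 k2] := @clamp_itv R t.
  have k3 : (2 * pi - b) * clamp t <= (2 * pi - b) * 1 by apply: ler_wpM2l => //; rewrite subr_ge0 ltW.
  have k4 : 0 <= (2 * pi - b) * clamp t by apply: mulr_ge0 => //; rewrite subr_ge0 ltW.
  have -> : (b - 2 * pi) * clamp t = - ((2 * pi - b) * clamp t) by ring.
  by apply/andP; move: k3 k4; shed; split; lra.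
have Y10 : Y1 (phi 0) by left.
have Y20 : Y2 (phi 0) by left.
have ev1 : even_index c1 S (phi 0).
  apply: (even_index_unbounded (cc b) cS c10 c11 cY2 _ c1K SK uY2 Y20).
  by move=> z Yz; split; [exact: off1|apply: offS; exact: Yp2].
have ev2 : even_index c2 S (phi 0).
  apply: (even_index_unbounded (cc _) cS c20 c21 cY1 _ c2K SK uY1 Y10).
  by move=> z Yz; split; [exact: off2|apply: offS; exact: Yp1].
apply: (circle_not_even w0 w1 (even_index_trans _ ev1 ev2)) => t.
by have := bounded_away_neq t (offS _ (Yp1 _ Y10)); rewrite subr_eq0.
Qed.
End TwoAccess.
End Accesses.

(** * Density of irrational rotations *)

Section Rotation.
Variable R : realType.
Local Notation C := R[i].
Local Notation Co := (R[i]^o).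
Local Notation nm := (@ComplexField.Normc.normc R).
Implicit Types (z w : C) (f g : C -> C).

Local Notation Re := (@complex.Re R).
Local Notation Im := (@complex.Im R).

(** Pigeonhole: among [N + 1] fractional parts two share an interval of length [1 / N]. *)
Lemma dirichlet (theta e : R) : 0 < e -> exists (k : nat) (l : int), (0 < k)%N /\ `|k%:R * theta - l%:~R| < e.
Proof.
move=> e0; pose N := (Num.trunc e^-1).+1.
have N0 : 0 < N%:R :> R by rewrite ltr0n.
have Ne : N%:R^-1 < e.
  by rewrite invf_plt ?posrE//; exact: truncnS_gt.
pose fr (k : nat) : R := k%:R * theta - (Num.floor (k%:R * theta))%:~R.
have fr01 k : 0 <= fr k < 1.
  have /andP[h1 h2] := floor_itv (k%:R * theta).
  by rewrite /fr subr_ge0 h1 /= ltrBlDl; move: h2; rewrite rmorphD /=; lra.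
have bin_lt k : (Num.trunc (N%:R * fr k) < N)%N.
  have /andP[f0 f1] := fr01 k.
  have h0 : 0 <= N%:R * fr k by rewrite mulr_ge0// ltW.
  rewrite truncn_lt_nat//; by rewrite -[ltRHS]mulr1 ltr_pM2l.
have [bin binE] : exists bin : 'I_N.+1 -> 'I_N, forall k, bin k = Num.trunc (N%:R * fr k) :> nat.
  by exists (fun k => Ordinal (bin_lt k)).
have [i [j [ij Eij]]] : exists i j : 'I_N.+1, (i < j)%N /\ bin i = bin j.
  apply: contrapT => H.
  have inj : injective bin.
    move=> i j E; apply: ord_inj; apply/eqP; rewrite eqn_leq.
    apply/andP; split; rewrite leqNgt; apply/negP => h; apply: H; [exists j, i|exists i, j].
      by split; [exact: h|rewrite E].
    by split; [exact: h|rewrite E].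
  by have := leq_card bin inj; rewrite !card_ord ltnn.
exists (j - i)%N, (Num.floor (j%:R * theta) - Num.floor (i%:R * theta)); split; first by rewrite subn_gt0.
have -> : (j - i)%:R * theta - (Num.floor (j%:R * theta) - Num.floor (i%:R * theta))%:~R = fr j - fr i.
  by rewrite natrB ?(ltnW ij)// rmorphB /= /fr; ring.
apply: lt_trans Ne.
have ET : Num.trunc (N%:R * fr i) = Num.trunc (N%:R * fr j) by rewrite -!binE Eij.
have /andP[fi0 _] := fr01 i; have /andP[fj0 _] := fr01 j.
have hi : 0 <= N%:R * fr i by rewrite mulr_ge0// ltW.
have hj : 0 <= N%:R * fr j by rewrite mulr_ge0// ltW.
have /andP[a1 a2] := truncn_itv hi; have /andP[b1 b2] := truncn_itv hj.
rewrite -ET in b1; rewrite -ET -natr1 in b2; rewrite -natr1 in a2.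
have -> : `|fr j - fr i| = N%:R^-1 * `|N%:R * fr j - N%:R * fr i|.
  rewrite -mulrBr normrM (gtr0_norm N0) mulrA mulVf ?mul1r// gt_eqF//.
rewrite -[ltRHS]mulr1 ltr_pM2l ?invr_gt0// ltr_norml; apply/andP; split; lra.
Qed.

Lemma irrational_mul (theta : R) (k : nat) (l : int) : irrational theta -> (0 < k)%N ->
  k%:R * theta - l%:~R != 0.
Proof.
move=> irr k0; apply/eqP => /subr0_eq E; apply: irr; apply/rationalP.
exists l, k; by rewrite -E mulrAC divff ?mul1r// pnatr_eq0 -lt0n.
Qed.

(** Steps of size less than [d - c] cannot jump over the interval. As accesses are only moved
    backwards, [k] is a natural number, and a step of either sign starts from a translate [x + L] on
    the appropriate side. *)
Lemma rotation_dense (theta x c d : R) : irrational theta -> c < d ->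
  exists (k : nat) (l : int), c < x - k%:R * theta + l%:~R < d.
Proof.
move=> irr cd; have dc : 0 < d - c by rewrite subr_gt0.
have [k0 [l0 [k00 s1]]] := dirichlet theta dc.
have s0 := irrational_mul l0 irr k00.
set s := k0%:R * theta - l0%:~R in s0 s1.
have E (m : nat) (L : int) : x - (m * k0)%:R * theta + (m%:Z * l0 + L)%:~R = x + L%:~R - m%:R * s.
  by rewrite /s natrM rmorphD rmorphM /=; ring.
case: (ltrgt0P s) s0 s1 => // sp _ s1.
  pose L := Num.floor (d - x) + 1.
  have hL : d < x + L%:~R by have := floorD1_gt (d - x); rewrite -/L; lra.
  pose m := (Num.trunc ((x + L%:~R - d) / s)).+1.
  exists (m * k0)%N, (m%:Z * l0 + L); rewrite E.
  have q0 : 0 <= (x + L%:~R - d) / s by rewrite divr_ge0//; lra.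
  have /andP[m1 m2] := truncn_itv q0; rewrite -/m in m2.
  have m3 : (x + L%:~R - d) < m%:R * s by rewrite -ltr_pdivrMr.
  have m4 : m%:R * s <= (x + L%:~R - d) + s.
    rewrite /m -natr1 mulrDl mul1r lerD2r -ler_pdivlMr//.
  apply/andP; split; lra.
pose L := - (Num.floor (x - c) + 1).
have hL : x + L%:~R < c by have := floorD1_gt (x - c); rewrite /L rmorphN /=; lra.
have s0' : 0 < - s by rewrite oppr_gt0.
pose m := (Num.trunc ((c - (x + L%:~R)) / - s)).+1.
exists (m * k0)%N, (m%:Z * l0 + L); rewrite E.
have q0 : 0 <= (c - (x + L%:~R)) / - s by rewrite divr_ge0//; lra.
have /andP[m1 m2] := truncn_itv q0; rewrite -/m in m2.
have m3 : (c - (x + L%:~R)) < m%:R * - s by rewrite -ltr_pdivrMr.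
have m4 : m%:R * - s <= (c - (x + L%:~R)) + - s.
  by rewrite /m -natr1 mulrDl mul1r lerD2r -ler_pdivlMr.
rewrite mulrN in m3 m4; apply/andP; split; lra.
Qed.

Lemma cis_int (l : int) : cis (2 * pi * l%:~R) = 1 :> C.
Proof.
have nat_case n : cis (2 * pi * n%:R) = 1 :> C.
  elim: n => [|n IH]; first by rewrite mulr0 cis0.
  by rewrite -[n.+1%:R]natr1 mulrDr mulr1 cisD IH cis2pi mulr1.
case: l => n; first exact: nat_case.
by rewrite NegzE rmorphN mulrN cisN (nat_case n.+1) invr1.
Qed.

Lemma cis_natmul (t : R) n : cis (t * n%:R) = cis t ^+ n :> C.
Proof. by elim: n => [|n IH]; [rewrite mulr0 cis0|rewrite -[n.+1%:R]natr1 mulrDr mulr1 cisD IH exprSr]. Qed.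

Lemma cis_surj z : nm z = 1 -> exists t : R, z = cis t.
Proof.
move=> z1; have := nm_sqr z; rewrite z1 expr1n; case: z z1 => a b z1 /= ab.
have a1 : -1 <= a <= 1.
  rewrite -ler_norml -ler_sqr ?nnegrE// expr1n real_normK ?num_real// ab lerDl; exact: sqr_ge0.
have sE : sin (acos a) = `|b|.
  by rewrite sin_acos// ab addrAC subrr add0r sqrtr_sqr.
have cE : cos (acos a) = a by rewrite acosK// in_itv.
have [b0|b0] := leP 0 b.
  by exists (acos a); rewrite /cis cE sE ger0_norm.
by exists (- acos a); rewrite /cis cosN sinN cE sE ltr0_norm// opprK.
Qed.
End Rotation.

(** * Siegel discs *)

Section Bridges.
Variable R : realType.
Local Notation C := R[i].
Local Notation Co := (R[i]^o).
Local Notation nm := (@ComplexField.Normc.normc R).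
Implicit Types (z w : C) (f g : C -> C).

Local Notation Re := (@complex.Re R).
Local Notation Im := (@complex.Im R).

Lemma unit_diskE z : @unit_disk R z = (nm z < 1) :> Prop.
Proof. by rewrite /unit_disk /= -[1 : R[i]]/((1 : R)%:C) nmE ltcR. Qed.

Lemma open_openC (A : set Co) : open A -> openC A.
Proof. by rewrite openE => oA z Az; apply/nbhs_cP; exact: oA. Qed.
Lemma Fatou_open (f : Co -> Co) : openC (Fatou f).
Proof.
move=> z [V [oV Vz nV]]; have [d d0 dH] := open_openC oV Vz.
by exists d => // w /dH Vw; exists V.
Qed.

Lemma component_openC (A : set Co) z : openC A -> openC (connected_component A z).
Proof.
move=> oA w cw; have Aw : A w := connected_component_sub cw.
have [d d0 dH] := oA w Aw; exists d => // v vd.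
have -> : connected_component A z = connected_component A w by exact: same_connected_component.
pose I := [set (seg w v t : Co) | t in [set: R]].
have cI : connected I.
  apply: connected_continuous_connected; first by apply/connected_intervalP.
  apply: continuous_subspaceT => t; apply/cont_rP; apply/ctsRP; exact: cr_seg.
apply: (@connected_component_max _ A I w); [by exists 0 => //; rewrite seg0| |exact: cI|by exists 1 => //; rewrite seg1].
by move=> _ [t _ <-]; apply: dH; apply: seg_ball; rewrite ?subrr ?nm0.
Qed.

Lemma boundary_openC (U : set Co) p : openC U -> boundary U p -> adherentC U p /\ ~ U p.
Proof.
move=> oU [cU nU]; split; last by move=> Up; apply: nU; apply/nbhs_cP; exact: oU.
move=> e e0; have [|w [Uw hw]] := cU [set w | nm (w - p) < e]; first by apply/nbhs_cP; exists e.
by exists w.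
Qed.

Lemma access_of_curve (gamma : R -> Co) (U : set Co) (phi psi : C -> C) :
  {within `[0, 1[, continuous gamma} -> (forall t, t \in `[0, 1[ -> U (gamma t)) ->
  nm (gamma t) @[t --> 1^'-] --> +oo ->
  (forall z, U z -> ctsC psi z /\ nm (psi z) < 1 /\ phi (psi z) = z) ->
  exists g : R -> C, [/\ forall t, ctsR g t, forall t, nm (g t) < 1 & to_infty (fun t => phi (g t))].
Proof.
move=> cg gU ginf hpsi.
(* A 1-Lipschitz map of the line onto [[0, 1[] tending to [1] at infinity; it turns the given curve
   into a total one. *)
pose h (t : R) := `|t| / (1 + `|t|).
have q0 (t : R) : 0 < 1 + `|t| by rewrite ltr_wpDr.
have h01 t : h t \in `[0, 1[.
  by rewrite in_itv /= divr_ge0 ?(ltW (q0 t))//= /h ltr_pdivrMr// mul1r ltrDr.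
have hl s t : `|h s - h t| <= `|s - t|.
  have -> : h s - h t = (`|s| - `|t|) / ((1 + `|s|) * (1 + `|t|)).
    by rewrite /h; field; rewrite !gt_eqF.
  have q : 1 <= (1 + `|s|) * (1 + `|t|).
    have : 0 <= `|s| * `|t| by rewrite mulr_ge0.
    by have := normr_ge0 s; have := normr_ge0 t; lra.
  have q1 : 0 < (1 + `|s|) * (1 + `|t|) by rewrite mulr_gt0.
  rewrite normrM normfV (gtr0_norm q1); apply: le_trans (ler_dist_dist s t).
  by rewrite ler_pdivrMr// ler_peMr.
have cgh t : ctsR (fun t => gamma (h t)) t.
  apply/ctsRP => e e0; move/subspace_continuousP: cg => /(_ (h t)) /=.
  have hI : `[0, 1[%classic (h t) by exact: h01.
  move=> /(_ hI) H; have : nbhs (gamma (h t)) [set w : Co | nm (w - gamma (h t)) < e] by apply/nbhs_cP; exists e.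
  move=> /H /nbhs_ballP [d /= d0 dH]; exists d => // s st.
  apply: (dH (h s)); last exact: h01.
  by rewrite /ball /= distrC; apply: le_lt_trans (hl s t) st.
exists (fun t => psi (gamma (h t))); split.
- by move=> t; exact: (cr_comp (cgh t) (hpsi _ (gU _ (h01 t))).1).
- by move=> t; exact: (hpsi _ (gU _ (h01 t))).2.1.
move=> M; move/cvgryPge: ginf => /(_ M) /nbhs_ballP [d /= d0 dH].
exists d^-1 => t dt; rewrite (hpsi _ (gU _ (h01 t))).2.2.
apply: dH; last by have := h01 t; rewrite in_itv /= => /andP[].
have -> : ball (1 : R) d (h t) = (`|1 - h t| < d) :> Prop by [].
have -> : 1 - h t = (1 + `|t|)^-1 by rewrite /h; field; rewrite gt_eqF.
have t0 : 0 < `|t| by apply: lt_le_trans (le_trans dt (ler_norm t)); rewrite invr_gt0.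
rewrite gtr0_norm ?invr_gt0// -[ltRHS]invrK ltf_pV2 ?posrE ?invr_gt0//.
by have := ler_norm t; lra.
Qed.

(** Backwards only: a large value of [f] requires a large argument, whereas [f] may be small at
    large arguments. *)
Lemma access_back (f phi : C -> C) u z : nm u = 1 -> (forall z, ctsC f z) ->
  (forall z, nm z < 1 -> f (phi z) = phi (u * z)) ->
  access phi z -> access phi (u^-1 * z).
Proof.
move=> u1 cf fphi [z1 [g [cg g1 ginf glim]]].
have u0 : u != 0 by rewrite -nm_gt0 u1.
have ui1 : nm u^-1 = 1 by rewrite nmV u1 invr1.
split; first by rewrite nmM ui1 mul1r.
exists (fun t => u^-1 * g t); split.
- by move=> t; have h := cg t; cts.
- by move=> t; rewrite nmM ui1 mul1r.
- move=> M; have [B HB] := @bounded_on_disc R f M (fun z _ => cf z).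
  have [T HT] := ginf (B + 1); exists T => t /HT h.
  rewrite leNgt; apply/negP => hM; have := HB _ (ltW hM).
  by rewrite fphi ?nmM ?ui1 ?mul1r// mulVKf//; lra.
- move=> e /glim [T HT]; exists T => t /HT h.
  by rewrite -mulrBr nmM ui1 mul1r.
Qed.
End Bridges.

Unset Implicit Arguments.

Local Notation nm := (@ComplexField.Normc.normc _).

Theorem corollaryB (R : realType) (f : R[i]^o -> R[i]^o) (U : set R[i]^o)
    (hf : transcendental_entire f) (hU : Siegel_disk f U)
    (hinf : infinity_accessible U) :
  forall z : R[i]^o, boundary U z -> ~ periodic_point f z.
Proof.
move=> p Bp [n n0 fnp].
have cf z : ctsC f z by apply: cdiff_cont; apply: derivable_cdiff; exact: hf.1.
case: hU => -[zU _ EU] _ [theta [irr [phi [[finj sinj surj] dphi [psi dpsi psiK]] fconj]]].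
have oU : openC U by rewrite EU; apply: component_openC; exact: Fatou_open.
have [clp Up] := boundary_openC oU Bp.
have hphi z : nm z < 1 -> cdiff phi z.
  by move=> hz; apply: derivable_cdiff; apply: dphi; rewrite unit_diskE.
have phiU z : nm z < 1 -> U (phi z) by move=> hz; apply: finj; rewrite unit_diskE.
have psiK' z : nm z < 1 -> psi (phi z) = z by move=> hz; apply: psiK; rewrite unit_diskE.
have hpsi y : U y -> cdiff psi y by move=> Uy; apply: derivable_cdiff; exact: dpsi.
have Upsi y : U y -> [/\ ctsC psi y, nm (psi y) < 1 & phi (psi y) = y].
  move=> Uy; have [z hz <-] := surj _ Uy; rewrite unit_diskE in hz.
  by rewrite psiK'//; split => //; apply: cdiff_cont; apply: hpsi; exact: phiU.
have hp z : nm z < 1 -> phi z != p.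
  by move=> hz; apply/eqP => E; apply: Up; rewrite -E; exact: phiU.
have nm01 : @ComplexField.Normc.normc R 0 < 1 by rewrite nm0.
have gphi : admissible phi p.
  split => // d d0; have [/ctsCP/(_ _ d0) [r r0 rH] _ _] := Upsi _ (phiU _ nm01).
  exists r => // z hz /rH; rewrite !psiK'//; by rewrite subr0.
pose u : R[i] := cis (2 * pi * theta).
have u1 : nm u = 1 by exact: nmcis.
have fphi z : nm z < 1 -> f (phi z) = phi (u * z).
  by move=> hz; apply: fconj; rewrite unit_diskE.
have [gamma [cgam gamU gaminf]] := hinf.
have [g [cg g1 ginf]] := access_of_curve cgam gamU gaminf (fun y Uy =>
  let: And3 a b c := Upsi y Uy in (conj a (conj b c))).
have [zeta zeta1 glim] := landing gphi cg g1 ginf.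
have acc0 : access phi zeta by split => //; exists g; split.
have acc k : access phi (cis (- (2 * pi * theta) * k%:R) * zeta).
  elim: k => [|k IH]; first by rewrite mulr0 cis0 mul1r.
  have -> : cis (- (2 * pi * theta) * k.+1%:R) * zeta = u^-1 * (cis (- (2 * pi * theta) * k%:R) * zeta).
    by rewrite !cis_natmul cisN exprS mulrA.
  exact: access_back u1 cf fphi IH.
have fiter k z : nm z < 1 -> iter k f (phi z) = phi (u ^+ k * z) /\ nm (u ^+ k * z) < 1.
  move=> hz; have nk j : nm (u ^+ j * z) < 1 by rewrite nmM nmX u1 expr1n mul1r.
  split => //; elim: k => [|k IH]; first by rewrite expr0 mul1r.
  by rewrite iterS IH fphi// mulrA -exprS.
have citer k z : ctsC (iter k f) z.
  by elim: k => [|k IH]; [exact: ct_id|exact: (ct_comp IH (cf _))].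
(* [b] is the angle of the [n]-fold rotation reduced modulo [2 * pi]; irrationality keeps it from
   being [0]. *)
pose l := Num.floor (n%:R * theta).
pose b : R := 2 * pi * (n%:R * theta - l%:~R).
have pi2 : 0 < 2 * pi :> R by rewrite mulr_gt0// pi_gt0.
have bI : 0 < b < 2 * pi.
  have := floor_itv (n%:R * theta); rewrite -/l rmorphD rmorph1 => /andP[l1 l2].
  have ne := irrational_mul l irr n0.
  have lt0 : 0 < n%:R * theta - l%:~R by rewrite lt_def ne subr_ge0.
  rewrite /b mulr_gt0//= -[ltRHS]mulr1 ltr_pM2l//; lra.
have ub : u ^+ n = cis b.
  rewrite /b mulrBr cisD -mulrN -rmorphN cis_int mulr1 /u -cis_natmul; congr cis; ring.
have [b0 b2] := andP bI.
have uP (k : nat) : exists w, [/\ nm w < 1 & nm (phi w - p) < k.+1%:R^-1].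
  have e0 : 0 < k.+1%:R^-1 :> R by rewrite invr_gt0.
  have [y Uy hy] := clp _ e0; have [_ h1 h2] := Upsi y Uy.
  by exists (psi y); split => //; rewrite h2.
have [w wP] := boolp.choice uP.
have [xi xiP] := bolzano_weierstrass (fun k => ltW (wP k).1).
have close (e : R) N : 0 < e -> exists2 k, nm (w k - xi) < e & nm (phi (w k) - p) < e /\ (N <= k)%N.
  move=> e0; pose M := (Num.trunc e^-1).+1.
  have [k kN hk] := xiP e e0 (maxn N M).
  move: kN; rewrite geq_max => /andP[Nk Mk]; exists k => //; split => //.
  apply: lt_le_trans (wP k).2 _; rewrite invf_ple ?posrE//.
  apply: ltW; apply: lt_le_trans (truncnS_gt _) _; rewrite ler_nat; exact: leq_trans Mk _.
(* At an interior limit point continuity would give [phi xi = p]. *)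
have xi1 : nm xi = 1.
  apply/eqP; rewrite eq_le; apply/andP; split.
    apply/ler_addgt0Pr => e /(close e 0%N) [k hk _].
    by have := (wP k).1; have := nm_sub xi (w k); rewrite nmBC; lra.
  rewrite leNgt; apply/negP => xi_lt1; have := hp _ xi_lt1; rewrite -subr_eq0 -nm_gt0 => q0.
  have q2 : 0 < nm (phi xi - p) / 2 by rewrite divr_gt0.
  have /ctsCP/(_ _ q2) [d d0 dH] := cdiff_cont (hphi _ xi_lt1).
  have e0 : 0 < Num.min d (nm (phi xi - p) / 2) by rewrite lt_min d0.
  have [k + [+ _]] := close _ 0%N e0; rewrite !lt_min => /andP[/dH h1 _] /andP[_ h2].
  have := nm_tri (phi xi) (phi (w k)) p; rewrite (nmBC (phi xi) (phi (w k))); lra.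
have xi0 : xi != 0 by rewrite -nm_gt0 xi1.
have [a0 Ea0] : exists a0 : R, zeta = xi * cis a0.
  have [|a0 Ea] := @cis_surj R (zeta / xi); first by rewrite nmM nmV zeta1 xi1 divr1.
  by exists a0; rewrite -Ea mulrC divfK.
(* Angles are measured from [xi], in units of a full turn for the density lemma. *)
have acc_in (c d : R) : c < d -> exists2 a, c < a < d & access phi (xi * cis a).
  move=> cd; have cd' : c / (2 * pi) < d / (2 * pi) by rewrite ltr_pM2r// invr_gt0.
  have [k [m /andP[h1 h2]]] := rotation_dense (a0 / (2 * pi)) irr cd'.
  exists (2 * pi * (a0 / (2 * pi) - k%:R * theta + m%:~R)).
    apply/andP; split; first by rewrite -ltr_pdivrMl// (mulrC _ c).
    by rewrite -ltr_pdivlMl// (mulrC _ d).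
  rewrite mulrDr mulrBr mulrCA divff ?gt_eqF// mulr1 !cisD cis_int mulr1.
  have -> : xi * (cis a0 * cis (- (2 * pi * (k%:R * theta)))) = cis (- (2 * pi * theta) * k%:R) * zeta.
    by rewrite Ea0 (_ : - (2 * pi * (k%:R * theta)) = - (2 * pi * theta) * k%:R); ring.
  exact: acc.
have [a1 a1I acc1] := acc_in _ _ b0.
have [a2 a2I acc2] := acc_in _ _ b2.
apply: (two_access hphi (hpsi _ (phiU _ nm01)) psiK' hp xi1 a1I a2I acc1 acc2) => e e0.
(* Continuity of the [n]-th iterate at its fixed point [p] makes [phi (w * cis b)] close to [p] once
   [phi w] is. *)
have /ctsCP/(_ _ e0) [d d0 dH] := citer n p.
have ed0 : 0 < Num.min e d by rewrite lt_min e0.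
have [k + [+ _]] := close _ 0%N ed0; rewrite !lt_min => /andP[h1 _] /andP[h2 h3].
exists (w k); split => //; first exact: (wP k).1.
have := dH _ h3; rewrite fnp (fiter n _ (wP k).1).1 ub.
by rewrite mulrC.
Qed.
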